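(* Consider the EC-LSVRG algorithm described in the context, where $Q$ and $Q_1$ are contraction compressors with parameters $\delta$ and $\delta_1$ respectively, which also satisfy $\mathbb{E}[Q(x)]=\delta x$ and $\mathbb{E}[Q_1(x)]=\delta_1x$; each $f_i^{(\tau)}$ is $L$-smooth, each $f^{(\tau)}$ is $\bar L$-smooth, $f$ is $L_f$-smooth, $\psi$ is $\mu$-strongly convex, and $L_f\ge\mu\ge0$. Put $\rho:=\min\{\frac{\mu\eta}{3},\frac{\delta}{4},\frac{\delta_1}{4},\frac p4\}$, $w_k:=(1-\rho)^{-k}$, $W_k:=\sum_{i=0}^k w_i$, $\bar x^k:=\frac1{W_k}\sum_{i=0}^k w_i x^i$, and $$M:=\frac{1-\delta}{\delta}\left(\frac{418L_f}{\delta}+\frac{3422\bar L}{\delta n}+\frac{1349L}{n}+\frac{\big(1671L_f+\frac{20364\bar L}{n}\big)p}{\delta\delta_1}\Big(1+\frac{2p}{\delta_1}\Big)\right)+4L_f+\frac{42L}{n},$$ $$\Delta_0:=\frac\mu2\|x^0-x^*\|^2+\frac12\big(P(x^0)-P(x^* )\big)+\frac1{40L_f}\|\nabla f(x^0)\|^2+\frac{3}{10L_f n}\sum_{\tau=1}^n\|\nabla f^{(\tau)}(x^0)-h_\tau^0\|^2 .$$ (i) Let $\eta\le1/M$. If $\mu>0$, then $$\mathbb{E}[P(\bar x^k)-P(x^* )]\le\frac{\Delta_0}{1-(1-\rho)^{k+1}}\,(1-\rho)^k.$$ If $\mu=0$, then $$\mathbb{E}[P(\bar x^k)-P(x^* )]\le\frac1{k+1}\left(\frac9{8\eta}\|x^0-x^*\|^2+\frac1{10L_fp}\|\nabla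 f(x^0)\|^2+\frac{6}{5L_fpn}\sum_{\tau=1}^n\|\nabla f^{(\tau)}(x^0)-h_\tau^0\|^2+\frac8{3p}\big(P(x^0)-P(x^* )\big)\right).$$ (ii) Let $\eta=1/M$ and $p\le O(\delta_1)$. If $\mu>0$ and $\epsilon\le\Delta_0$, then $\mathbb{E}[P(\bar x^k)-P(x^* )]\le\epsilon$ as long as $$k\ge O\left(\left(\frac1\delta+\frac1p+\frac{L_f}\mu+\frac L{n\mu}+\frac{(1-\delta)L_f}{\delta^2\mu}+\frac{(1-\delta)L}{n\delta\mu}\right)\ln\frac1\epsilon\right).$$ If $\mu=0$, then $\mathbb{E}[P(\bar x^k)-P(x^* )]\le\epsilon$ as long as $$k\ge O\left(\left(\frac1p+L_f+\frac Ln+\frac{(1-\delta)L_f}{\delta^2}+\frac{(1-\delta)L}{n\delta}\right)\frac1\epsilon\right).$$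
   Context: Problem: $\min_{x\in\mathbb{R}^d}P(x)=f(x)+\psi(x)$, where $f=\frac1n\sum_{\tau=1}^n f^{(\tau)}$, $f^{(\tau)}=\frac1m\sum_{i=1}^m f_i^{(\tau)}$, each $f_i^{(\tau)}:\mathbb{R}^d\to\mathbb{R}$ is convex and smooth, and $\psi:\mathbb{R}^d\to\mathbb{R}\cup\{+\infty\}$ is proper, closed and convex; $x^*$ is an optimal solution (assumed to exist). $\|\cdot\|$ is the Euclidean norm. ''$L$-smooth'' means differentiable with $L$-Lipschitz gradient. ''$\mu$-strongly convex'' ($\mu\ge0$) means $\psi-\frac\mu2\|\cdot\|^2$ is convex. A possibly randomized map $Q:\mathbb{R}^d\to\mathbb{R}^d$ is a contraction compressor with parameter $\delta\in(0,1]$ if $\mathbb{E}\|x-Q(x)\|^2\le(1-\delta)\|x\|^2$ for all $x\in\mathbb{R}^d$. EC-LSVRG algorithm. Parameters: stepsize $\eta>0$, probability $p\in(0,1]$. Initialization: $x^0=w^0\in\mathbb{R}^d$, $e_\tau^0=0$, $h_\tau^0\in\mathbb{R}^d$ for $1\le\tau\le n$, $h^0=\frac1n\sum_\tau h_\tau^0$. For $k=0,1,2,\dots$: for each $\tau$, sample $i_k^\tau$ uniformly and independently from $\{1,\dots,m\}$ and set $g_\tau^k=\nabla f^{(\tau)}_{i_k^\tau}(x^k)-\nabla f^{(\tau)}_{i_k^\tau}(w^k)+\nabla f^{(\tau)}(w^k)-h_\tau^k$, $\;y_\tau^k=Q(\eta g_\tau^k+e_\tau^k)$, $\;e_\tau^{k+1}=e_\tau^k+\eta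 g_\tau^k-y_\tau^k$, $\;z_\tau^k=Q_1(\nabla f^{(\tau)}(w^k)-h_\tau^k)$, $\;h_\tau^{k+1}=h_\tau^k+z_\tau^k$. Then $y^k=\frac1n\sum_\tau y_\tau^k$, $z^k=\frac1n\sum_\tau z_\tau^k$, $x^{k+1}=\mathrm{prox}_{\eta\psi}(x^k-(y^k+\eta h^k))$ with $\mathrm{prox}_{\eta\psi}(x)=\arg\min_y\{\frac12\|x-y\|^2+\eta\psi(y)\}$; $w^{k+1}=x^k$ with probability $p$ and $w^{k+1}=w^k$ with probability $1-p$; $h^{k+1}=h^k+z^k$.
   Formalization: L_f>0 is assumed. In (ii), L̄ is the least common smoothness modulus of the f^(τ) or satisfies L̄ ≤ nL_f; p ≤ cδ_1; the O-constant may depend on c and on a bound for Δ_0 (μ>0) or for the initial error (μ=0); for μ>0, ε ≤ ε_1 for a fixed ε_1<1, on which the constant may also depend. *)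

(* Defs.v *)
From HB Require Import structures.
From mathcomp Require Import all_boot all_order all_algebra.
From mathcomp Require Import all_classical all_reals all_analysis.

Set Implicit Arguments.
Unset Strict Implicit.
Unset Printing Implicit Defensive.

Import Order.TTheory GRing.Theory Num.Theory.
Import numFieldNormedType.Exports.

Local Open Scope classical_set_scope.
Local Open Scope ring_scope.

(* The library's norm on ['rV_d] is the sup norm, hence a separate Euclidean
   norm. Both induce the same topology, so [differentiable], [open] and
   [lower_semicontinuous] can be taken from the library. *)
Definition enorm (R : realType) (d : nat) (x : 'rV[R]_d) : R :=
  Num.sqrt (\sum_(j < d) x 0 j ^+ 2).

Definition grad (R : realType) (d : nat) (f : 'rV[R]_d -> R)
    (x : 'rV[R]_d) : 'rV[R]_d :=
  \row_(j < d) 'D_(delta_mx 0 j) f x.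

Definition smooth (R : realType) (d : nat) (L : R) (f : 'rV[R]_d -> R) : Prop :=
  (forall x, differentiable f x) /\
  (forall x y, enorm (grad f x - grad f y) <= L * enorm (x - y)).

Definition convex_fun (R : realType) (d : nat) (f : 'rV[R]_d -> R) : Prop :=
  convex_function [set: convex_lmodType 'rV[R]_d] f.

(* [0 * +oo = 0] in [\bar R], so the cases [t = 0] and [t = 1] are harmless. *)
Definition econvex (R : realType) (d : nat) (g : 'rV[R]_d -> \bar R) : Prop :=
  forall (x y : 'rV[R]_d) (t : R), 0 <= t <= 1 ->
    (g (t *: x + (1 - t) *: y)%R <= t%:E * g x + (1 - t)%:E * g y)%E.

Definition strongly_convex (R : realType) (d : nat) (mu : R)
    (g : 'rV[R]_d -> \bar R) : Prop :=
  econvex (fun x => g x - (mu / 2 * enorm x ^+ 2)%:E)%E.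

Definition proper_fun (R : realType) (d : nat) (g : 'rV[R]_d -> \bar R) : Prop :=
  (forall x, g x != -oo%E) /\ (exists x, g x < +oo)%E.

(* For proper, closed and convex [psi] and [eta > 0] the minimizer exists and is
   unique, so the default value [0] and the choice made by [xget] are immaterial. *)
Definition prox (R : realType) (d : nat) (eta : R) (psi : 'rV[R]_d -> \bar R)
    (v : 'rV[R]_d) : 'rV[R]_d :=
  let obj y := ((1 / 2 * enorm (v - y) ^+ 2)%:E + eta%:E * psi y)%E in
  xget 0 [set y | forall z, (obj y <= obj z)%E].

Record erm_problem (R : realType) (d n m : nat) := ErmProblem {
  loss : 'I_n -> 'I_m -> 'rV[R]_d -> R;
  psi : 'rV[R]_d -> \bar R;
  xstar : 'rV[R]_d;
  smL : R;
  smLbar : R;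
  smLf : R;
  sc_mu : R
}.

Definition fnode (R : realType) (d n m : nat) (pb : erm_problem R d n m)
    (tau : 'I_n) (x : 'rV[R]_d) : R :=
  m%:R^-1 * \sum_(i < m) loss pb tau i x.

Definition favg (R : realType) (d n m : nat) (pb : erm_problem R d n m)
    (x : 'rV[R]_d) : R :=
  n%:R^-1 * \sum_(tau < n) fnode pb tau x.

Definition objective (R : realType) (d n m : nat) (pb : erm_problem R d n m)
    (x : 'rV[R]_d) : \bar R :=
  ((favg pb x)%:E + psi pb x)%E.

(* [smLf] is a denominator in the bounds, hence [0 < smLf]. *)
Record erm_assumptions (R : realType) (d n m : nat)
    (pb : erm_problem R d n m) : Prop := ErmAssumptions {
  n_gt0 : (0 < n)%N;
  m_gt0 : (0 < m)%N;
  L_ge0 : 0 <= smL pb;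
  Lbar_ge0 : 0 <= smLbar pb;
  Lf_gt0 : 0 < smLf pb;
  mu_ge0 : 0 <= sc_mu pb;
  mu_le_Lf : sc_mu pb <= smLf pb;
  loss_convex : forall tau i, convex_fun (loss pb tau i);
  loss_smooth : forall tau i, smooth (smL pb) (loss pb tau i);
  fnode_smooth : forall tau, smooth (smLbar pb) (fnode pb tau);
  favg_smooth : smooth (smLf pb) (favg pb);
  psi_proper : proper_fun (psi pb);
  psi_closed : lower_semicontinuous (psi pb);
  psi_strongly_convex : strongly_convex (sc_mu pb) (psi pb);
  xstar_opt : forall x, (objective pb (xstar pb) <= objective pb x)%E
}.

(* A possibly randomized map: [rmap s x] is the output on [x] when the internal
   randomness takes the value [s], drawn from [seed_law]. The input space carries
   its Borel sigma-algebra. *)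
Record random_map (R : realType) (d : nat) := RandomMap {
  seed_display : measure_display;
  seed : measurableType seed_display;
  seed_law : probability seed R;
  rmap : seed -> 'rV[R]_d -> 'rV[R]_d;
  rmap_measurable : forall j : 'I_d,
    measurable_fun setT
      (fun sx : seed * g_sigma_algebraType (@open 'rV[R]_d) =>
         rmap sx.1 sx.2 0 j)
}.

Definition contraction_compressor (R : realType) (d : nat) (delta : R)
    (Q : random_map R d) : Prop :=
  0 < delta <= 1 /\
  forall x : 'rV[R]_d,
    ('E_(seed_law Q)[fun s => (enorm (x - rmap s x) ^+ 2)%R]
       <= ((1 - delta) * enorm x ^+ 2)%:E)%E.

Definition mean_scaling (R : realType) (d : nat) (delta : R)
    (Q : random_map R d) : Prop :=
  forall (x : 'rV[R]_d) (j : 'I_d),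
    ('E_(seed_law Q)[fun s => rmap s x 0%R j] = (delta * x 0 j)%:E)%E.

(* All the randomness used in one iteration; [coin = true] means that the
   reference point [w] is refreshed. *)
Record draw (n m : nat) (S S1 : Type) := Draw {
  idx : 'I_n -> 'I_m;
  seedQ : 'I_n -> S;
  seedQ1 : 'I_n -> S1;
  coin : bool
}.

Inductive source (n : nat) :=
  | IdxSource of nat & 'I_n
  | QSource of nat & 'I_n
  | Q1Source of nat & 'I_n
  | CoinSource of nat.

Definition source_events (n m : nat) (dO dS dS1 : measure_display)
    (Omega : measurableType dO) (S : measurableType dS) (S1 : measurableType dS1)
    (D : nat -> Omega -> draw n m S S1) (s : source n) : set (set Omega) :=
  match s with
  | IdxSource k tau =>
      preimage_set_system setT (fun omega => idx (D k omega) tau) setT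
  | QSource k tau =>
      preimage_set_system setT (fun omega => seedQ (D k omega) tau) measurable
  | Q1Source k tau =>
      preimage_set_system setT (fun omega => seedQ1 (D k omega) tau) measurable
  | CoinSource k =>
      preimage_set_system setT (fun omega => coin (D k omega)) setT
  end.

Definition mutually_independent (R : realType) (dO : measure_display)
    (Omega : measurableType dO) (Pr : probability Omega R) (I : Type)
    (F : I -> set (set Omega)) : Prop :=
  forall (N : nat) (s : 'I_N -> I) (A : 'I_N -> set Omega),
    injective s -> (forall i, F (s i) (A i)) ->
    Pr (\bigcap_i A i) = (\prod_(i < N) Pr (A i))%E.

Record sampling_assumptions (R : realType) (d n m : nat)
    (Q Q1 : random_map R d) (p : R) (dO : measure_display)
    (Omega : measurableType dO) (Pr : probability Omega R)
    (D : nat -> Omega -> draw n m (seed Q) (seed Q1)) : Prop :=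
  SamplingAssumptions {
  sources_measurable : forall s, source_events D s `<=` measurable;
  idx_uniform : forall k tau (i : 'I_m),
    Pr [set omega | idx (D k omega) tau = i] = (m%:R^-1)%:E;
  seedQ_law : forall k tau B, measurable B ->
    Pr [set omega | B (seedQ (D k omega) tau)] = seed_law Q B;
  seedQ1_law : forall k tau B, measurable B ->
    Pr [set omega | B (seedQ1 (D k omega) tau)] = seed_law Q1 B;
  coin_law : forall k, Pr [set omega | coin (D k omega)] = p%:E;
  sources_independent : mutually_independent Pr (source_events D)
}.

Record state (R : realType) (d n : nat) := State {
  st_x : 'rV[R]_d;
  st_w : 'rV[R]_d;
  st_e : 'I_n -> 'rV[R]_d;
  st_h : 'I_n -> 'rV[R]_d;
  st_hbar : 'rV[R]_d
}.

Definition mean (R : realType) (d n : nat) (v : 'I_n -> 'rV[R]_d) : 'rV[R]_d :=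
  n%:R^-1 *: \sum_(tau < n) v tau.

Definition init_state (R : realType) (d n : nat) (x0 : 'rV[R]_d)
    (h0 : 'I_n -> 'rV[R]_d) : state R d n :=
  State x0 x0 (fun=> 0) h0 (mean h0).

Definition ec_lsvrg_step (R : realType) (d n m : nat) (pb : erm_problem R d n m)
    (Q Q1 : random_map R d) (eta : R) (r : draw n m (seed Q) (seed Q1))
    (st : state R d n) : state R d n :=
  let: State x w e h hbar := st in
  let g tau := grad (loss pb tau (idx r tau)) x
               - grad (loss pb tau (idx r tau)) w
               + grad (fnode pb tau) w - h tau in
  let y tau := rmap (seedQ r tau) (eta *: g tau + e tau) in
  let z tau := rmap (seedQ1 r tau) (grad (fnode pb tau) w - h tau) in
  State
    (prox eta (psi pb) (x - (mean y + eta *: hbar)))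
    (if coin r then x else w)
    (fun tau => e tau + eta *: g tau - y tau)
    (fun tau => h tau + z tau)
    (hbar + mean z).

Record ec_lsvrg (R : realType) := EcLsvrg {
  dim : nat;
  nodes : nat;
  samples : nat;
  pb : erm_problem R dim nodes samples;
  compQ : random_map R dim;
  compQ1 : random_map R dim;
  delta : R;
  delta1 : R;
  eta : R;
  prob_w : R;
  x_init : 'rV[R]_dim;
  h_init : 'I_nodes -> 'rV[R]_dim;
  omega_display : measure_display;
  Omega : measurableType omega_display;
  Pr : probability Omega R;
  draws : nat -> Omega -> draw nodes samples (seed compQ) (seed compQ1)
}.

Record ec_lsvrg_assumptions (R : realType) (A : ec_lsvrg R) : Prop :=
  EcLsvrgAssumptions {
  A_problem : erm_assumptions (pb A);
  A_compressor : contraction_compressor (delta A) (compQ A);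
  A_compressor1 : contraction_compressor (delta1 A) (compQ1 A);
  A_mean : mean_scaling (delta A) (compQ A);
  A_mean1 : mean_scaling (delta1 A) (compQ1 A);
  A_eta : 0 < eta A;
  A_p : 0 < prob_w A <= 1;
  A_sampling : sampling_assumptions (prob_w A) (Pr A) (@draws R A)
}.

Fixpoint iterate (R : realType) (A : ec_lsvrg R) (k : nat) (omega : Omega A) :
    state R (dim A) (nodes A) :=
  if k is k'.+1
  then ec_lsvrg_step (pb A) (eta A) (draws k' omega) (iterate k' omega)
  else init_state (x_init A) (@h_init R A).

Definition rho (R : realType) (A : ec_lsvrg R) : R :=
  Num.min (sc_mu (pb A) * eta A / 3)
    (Num.min (delta A / 4) (Num.min (delta1 A / 4) (prob_w A / 4))).

Definition weight (R : realType) (A : ec_lsvrg R) (k : nat) : R :=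
  (1 - rho A) ^- k.

Definition weight_sum (R : realType) (A : ec_lsvrg R) (k : nat) : R :=
  \sum_(i < k.+1) weight A i.

Definition xbar (R : realType) (A : ec_lsvrg R) (k : nat) (omega : Omega A) :
    'rV[R]_(dim A) :=
  (weight_sum A k)^-1 *: \sum_(i < k.+1) weight A i *: st_x (iterate i omega).

Definition expected_gap (R : realType) (A : ec_lsvrg R) (k : nat) : \bar R :=
  (\int[Pr A]_omega
     (objective (pb A) (xbar k omega) - objective (pb A) (xstar (pb A))))%E.

Definition bigM (R : realType) (A : ec_lsvrg R) : R :=
  let: P := pb A in
  let: N := (nodes A)%:R in
  (1 - delta A) / delta A *
    (418 * smLf P / delta A + 3422 * smLbar P / (delta A * N) + 1349 * smL P / N
     + (1671 * smLf P + 20364 * smLbar P / N) * prob_w A / (delta A * delta1 A)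
       * (1 + 2 * prob_w A / delta1 A))
  + 4 * smLf P + 42 * smL P / N.

Definition init_dist (R : realType) (A : ec_lsvrg R) : R :=
  enorm (x_init A - xstar (pb A)) ^+ 2.

Definition init_grad (R : realType) (A : ec_lsvrg R) : R :=
  enorm (grad (favg (pb A)) (x_init A)) ^+ 2.

Definition init_shift (R : realType) (A : ec_lsvrg R) : R :=
  \sum_(tau < nodes A)
    enorm (grad (fnode (pb A) tau) (x_init A) - h_init tau) ^+ 2.

(* Equal to [+oo] when [x_init A] lies outside the domain of [psi]. *)
Definition init_gap (R : realType) (A : ec_lsvrg R) : \bar R :=
  (objective (pb A) (x_init A) - objective (pb A) (xstar (pb A)))%E.

Definition Delta0 (R : realType) (A : ec_lsvrg R) : \bar R :=
  ((sc_mu (pb A) / 2 * init_dist A)%:E + (1 / 2)%:E * init_gap A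
   + (1 / (40 * smLf (pb A)) * init_grad A
      + 3 / (10 * smLf (pb A) * (nodes A)%:R) * init_shift A)%:E)%E.

(* The initial quantities that an O(.) bound without strong convexity hides in
   its constant. *)
Definition initial_error (R : realType) (A : ec_lsvrg R) : \bar R :=
  ((init_dist A)%:E + init_gap A
   + (init_grad A / smLf (pb A)
      + init_shift A / (smLf (pb A) * (nodes A)%:R))%:E)%E.

(* By convexity every [fnode] is [n * smLf]-smooth, so the least common
   smoothness modulus of the [fnode] is at most [n * smLf]. [smooth smLbar] alone
   also holds for arbitrarily large [smLbar]; the step size [1 / bigM] then
   tends to [0], and no complexity estimate free of [smLbar] can hold. *)
Definition Lbar_tight (R : realType) (A : ec_lsvrg R) : Prop :=
  (forall L', 0 <= L' -> (forall tau, smooth L' (fnode (pb A) tau)) ->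
     smLbar (pb A) <= L') \/
  smLbar (pb A) <= (nodes A)%:R * smLf (pb A).

Definition complexity_strong (R : realType) (A : ec_lsvrg R) : R :=
  let: P := pb A in
  let: N := (nodes A)%:R in
  1 / delta A + 1 / prob_w A + smLf P / sc_mu P + smL P / (N * sc_mu P)
  + (1 - delta A) * smLf P / (delta A ^+ 2 * sc_mu P)
  + (1 - delta A) * smL P / (N * delta A * sc_mu P).

Definition complexity_convex (R : realType) (A : ec_lsvrg R) : R :=
  let: P := pb A in
  let: N := (nodes A)%:R in
  1 / prob_w A + smLf P + smL P / N
  + (1 - delta A) * smLf P / delta A ^+ 2
  + (1 - delta A) * smL P / (N * delta A).

(* Main.v *)
(* With e the node average of the compression errors, the virtual iterate x - e
   follows an exact proximal gradient step up to the sampling noise, so the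
   objective gap obeys a one-step inequality driven by |e|^2 and by the sampling
   variance. Since Q(x) - delta x is centred given the past and the nodes draw
   independently, averaging over the nodes improves the noise terms by 1/n, and
   |e|^2, the node errors, the distances of the gradients at w to the shifts h,
   and the Bregman distance at w satisfy coupled linear recurrences. Each of them
   contracts at a rate of at least 2 rho, so after summation with the weights
   (1 - rho)^-k they are bounded by the weighted sum of the gaps with a
   coefficient that the step size makes small, and are absorbed. Jensen's
   inequality passes to the averaged iterate, and the complexity bounds follow
   from eta = 1/M together with Lbar <= n L_f. *)

(* No conditional expectation is formed. All sources are put in one sequence (in a round: indices,
   seeds of [Q], seeds of [Q1], coin), and a noise term counts as centred when it is orthogonal to
   every square-integrable vector determined by earlier sources; independence and Fubini give this.
   The order matters: the new shifts are known before the coin is tossed.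

   The obstacle is that the error of a single node has only the factor 1 - delta to pay for Young's
   inequality, whereas the averaged error has (1 - delta)^2 plus a centred part of size 1/n. So
   errors and shifts each need two recurrences, the node one feeding the averaged one with weight
   1/n. Their rates are at least delta/2, delta1/2 and p; as rho is at most a quarter of delta,
   delta1 and p, at least half of each rate survives the weights, and mu eta/3 stays below the gain
   mu eta/2 of one step.

   [psi] may be infinite. A start outside its domain makes the bounds infinite, so only starts
   inside it need an argument. Integrability of the gap is not assumed: it is read off the one-step
   inequality. *)
From HB Require Import structures.
Require Import Defs.
From mathcomp Require Import all_boot all_order all_algebra.
From mathcomp Require Import all_classical all_reals all_analysis.
From mathcomp Require Import measurable_realfun ring lra zify.

Set Implicit Arguments.
Unset Strict Implicit.
Unset Printing Implicit Defensive.

Import Order.TTheory GRing.Theory Num.Theory.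
Import numFieldNormedType.Exports.

Local Open Scope classical_set_scope.
Local Open Scope ring_scope.

(** * Euclidean geometry *)

Section Euclid.
Context (R : realType) (d : nat).
Implicit Types u v w : 'rV[R]_d.

Definition dot u v : R := \sum_(j < d) u 0 j * v 0 j.
Definition nsq u : R := dot u u.

Lemma dotC u v : dot u v = dot v u.
Proof. by apply: eq_bigr => j _; rewrite mulrC. Qed.

Lemma dotDl u v w : dot (u + v) w = dot u w + dot v w.
Proof. by rewrite -big_split; apply: eq_bigr => j _; rewrite mxE mulrDl. Qed.

Lemma dotZl a u v : dot (a *: u) v = a * dot u v.
Proof. by rewrite mulr_sumr; apply: eq_bigr => j _; rewrite mxE mulrA. Qed.

Lemma dotNl u v : dot (- u) v = - dot u v.
Proof. by rewrite -scaleN1r dotZl mulN1r. Qed.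

Lemma dot0l u : dot 0 u = 0.
Proof. by rewrite -(scale0r 0) dotZl mul0r. Qed.

Lemma dotDr u v w : dot u (v + w) = dot u v + dot u w.
Proof. by rewrite dotC dotDl !(dotC _ u). Qed.

Lemma dotZr a u v : dot u (a *: v) = a * dot u v.
Proof. by rewrite dotC dotZl dotC. Qed.

Lemma dotNr u v : dot u (- v) = - dot u v.
Proof. by rewrite dotC dotNl dotC. Qed.

Lemma dot0r u : dot u 0 = 0.
Proof. by rewrite dotC dot0l. Qed.

Lemma dot_suml (I : Type) (s : seq I) (P : pred I) (F : I -> 'rV[R]_d) u :
  dot (\sum_(i <- s | P i) F i) u = \sum_(i <- s | P i) dot (F i) u.
Proof.
by elim/big_rec2: _ => [|i x y _ <-]; rewrite ?dot0l ?dotDl.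
Qed.

Definition dotE := (dotDl, dotDr, dotNl, dotNr, dotZl, dotZr, dot0l, dot0r).

Lemma nsq_ge0 u : 0 <= nsq u.
Proof. by apply: sumr_ge0 => j _; rewrite -expr2 sqr_ge0. Qed.

Lemma nsqE u : nsq u = \sum_(j < d) u 0 j ^+ 2.
Proof. by apply: eq_bigr => j _; rewrite expr2. Qed.

Lemma nsq0 : nsq 0 = 0. Proof. exact: dot0l. Qed.

Lemma nsqD u v : nsq (u + v) = nsq u + 2 * dot u v + nsq v.
Proof. by rewrite /nsq !dotE (dotC v u); ring. Qed.

Lemma nsqB u v : nsq (u - v) = nsq u - 2 * dot u v + nsq v.
Proof. by rewrite /nsq !dotE (dotC v u); ring. Qed.

Lemma nsqZ a u : nsq (a *: u) = a ^+ 2 * nsq u.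
Proof. by rewrite /nsq !dotE; ring. Qed.

Lemma nsqN u : nsq (- u) = nsq u.
Proof. by rewrite /nsq !dotE opprK. Qed.

Lemma nsqBC u v : nsq (u - v) = nsq (v - u).
Proof. by rewrite -nsqN opprB. Qed.

Lemma nsq_eq0 u : nsq u <= 0 -> u = 0.
Proof.
move=> u0; apply/rowP => j; rewrite mxE; apply/eqP; rewrite -sqrf_eq0 eq_le sqr_ge0 andbT.
apply: le_trans u0; rewrite nsqE (bigD1 j)//= lerDl.
by apply: sumr_ge0 => i _; exact: sqr_ge0.
Qed.

Lemma enorm_sq u : enorm u ^+ 2 = nsq u.
Proof. by rewrite /enorm -nsqE sqr_sqrtr ?nsq_ge0. Qed.

Lemma enorm_ge0 u : 0 <= enorm u. Proof. exact: sqrtr_ge0. Qed.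

Lemma dot_young (a : R) u v : 0 < a -> 2 * dot u v <= a * nsq u + a^-1 * nsq v.
Proof.
move=> a0; have := nsq_ge0 (a *: u - v).
rewrite nsqB nsqZ dotZl => H.
have -> : a * nsq u + a^-1 * nsq v =
   2 * dot u v + a^-1 * (a ^+ 2 * nsq u - 2 * (a * dot u v) + nsq v).
  by field; rewrite gt_eqF.
by rewrite lerDl mulr_ge0// invr_ge0 ltW.
Qed.

Lemma nsqD_le (a : R) u v : 0 < a ->
  nsq (u + v) <= (1 + a) * nsq u + (1 + a^-1) * nsq v.
Proof. by move=> a0; have := dot_young u v a0; rewrite nsqD; lra. Qed.

Lemma nsqD_le2 u v : nsq (u + v) <= 2 * nsq u + 2 * nsq v.
Proof. by have := @nsqD_le 1 u v ltr01; rewrite invr1. Qed.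

Lemma cauchy_schwarz u v : dot u v ^+ 2 <= nsq u * nsq v.
Proof.
have [/nsq_eq0 ->|v0] := leP (nsq v) 0.
  by rewrite dot0r nsq0 expr0n mulr0.
have := nsq_ge0 (nsq v *: u - dot u v *: v).
rewrite nsqB !nsqZ !dotE => H.
have : 0 <= nsq v * (nsq u * nsq v - dot u v ^+ 2) by move: H; rewrite /nsq; lra.
by rewrite pmulr_rge0// subr_ge0.
Qed.

Lemma dot_le_enorm u v : dot u v <= enorm u * enorm v.
Proof.
apply: le_trans (ler_norm _) _.
rewrite -(@ler_pXn2r _ 2)// ?nnegrE ?mulr_ge0 ?enorm_ge0//.
by rewrite real_normK ?num_real// exprMn !enorm_sq cauchy_schwarz.
Qed.

Lemma enorm_le_sq (a : R) u v : 0 <= a -> enorm u <= a * enorm v ->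
  nsq u <= a ^+ 2 * nsq v.
Proof.
move=> a0 uv; rewrite -!enorm_sq -exprMn ler_pXn2r// nnegrE ?mulr_ge0 ?enorm_ge0//.
Qed.

(** The average of [nsq (F i - mean F)] is nonnegative and is the difference of the two sides. *)
Lemma nsq_mean_le (n : nat) (F : 'I_n -> 'rV[R]_d) :
  nsq (mean F) <= n%:R^-1 * \sum_(i < n) nsq (F i).
Proof.
case: n F => [|n] F; first by rewrite /mean !big_ord0 scaler0 nsq0 mulr0.
have N0 : 0 < n.+1%:R :> R by rewrite ltr0n.
have : 0 <= n.+1%:R^-1 * \sum_(i < n.+1) nsq (F i - mean F).
  by rewrite mulr_ge0 ?invr_ge0 ?ler0n// sumr_ge0// => i _; exact: nsq_ge0.
under eq_bigr do rewrite nsqB.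
rewrite big_split/= sumrB sumr_const card_ord -mulr_sumr -dot_suml.
have -> : \sum_(i < n.+1) F i = n.+1%:R *: mean F.
  by rewrite /mean scalerA divff ?scale1r// gt_eqF.
rewrite dotZl -/(nsq _) -(mulr_natr (nsq (mean F))) mulrDr mulrBr => H.
have E1 : n.+1%:R^-1 * (2 * (n.+1%:R * nsq (mean F))) = 2 * nsq (mean F).
  by field; rewrite gt_eqF.
have E2 : n.+1%:R^-1 * (nsq (mean F) * n.+1%:R) = nsq (mean F).
  by field; rewrite gt_eqF.
by move: H; rewrite E1 E2; set S := _ * \sum_(_ < _) _; lra.
Qed.

Lemma nsq_center_le (n : nat) (F : 'I_n -> 'rV[R]_d) :
  \sum_(i < n) nsq (F i - mean F) <= \sum_(i < n) nsq (F i).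
Proof.
case: n F => [|n] F; first by rewrite !big_ord0.
have N0 : n.+1%:R != 0 :> R by rewrite pnatr_eq0.
under eq_bigr do rewrite nsqB.
rewrite big_split/= sumrB sumr_const card_ord -mulr_sumr -dot_suml.
have -> : \sum_(i < n.+1) F i = n.+1%:R *: mean F.
  by rewrite /mean scalerA divff ?scale1r.
rewrite dotZl -/(nsq _) -(mulr_natr (nsq (mean F))) (mulrC _ n.+1%:R).
have : 0 <= n.+1%:R * nsq (mean F) by rewrite mulr_ge0 ?nsq_ge0.
set a := _ * nsq _; set b := \sum_(_ < _) _; lra.
Qed.

(** Young's inequality with weight [a] against [(1 - a) *: v]. In use a factor [(1 - a) ^+ 2] is at
    hand: one factor is spent here, the other survives as the contraction of the averaged error. *)
Lemma contract_young1 (a : R) u v : 0 < a <= 1 ->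
  (1 - a) * nsq (u + v) <= nsq u + (1 - a) / a * nsq v.
Proof.
move=> /andP[a0 a1]; rewrite nsqD.
have := dot_young u ((1 - a) *: v) a0; rewrite dotZr nsqZ => Y.
have -> : (1 - a) / a * nsq v = (1 - a) * nsq v + a^-1 * ((1 - a) ^+ 2 * nsq v).
  by field; rewrite gt_eqF.
by move: Y; set b := a^-1 * _; lra.
Qed.

(** For the errors of single nodes, which shrink only by [1 - a]: the whole factor is spent, and
    half of the contraction is given up to Young's inequality. *)
Lemma contract_young2 (a : R) u v : 0 < a <= 1 ->
  (1 - a) * nsq (u + v) <= (1 - a / 2) * nsq u + 2 * ((1 - a) / a) * nsq v.
Proof.
move=> /andP[a0 a1]; rewrite nsqD.
have a20 : 0 < a / 2 by rewrite divr_gt0.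
have := dot_young u ((1 - a) *: v) a20; rewrite dotZr nsqZ => Y.
have -> : 2 * ((1 - a) / a) * nsq v = (1 - a) * nsq v + (1 - a) * nsq v
    + (a / 2)^-1 * ((1 - a) ^+ 2 * nsq v) by field; rewrite gt_eqF.
have : 0 <= (1 - a) * nsq v by rewrite mulr_ge0 ?subr_ge0 ?nsq_ge0.
by move: Y; set b := (a / 2)^-1 * _; lra.
Qed.

End Euclid.

(** * Gradients and Bregman distances *)

Section Gradient.
Context (R : realType) (d : nat).
Implicit Types (f g : 'rV[R]_d -> R) (x y v : 'rV[R]_d).

Lemma derive_grad f x v : differentiable f x -> 'D_v f x = dot (grad f x) v.
Proof.
move=> df; rewrite deriveE// {1}(row_sum_delta v) linear_sum /dot.
by apply: eq_bigr => j _; rewrite linearZ mxE deriveE// mulrC.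
Qed.

Lemma is_derive_line f x v (t : R) : (forall z, differentiable f z) ->
  is_derive t 1 (fun s : R => f (x + s *: v)) (dot (grad f (x + t *: v)) v).
Proof.
move=> df; rewrite -derive_grad//.
have E : (fun h : R => h^-1 *: (((fun s : R => f (x + s *: v)) \o shift t) (h *: 1) - f (x + t *: v))) =
    (fun h : R => h^-1 *: ((f \o shift (x + t *: v)) (h *: v) - f (x + t *: v))).
  apply/funext => h /=; congr (_ *: (f _ - _)).
  by rewrite /GRing.scale/= mulr1 -/(GRing.scale _ _) scalerDl addrCA.
have D : derivable f (x + t *: v) v by exact: diff_derivable.
by apply: DeriveDef; rewrite /derivable /derive E.
Qed.

Definition bregman f x y : R := f x - f y - dot (grad f y) (x - y).

Lemma smooth_nsq (L : R) f x y : 0 <= L -> smooth L f ->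
  nsq (grad f x - grad f y) <= L ^+ 2 * nsq (x - y).
Proof. by move=> L0 [_ /(_ x y)]; exact: enorm_le_sq. Qed.

Lemma descent (L : R) f x y : 0 <= L -> smooth L f ->
  `|bregman f x y| <= L / 2 * nsq (x - y).
Proof.
move=> L0 [df Lf].
suff H (s : R) : `|s| <= 1 -> s * bregman f x y <= L / 2 * nsq (x - y).
  have := H 1; have := H (-1); rewrite normrN normr1 lexx ler_norml => /(_ isT) H1 /(_ isT) H2.
  by move: H1 H2; lra.
move=> s1.
pose v := x - y.
(* The quadratic correction makes [G] nonincreasing on the unit interval, so the mean value theorem
   gives [G 1 <= G 0]. The sign [s] treats both halves of the absolute value at once. *)
pose G (t : R) := s * (f (y + t *: v) - t * dot (grad f y) v) - L / 2 * nsq v * t ^+ 2.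
pose dG (t : R) := s * (dot (grad f (y + t *: v)) v - dot (grad f y) v) - L * nsq v * t.
have dGP (t : R) : is_derive t 1 G (dG t).
  have H := is_derive_line y v t df.
  apply: is_derive_eq; rewrite /dG !scaler1 /GRing.scale /=; by field.
have cG : {within `[0, 1], continuous G}.
  apply: derivable_within_continuous => r _; by have [] := dGP r.
have [c + E] := MVT ltr01 (fun t _ => dGP t) cG.
rewrite in_itv/= => /andP[c0 c1].
have : dG c <= 0.
  rewrite /dG subr_le0 -dotNl -dotDl.
  apply: le_trans (ler_norm _) _; rewrite normrM.
  apply: (@le_trans _ _ (1 * `|dot (grad f (y + c *: v) - grad f y) v|)).
    exact: ler_wpM2r.
  rewrite mul1r.
  have K (w : 'rV[R]_d) : enorm w = enorm v ->
      dot (grad f (y + c *: v) - grad f y) w <= L * nsq v * c.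
    move=> wv; apply: le_trans (dot_le_enorm _ _) _; rewrite wv.
    have := Lf (y + c *: v) y; rewrite addrAC subrr add0r.
    have -> : enorm (c *: v) = c * enorm v.
      by rewrite /enorm -!nsqE nsqZ sqrtrM ?sqr_ge0// sqrtr_sqr ger0_norm// ltW.
    move=> /(ler_wpM2r (enorm_ge0 v)); rewrite -enorm_sq => /le_trans; apply.
    by rewrite le_eqVlt; apply/orP; left; apply/eqP; ring.
  rewrite ler_norml K// andbT lerNl -dotNr K//.
  by rewrite /enorm -!nsqE nsqN.
move: E; rewrite subr0 mulr1 => <-.
rewrite /G scale0r addr0 scale1r !mul0r !mul1r subr0 expr0n expr1n mulr0 subr0 mulr1.
have -> : y + v = x by rewrite /v addrC subrK.
by rewrite /bregman -/v; lra.
Qed.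

Lemma bregman_le (L : R) f x y : 0 <= L -> smooth L f ->
  bregman f x y <= L / 2 * nsq (x - y).
Proof. by move=> L0 /(descent x y L0); exact/le_trans/ler_norm. Qed.

Lemma convex_funE f x y (t : R) : convex_fun f -> 0 <= t <= 1 ->
  f (t *: x + (1 - t) *: y) <= t * f x + (1 - t) * f y.
Proof.
move=> cf /andP[t0 t1].
have := cf (Itv01 t0 t1) x y; rewrite !inE => /(_ Logic.I Logic.I).
by [].
Qed.

Lemma bregman_ge0 (L : R) f x y : 0 <= L -> smooth L f -> convex_fun f ->
  0 <= bregman f x y.
Proof.
move=> L0 Lf cf; rewrite leNgt; apply/negP => B0.
(* a small step from y towards x contradicts the quadratic lower bound *)
pose b := - bregman f x y.
have b0 : 0 < b by rewrite /b oppr_gt0.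
(* This choice keeps [t] in (0, 1] and gives [L * t * nsq (x - y) = b - t * b < b], whereas
   convexity would force [b <= L / 2 * t * nsq (x - y)]. *)
pose t := b / (L * nsq (x - y) + b).
have D0 : 0 < L * nsq (x - y) + b by rewrite ltr_wpDl// mulr_ge0// nsq_ge0.
have t0 : 0 < t by rewrite divr_gt0.
have t1 : t <= 1 by rewrite ler_pdivrMr// mul1r lerDr mulr_ge0// nsq_ge0.
have t01 : 0 <= t <= 1 by rewrite ltW.
have := convex_funE x y cf t01.
have zE : t *: x + (1 - t) *: y = y + t *: (x - y).
  by rewrite scalerBl scale1r scalerBr addrCA addrA.
rewrite zE => H1.
have := descent (y + t *: (x - y)) y L0 Lf.
rewrite ler_norml => /andP[+ _].
rewrite /bregman [y + _ - y]addrAC subrr add0r dotZr nsqZ => H2.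
have E : t * (L * nsq (x - y) + b) = b by rewrite /t divfK// gt_eqF.
have : t * (b - L / 2 * (t * nsq (x - y))) <= 0.
  by move: H1 H2; rewrite /b /bregman expr2; lra.
rewrite pmulr_rle0// subr_le0 => H3.
have tN : 0 <= t * L * nsq (x - y) by rewrite mulr_ge0 ?nsq_ge0// mulr_ge0// ltW.
have tb : 0 < t * b by exact: mulr_gt0.
by move: H3 E tN tb; lra.
Qed.

Lemma bregman_first_order (L : R) f x y : 0 <= L -> smooth L f -> convex_fun f ->
  f y + dot (grad f y) (x - y) <= f x.
Proof. by move=> L0 Lf cf; have := bregman_ge0 x y L0 Lf cf; rewrite /bregman; lra. Qed.

(** At the gradient-step point [x - s *: D], the Bregman lower bound seen from [y] meets the
    quadratic upper bound seen from [x]; [s = L^-1] is the best step, and for [L = 0] arbitrarily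
    long steps force [D = 0]. The hypothesis is a bound on Bregman distances rather than [smooth],
    so that [smooth_of_bregman] can use the lemma to derive smoothness. *)
Lemma cocoercive (L : R) f x y : 0 <= L ->
  (forall u v, 0 <= bregman f u v <= L / 2 * nsq (u - v)) ->
  nsq (grad f x - grad f y) <= 2 * L * bregman f x y.
Proof.
move=> L0 H; set D := grad f x - grad f y.
have step (s : R) : (s - L / 2 * s ^+ 2) * nsq D <= bregman f x y.
  have /andP[H1 _] := H (x - s *: D) y; have /andP[_ H2] := H (x - s *: D) x.
  move: H1 H2; rewrite /bregman [x - _ - x]addrAC subrr add0r [x - _ - y]addrAC.
  rewrite nsqN nsqZ [dot _ (x - y - _)]dotDr !dotNr !dotZr.
  have : nsq D = dot (grad f x) D - dot (grad f y) D by rewrite /nsq {1}/D !dotE.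
  by move=> ->; lra.
have B0 : 0 <= bregman f x y by case/andP: (H x y).
have [L_le0|L_gt0] := leP L 0.
  have -> : L = 0 by apply/eqP; rewrite eq_le L_le0.
  rewrite mulr0 mul0r leNgt; apply/negP => D0.
  have := step ((bregman f x y + 1) / nsq D).
  have -> : L = 0 by apply/eqP; rewrite eq_le L_le0.
  by rewrite !mul0r subr0 divfK ?gt_eqF//; lra.
have := step L^-1.
have -> : L^-1 - L / 2 * L^-1 ^+ 2 = (2 * L)^-1 by field; rewrite gt_eqF.
by rewrite ler_pdivrMl// mulr_gt0.
Qed.

Lemma smooth_cocoercive (L : R) f x y : 0 <= L -> smooth L f -> convex_fun f ->
  nsq (grad f x - grad f y) <= 2 * L * bregman f x y.
Proof.
move=> L0 Lf cf; apply: cocoercive => // u v.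
by rewrite (bregman_ge0 _ _ L0)//= bregman_le.
Qed.

(** With [z] the optimum, this turns the change of a gradient between the iterate and the reference
    point into Bregman distances that the gap controls. *)
Lemma smooth_diff (L : R) f a b z : 0 <= L -> smooth L f ->
  convex_fun f ->
  nsq (grad f a - grad f b) <= 4 * L * (bregman f a z + bregman f b z).
Proof.
move=> L0 Lf Cf.
have H1 := smooth_cocoercive a z L0 Lf Cf; have H2 := smooth_cocoercive b z L0 Lf Cf.
have := nsqD_le2 (grad f a - grad f z) (- (grad f b - grad f z)).
have -> : grad f a - grad f z - (grad f b - grad f z) = grad f a - grad f b.
  by rewrite opprB addrA subrK.
rewrite nsqN; move: H1 H2; move: (nsq _) (nsq _) (nsq _) (bregman _ _ _) (bregman _ _ _).
by move=> *; lra.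
Qed.

(** Adding cocoercivity in both orders gives [nsq D <= L * dot D (x - y)]; Cauchy-Schwarz and
    division by [enorm D] finish. *)
Lemma smooth_of_bregman (L : R) f : 0 <= L -> (forall x, differentiable f x) ->
  (forall u v, 0 <= bregman f u v <= L / 2 * nsq (u - v)) -> smooth L f.
Proof.
move=> L0 df H; split=> // x y.
set D := grad f x - grad f y.
have H1 := cocoercive x y L0 H; have H2 := cocoercive y x L0 H.
have : nsq D <= L * dot D (x - y).
  move: H1 H2; rewrite (nsqBC (grad f y)) -/D /bregman {3}/D.
  rewrite -(opprB x y) !dotE; lra.
move=> H3; have [D0|D0] := leP (enorm D) 0.
  by apply: le_trans D0 _; rewrite mulr_ge0 ?enorm_ge0.
have : enorm D * enorm D <= enorm D * (L * enorm (x - y)).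
  rewrite -expr2 enorm_sq; apply: le_trans H3 _.
  by rewrite mulrCA ler_wpM2l// dot_le_enorm.
by rewrite ler_pM2l.
Qed.

Lemma nsq_continuous (a : 'rV[R]_d) : continuous (fun y : 'rV[R]_d => nsq (a - y)).
Proof.
move=> x; rewrite /nsq /dot.
have FF : Filter (nbhs x) by exact: nbhs_filter.
apply: (cvg_big _ FF) => [|j _]; first exact: add_continuous.
have H : (fun y : 'rV[R]_d => (a - y) 0 j) @ x --> (a - x) 0 j.
  under eq_fun do rewrite !mxE; rewrite !mxE.
  by apply: cvgB; [exact: cvg_cst|exact: coord_continuous].
exact: cvgM.
Qed.

Lemma lipschitz_continuous (C : R) (g : 'rV[R]_d -> R) :
  (forall x y, (g x - g y) ^+ 2 <= C * nsq (x - y)) -> continuous g.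
Proof.
move=> gC x; have FF : Filter (nbhs x) by exact: nbhs_filter.
apply/(@cvgrPdist_lt _ _ _ (nbhs x) FF) => e e0.
have e2 : 0 < e ^+ 2 by rewrite exprn_gt0.
have H : (fun y : 'rV[R]_d => C * nsq (x - y)) @ x --> C * nsq (x - x).
  by apply: cvgM; [exact: cvg_cst|exact: nsq_continuous].
rewrite subrr nsq0 mulr0 in H.
have {H} := ((@cvgrPdist_lt _ _ _ (nbhs x) FF _ _).1 H) _ e2; apply: filterS => y.
rewrite sub0r normrN => H.
rewrite -(@ltr_pXn2r _ 2)// ?nnegrE ?normr_ge0 ?(ltW e0)//.
rewrite real_normK ?num_real//; apply: le_lt_trans (gC x y) _.
exact: le_lt_trans (ler_norm _) H.
Qed.

Lemma coord_sq_le (v : 'rV[R]_d) j : v 0 j ^+ 2 <= nsq v.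
Proof.
rewrite nsqE (bigD1 j)//= lerDl; apply: sumr_ge0 => i _; exact: sqr_ge0.
Qed.

Lemma grad_continuous (L : R) f j : 0 <= L -> smooth L f ->
  continuous (fun x => grad f x 0 j).
Proof.
move=> L0 Lf; apply: (@lipschitz_continuous (L ^+ 2)) => x y.
apply: le_trans (smooth_nsq x y L0 Lf).
by have := coord_sq_le (grad f x - grad f y) j; rewrite !mxE.
Qed.

Lemma smooth_continuous (L : R) f : smooth L f -> continuous f.
Proof. by move=> [df _] x; exact: differentiable_continuous. Qed.

Lemma avg_fctE n (F : 'I_n -> 'rV[R]_d -> R) (c : R) :
  (fun x => c * \sum_(i < n) F i x) = c *: (\sum_(i < n) F i).
Proof. by apply/funext => x /=; rewrite fct_sumE. Qed.

Lemma grad_avg n (F : 'I_n -> 'rV[R]_d -> R) (c : R) x :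
  (forall i x, differentiable (F i) x) ->
  grad (fun x => c * \sum_(i < n) F i x) x = c *: \sum_(i < n) grad (F i) x.
Proof.
move=> dF; apply/rowP => j; rewrite !mxE summxE.
have D i : derivable (F i) x (delta_mx 0 j) by exact: diff_derivable.
rewrite avg_fctE deriveZ; last exact: derivable_sum.
by rewrite derive_sum//; congr (_ * _); apply: eq_bigr => i _; rewrite mxE.
Qed.

Lemma bregman_avg n (F : 'I_n -> 'rV[R]_d -> R) (c : R) x y :
  (forall i x, differentiable (F i) x) ->
  bregman (fun x => c * \sum_(i < n) F i x) x y = c * \sum_(i < n) bregman (F i) x y.
Proof.
move=> dF; rewrite /bregman grad_avg// dotZl dot_suml !sumrB.
by ring.
Qed.

Lemma convex_avg n (F : 'I_n -> 'rV[R]_d -> R) (c : R) : 0 <= c ->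
  (forall i, convex_fun (F i)) -> convex_fun (fun x => c * \sum_(i < n) F i x).
Proof.
move=> c0 cF t x y _ _ /=.
rewrite [leRHS](_ : _ = c * \sum_(i < n)
   (t%:num * F i x + (1 - t%:num) * F i y)).
  rewrite ler_wpM2l//; apply: ler_sum => i _.
  by have := cF i t x y; rewrite !inE => /(_ Logic.I Logic.I).
rewrite big_split/= -!mulr_sumr mulrDr mulrCA (mulrCA c (1 - _)).
by [].
Qed.

End Gradient.

(** * The proximal operator *)

Section Prox.
Context (R : realType) (d : nat) (mu : R) (psi : 'rV[R]_d -> \bar R).
Implicit Types x y v : 'rV[R]_d.
Hypothesis mu0 : 0 <= mu.
Hypothesis psi_pr : proper_fun psi.
Hypothesis psi_lsc : lower_semicontinuous psi.
Hypothesis psi_sc : strongly_convex mu psi.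

Definition dom x := (psi x < +oo)%E.
(** Meaningful only on [dom]: [fine] sends an infinite value to 0. *)
Definition psir x : R := fine (psi x).

Lemma psirE x : dom x -> psi x = (psir x)%:E.
Proof.
move=> dx; rewrite /psir fineK// fin_numE (psi_pr.1 x)/=.
by apply/eqP => E; move: dx; rewrite /dom E ltxx.
Qed.

Lemma psir_strongly_convex x y (t : R) : dom x -> dom y -> 0 <= t <= 1 ->
  dom (t *: y + (1 - t) *: x) /\
  psir (t *: y + (1 - t) *: x) <=
    t * psir y + (1 - t) * psir x - mu / 2 * (t * (1 - t)) * nsq (y - x).
Proof.
move=> dx dy t01; have := psi_sc y x t01.
rewrite (psirE dx) (psirE dy) -!EFinB -!EFinM -EFinD => H.
set z := t *: y + (1 - t) *: x in H *.
have dz : dom z.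
  rewrite /dom ltey; apply/eqP => E; move: H; rewrite E.
  by rewrite addye// leye_eq.
split=> //; move: H; rewrite (psirE dz) -EFinB lee_fin !enorm_sq.
have -> : nsq z = t * nsq y + (1 - t) * nsq x - t * (1 - t) * nsq (y - x).
  rewrite nsqB /z nsqD !nsqZ !dotE; ring.
by lra.
Qed.

(** Replaces the limit [t -> 0]: a positive [b] is refuted by the single step [t = b / (K + b)]. *)
Lemma small_step_le0 (b K : R) : 0 <= K ->
  (forall t, 0 < t <= 1 -> b <= t * K) -> b <= 0.
Proof.
move=> K0 H; rewrite leNgt; apply/negP => b0.
have D0 : 0 < K + b by rewrite ltr_wpDl.
have t0 : 0 < b / (K + b) by rewrite divr_gt0.
have := H (b / (K + b)); rewrite t0 ler_pdivrMr// mul1r lerDr K0 => /(_ isT).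
have E : b / (K + b) * (K + b) = b by rewrite divfK// gt_eqF.
have := mulr_gt0 t0 b0; move: E; lra.
Qed.

(** Compare the minimizer with a point at fraction [t] of the way to [y], divide by [t] and let [t]
    vanish: [- g] is a subgradient of [psi] at [x], with the strong convexity term kept. It serves
    both the prox, where [h] is the quadratic, and the optimum, where [h] is the averaged loss. *)
Lemma min_subgradient (h : 'rV[R]_d -> R) (g x : 'rV[R]_d) (C : R) : 0 <= C ->
  (forall y, h y <= h x + dot g (y - x) + C * nsq (y - x)) ->
  (forall y, (h x)%:E + psi x <= (h y)%:E + psi y)%E ->
  dom x /\ forall y, dom y ->
    psir x - dot g (y - x) + mu / 2 * nsq (y - x) <= psir y.
Proof.
move=> C0 hC xmin.
have dx : dom x.
  have [y dy] := psi_pr.2; have := xmin y; rewrite (psirE dy) -EFinD /dom ltey.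
  by apply: contraTneq => ->; rewrite addey// leye_eq.
split=> // y dy; rewrite -subr_le0.
apply: (@small_step_le0 _ ((C + mu / 2) * nsq (y - x))).
  by rewrite mulr_ge0 ?nsq_ge0// addr_ge0// divr_ge0.
move=> t /andP[t0 t1].
have t01 : 0 <= t <= 1 by rewrite ltW.
have [dz Hz] := psir_strongly_convex dx dy t01.
have := xmin (t *: y + (1 - t) *: x).
rewrite (psirE dx) (psirE dz) -!EFinD lee_fin => H1.
have := hC (t *: y + (1 - t) *: x).
have -> : t *: y + (1 - t) *: x - x = t *: (y - x).
  by rewrite scalerBl scale1r scalerBr addrCA addrAC subrr add0r.
rewrite dotZr nsqZ => H2.
rewrite -(ler_pM2l t0); move: H1 H2 Hz; set N := nsq _; set G := dot _ _.
rewrite expr2; lra.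
Qed.

Section existence.
Variables (eta : R) (x0 c v : 'rV[R]_d).
Hypothesis eta0 : 0 < eta.
Hypothesis minorant : forall y, ((psir x0 + dot c (y - x0))%:E <= psi y)%E.
Hypothesis dx0 : dom x0.

Let obj y := ((1 / 2 * enorm (v - y) ^+ 2)%:E + eta%:E * psi y)%E.

Let obj_lsc : lower_semicontinuous obj.
Proof.
move=> p r; rewrite /obj.
have cq : continuous (fun y : 'rV[R]_d => 1 / 2 * nsq (v - y)).
  move=> q; have FF : Filter (nbhs q) by exact: nbhs_filter.
  by apply: (@cvgM _ _ (nbhs q) FF); [exact: cvg_cst|exact: nsq_continuous].
have [dp|dp] := boolP (psi p < +oo)%E; last first.
  have pp : psi p = +oo%E by move: dp; rewrite ltNge negbK leye_eq => /eqP.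
  move=> _; have : ((r / eta)%:E < psi p)%E by rewrite pp ltry.
  move=> /psi_lsc[V Vp HV]; exists V => // y /HV Hy.
  have [dy|dy] := boolP (psi y < +oo)%E; last first.
    have -> : psi y = +oo%E by move: dy; rewrite ltNge negbK leye_eq => /eqP.
    by rewrite mulry gtr0_sg// mul1e addey// ltry.
  move: Hy; rewrite (psirE dy) lte_fin -EFinM -EFinD lte_fin ltr_pdivrMr// enorm_sq.
  by have := nsq_ge0 (v - y); rewrite mulrC; lra.
rewrite (psirE dp) -EFinM -EFinD lte_fin enorm_sq => H.
(* Half of the slack pays for the continuity of the quadratic, the other half for the lower
   semicontinuity of [eta * psi]. *)
pose e := (1 / 2 * nsq (v - p) + eta * psir p - r) / 2.
have e0 : 0 < e by rewrite divr_gt0// subr_gt0.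
have : ((psir p - e / eta)%:E < psi p)%E.
  by rewrite (psirE dp) lte_fin ltrBlDr ltrDl divr_gt0.
move=> /psi_lsc[V Vp HV].
have FF : Filter (nbhs p) by exact: nbhs_filter.
have := (@cvgrPdist_lt _ _ _ (nbhs p) FF _ _).1 (cq p) _ e0 => near.
exists (V `&` [set y | `|1 / 2 * nsq (v - p) - 1 / 2 * nsq (v - y)| < e]).
  exact: filterI.
move=> y [/HV Hy /=]; rewrite ltr_norml => /andP[_ Hn].
have [dy|dy] := boolP (psi y < +oo)%E; last first.
  have -> : psi y = +oo%E by move: dy; rewrite ltNge negbK leye_eq => /eqP.
  by rewrite mulry gtr0_sg// mul1e addey// ltry.
move: Hy; rewrite (psirE dy) lte_fin -EFinM -EFinD lte_fin enorm_sq.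
rewrite -(ltr_pM2l eta0) mulrBr [eta * (e / _)]mulrC divfK ?gt_eqF//.
by move: Hn; rewrite /e; lra.
Qed.

(** Outside [B] the affine minorant alone puts the prox objective above its value at [x0], so a
    minimizer may be sought in this compact set. *)
Let B : set 'rV[R]_d := [set y | 1 / 2 * nsq (v - y) + eta * dot c (y - x0)
   <= 1 / 2 * nsq (v - x0)].

Let objE y : dom y -> obj y = (1 / 2 * nsq (v - y) + eta * psir y)%:E.
Proof. by move=> dy; rewrite /obj (psirE dy) -EFinM -EFinD enorm_sq. Qed.

Let B_bound : exists M : R, forall y, B y -> nsq (v - y) <= M.
Proof.
exists (2 * (nsq (v - x0) + 2 * eta ^+ 2 * nsq c + eta * 2 * `|dot c (v - x0)|)) => y.
rewrite /B /= => By.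
have E : dot c (y - x0) = dot c (v - x0) - dot c (v - y).
  by rewrite -dotNr -dotDr opprB [v - x0 + _]addrC addrA subrK.
have := dot_young (2 * eta *: c) (v - y) ltr01.
rewrite invr1 !mul1r nsqZ dotZl => Y.
have := ler_norm (- dot c (v - x0)); rewrite normrN => /(ler_wpM2l (ltW eta0)) N.
by move: By; rewrite E; move: N Y; rewrite !expr2; nra.
Qed.

(** A minimizing sequence in [B] has a cluster point, and lower semicontinuity carries the infimum
    to it. The affine minorant will come from the optimality of [xstar], which avoids a separation
    theorem. *)
Lemma prox_exists : exists x, forall y, (obj x <= obj y)%E.
Proof.
have Bx0 : B x0 by rewrite /B /= subrr dot0r mulr0 addr0.
have cB : compact B.
  apply: bounded_closed_compact.
    have [M HM] := B_bound; exists (`|v| + (M + 1)); split; first exact: num_real.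
    move=> M' MM y By; rewrite -(subKr v y).
    apply: le_trans (ler_normB _ _) _; apply: le_trans (ltW MM); rewrite lerD2l.
    rewrite [leLHS]mx_normrE; apply: bigmax_le => [|[i j] _].
      by have := nsq_ge0 (v - y); have := HM _ By; lra.
    rewrite (ord1 i); have := coord_sq_le (v - y) j; have := HM _ By => H1 H2.
    rewrite /= ler_norml; move: H1 H2; set z := (v - y) 0 j; set n := nsq _; nra.
  pose q (y : 'rV[R]_d) := 1 / 2 * nsq (v - y) + eta * dot c (y - x0).
  have cq : continuous q.
    move=> z; have FF : Filter (nbhs z) by exact: nbhs_filter.
    apply: (@cvgD _ _ _ (nbhs z) FF).
      by apply: (@cvgM _ _ (nbhs z) FF); [exact: cvg_cst|exact: nsq_continuous].
    apply: (@cvgM _ _ (nbhs z) FF); first exact: cvg_cst.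
    rewrite /dot; apply: (cvg_big _ FF) => [|j _]; first exact: add_continuous.
    apply: (@cvgM _ _ (nbhs z) FF); first exact: cvg_cst.
    under eq_fun do rewrite !mxE; rewrite !mxE.
    by apply: (@cvgB _ _ _ (nbhs z) FF); [exact: coord_continuous|exact: cvg_cst].
  have -> : B = q @^-1` `]-oo, (1 / 2 * nsq (v - x0))]%classic.
    by apply/seteqP; split=> y; rewrite /B /q /= in_itv.
  by apply: preimage_closed => [y _|]; [exact: cq|exact: interval_closed].
pose V := [set r : R | exists2 y, B y & dom y /\ r = 1 / 2 * nsq (v - y) + eta * psir y].
have lbV : has_lbound V.
  have [M HM] := B_bound.
  exists (eta * (psir x0 - nsq c - nsq (v - x0) - M)) => _ [y By [dy ->]].
  have := minorant y; rewrite (psirE dy) lee_fin => Hm.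
  have N1 := nsq_ge0 (v - y).
  have M1 := HM _ By.
  have E : dot c (y - x0) = dot c (v - x0) - dot c (v - y).
    by rewrite -dotNr -dotDr opprB [v - x0 + _]addrC addrA subrK.
  have Y1 := dot_young (- c) (v - x0) ltr01.
  have Y2 := dot_young c (v - y) ltr01.
  move: Y1 Y2; rewrite invr1 !mul1r nsqN dotNl => Y1 Y2.
  have C0 := nsq_ge0 c; have C1 := nsq_ge0 (v - x0).
  have : psir x0 - nsq c - nsq (v - x0) - M <= psir y by move: Hm; rewrite E; lra.
  by move=> /(ler_wpM2l (ltW eta0)); lra.
have V0 : V !=set0 by exists (1 / 2 * nsq (v - x0) + eta * psir x0), x0.
have hV : has_inf V by split.
have near_inf n : exists y, [/\ B y, dom y &
    1 / 2 * nsq (v - y) + eta * psir y < inf V + n.+1%:R^-1].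
  have e0 : 0 < n.+1%:R^-1 :> R by rewrite invr_gt0 ltr0n.
  by have [_ [y By [dy ->]] H] := inf_adherent e0 hV; exists y.
have [u Hu] := choice near_inf.
have [p [Bp clp]] : B `&` cluster (u @ \oo) !=set0.
  by apply: cB; exists 0%N => // n _; have [] := Hu n.
(* Otherwise a level [r] strictly between would be exceeded throughout a neighbourhood of [p],
   although the sequence returns there arbitrarily late with values below [r]. *)
have Hp : (obj p <= (inf V)%:E)%E.
  rewrite leNgt; apply/negP => Hp.
  have [r r1 r2] : exists2 r : R, inf V < r & (r%:E < obj p)%E.
    have [dp|dp] := boolP (psi p < +oo)%E; last first.
      have pp : psi p = +oo%E by move: dp; rewrite ltNge negbK leye_eq => /eqP.
      exists (inf V + 1); first by rewrite ltrDl.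
      by rewrite /obj pp mulry gtr0_sg// mul1e addey// ltry.
    move: Hp; rewrite objE// lte_fin => Hp.
    by exists ((inf V + (1 / 2 * nsq (v - p) + eta * psir p)) / 2); rewrite ?lte_fin; lra.
  have [W Wp HW] := obj_lsc r2.
  have r0 : 0 < r - inf V by rewrite subr_gt0.
  have [N _ HN] := near_infty_natSinv_lt (PosNum r0).
  have S : (u @ \oo) [set u n | n in [set n | (N <= n)%N]].
    by exists N => // n Nn; exists n.
  have [_ [[n Nn <-] /HW]] := clp _ _ S Wp.
  have [_ dn Hn] := Hu n.
  rewrite objE// lte_fin; have := HN n Nn => /= Hn2.
  apply/negP; rewrite -leNgt; apply: ltW; apply: lt_trans Hn _.
  by rewrite -ltrBrDl.
exists p => y.
have [By|nBy] := pselect (B y).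
  have [dy|dy] := boolP (psi y < +oo)%E; last first.
    have -> : obj y = +oo%E; last exact: leey.
    have pp : psi y = +oo%E by move: dy; rewrite ltNge negbK leye_eq => /eqP.
    by rewrite /obj pp mulry gtr0_sg// mul1e addey.
  apply: le_trans Hp _; rewrite objE// lee_fin.
  by apply: ge_inf => //; exists y.
apply: le_trans Hp _; apply: (@le_trans _ _ (obj x0)).
  by rewrite objE// lee_fin; apply: ge_inf => //; exists x0.
have [dy|dy] := boolP (psi y < +oo)%E; last first.
  have -> : obj y = +oo%E; last exact: leey.
  have pp : psi y = +oo%E by move: dy; rewrite ltNge negbK leye_eq => /eqP.
  by rewrite /obj pp mulry gtr0_sg// mul1e addey.
rewrite !objE// lee_fin.
move/negP : nBy; rewrite /B/= -ltNge => nBy.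
have := minorant y; rewrite (psirE dy) lee_fin => /(ler_wpM2l (ltW eta0)).
by move: nBy; lra.
Qed.

(** Existence shows that [xget] picks a true minimizer. Dividing the objective by [eta] brings it to
    the form of [min_subgradient], the quadratic being its own second-order model. *)
Lemma prox_spec : dom (prox eta psi v) /\ forall y, dom y ->
  psir (prox eta psi v) + dot (eta^-1 *: (v - prox eta psi v)) (y - prox eta psi v)
    + mu / 2 * nsq (y - prox eta psi v) <= psir y.
Proof.
set x := prox eta psi v.
have xmin y : (obj x <= obj y)%E.
  have [x1 H] := prox_exists.
  by move: y; rewrite /x /prox; case: xgetP => [_ -> //|/(_ x1)]; case.
have hC y : 1 / (2 * eta) * nsq (v - y) <= 1 / (2 * eta) * nsq (v - x) +
    dot (- (eta^-1 *: (v - x))) (y - x) + 1 / (2 * eta) * nsq (y - x).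
  have -> : v - y = (v - x) - (y - x) by rewrite opprB addrA subrK.
  rewrite (nsqB (v - x)) dotNl dotZl le_eqVlt; apply/orP; left; apply/eqP.
  by field; rewrite gt_eqF.
have C0 : 0 <= 1 / (2 * eta) by rewrite divr_ge0// mulr_ge0// ltW.
have hmin y : ((1 / (2 * eta) * nsq (v - x))%:E + psi x <=
    (1 / (2 * eta) * nsq (v - y))%:E + psi y)%E.
  rewrite -(@lee_pmul2l _ eta%:E)// !muleDr ?fin_num_adde_defr//.
  rewrite -!EFinM; have := xmin y; rewrite /obj !enorm_sq.
  by congr (_%:E + _ <= _%:E + _)%E; field; rewrite gt_eqF.
have [dx H] := min_subgradient C0 hC hmin.
by split=> // y dy; have := H y dy; rewrite dotNl; lra.
Qed.

End existence.

Section nonexpansive.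
Variables (eta : R) (x0 c : 'rV[R]_d).
Hypothesis eta0 : 0 < eta.
Hypothesis minorant : forall y, ((psir x0 + dot c (y - x0))%:E <= psi y)%E.
Hypothesis dx0 : dom x0.

(** Add the two subgradient inequalities, each tested at the other prox point. Continuity of the
    prox, hence measurability of the iterates, and their square-integrability rest on this bound. *)
Lemma prox_nonexpansive v v' :
  nsq (prox eta psi v - prox eta psi v') <= nsq (v - v').
Proof.
have [dx H] := prox_spec v eta0 minorant dx0.
have [dx' H'] := prox_spec v' eta0 minorant dx0.
move: (prox eta psi v) (prox eta psi v') dx H dx' H' => x x' dx H dx' H'.
have := H x' dx'; have := H' x dx; rewrite (nsqBC x') !dotZl => H1 H2.
have N0 : 0 <= mu / 2 * nsq (x - x') by rewrite mulr_ge0 ?nsq_ge0// divr_ge0.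
have : eta^-1 * (dot (v' - x') (x - x') + dot (v - x) (x' - x)) <= 0.
  by move: H1 H2 N0; lra.
rewrite pmulr_rle0 ?invr_gt0// -[x' - x]opprB dotNr -dotNl -dotDl.
have -> : v' - x' + - (v - x) = (x - x') - (v - v').
  by apply/rowP => j; rewrite !mxE; ring.
rewrite dotDl dotNl -/(nsq _) => H3.
by have := dot_young (v - v') (x - x') ltr01; rewrite invr1 !mul1r; lra.
Qed.

Lemma prox_continuous j : continuous (fun v => prox eta psi v 0 j).
Proof.
apply: (@lipschitz_continuous _ _ 1) => v v'; rewrite mul1r.
apply: le_trans (prox_nonexpansive v v').
by have := coord_sq_le (prox eta psi v - prox eta psi v') j; rewrite !mxE.
Qed.

End nonexpansive.

End Prox.

(** * One error-compensated proximal step, deterministically *)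

Section OneStep.
Context (R : realType) (d : nat).

(* With [xt = x - e] the error-compensated step is an exact prox-gradient step
   for [xt], up to the displacement [e'] of the point where the subgradient is
   taken; this is why [nsq e'] enters with coefficient 1. *)
Lemma shifted_step_identity (x x' e e' xs : 'rV[R]_d) :
  2 * dot ((x - e) - (x' - e')) (x' - xs) =
  nsq (x - e - xs) - nsq (x' - e' - xs) - nsq (x' - x + e) + nsq e'.
Proof.
have -> : x' - xs = (x' - e' - xs) + e' by apply/rowP => j; rewrite !mxE; ring.
have -> : x' - x + e = (x' - e' - xs) - (x - e - xs) + e'.
  by apply/rowP => j; rewrite !mxE; ring.
have -> : (x - e) - (x' - e') = (x - e - xs) - (x' - e' - xs).
  by apply/rowP => j; rewrite !mxE; ring.
move: (x - e - xs) (x' - e' - xs) => a b.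
by rewrite (nsqD (b - a)) nsqB !dotE (dotC b a) /nsq; ring.
Qed.

(** [V] is the argument of the prox, [D] the averaged sampling noise, and [ps], [ps'] the values of
    [psi] at [xs] and [x']. The identity supplies [- nsq (x' - x + e)], which pays for one half of
    this square in the noise term ([F6]) and one half in the smoothness term ([F8], where
    [eta * Lf <= 1 / 4] enters). *)
Lemma prox_step (mu Lf eta : R) (f : 'rV[R]_d -> R) (ps ps' : R)
    (x x' e e' xs V D : 'rV[R]_d) :
  0 <= mu -> 0 <= Lf -> 0 < eta -> eta * Lf <= 1 / 4 ->
  smooth Lf f -> convex_fun f ->
  ps' + dot (eta^-1 *: (V - x')) (xs - x') + mu / 2 * nsq (xs - x') <= ps ->
  V - x' + eta *: grad f x = (x - e) - (x' - e') - eta *: D ->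
  2 * eta * (f x' + ps' - (f xs + ps)) + (1 + mu * eta / 2) * nsq (x' - e' - xs) <=
  nsq (x - e - xs) + (1 + mu * eta) * nsq e' + 2 * (eta * Lf) * nsq e
  + 2 * eta ^+ 2 * nsq D - 2 * eta * dot (x - e - xs) D.
Proof.
move=> mu0 Lf0 eta0 etaL Sf Cf sub VE.
have F1 := bregman_le x' x Lf0 Sf.
have F2 := bregman_first_order xs x Lf0 Sf Cf.
have F3 : f x' - f xs <= dot (grad f x) (x' - xs) + Lf / 2 * nsq (x' - x).
  move: F1 F2; rewrite /bregman.
  have -> : x' - xs = (x' - x) - (xs - x) by apply/rowP => j; rewrite !mxE; ring.
  by rewrite [dot _ (_ - (xs - x))]dotDr dotNr; lra.
have F4 : 2 * eta * (f x' + ps' - (f xs + ps)) + mu * eta * nsq (x' - xs) <=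
    2 * dot (V - x' + eta *: grad f x) (x' - xs) + eta * Lf * nsq (x' - x).
  have : 2 * eta * (f x' - f xs) <=
      2 * eta * (dot (grad f x) (x' - xs) + Lf / 2 * nsq (x' - x)).
    by rewrite ler_wpM2l// mulr_ge0// ltW.
  have : eta * (ps' + dot (eta^-1 *: (V - x')) (xs - x') + mu / 2 * nsq (xs - x'))
      <= eta * ps by rewrite ler_wpM2l// ltW.
  rewrite dotZl !mulrDr mulVKf ?gt_eqF// (nsqBC xs) -(opprB x' xs) dotNr.
  by rewrite [dot (V - x' + _) _]dotDl dotZl; lra.
move: F4; rewrite VE dotDl dotNl dotZl [2 * (_ - _)]mulrBr shifted_step_identity => F4.
have F5 : nsq (x' - x) <= 2 * nsq (x' - x + e) + 2 * nsq e.
  by have := nsqD_le2 (x' - x + e) (- e); rewrite addrK nsqN.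
(* Only the part of the pairing that involves the new point goes through Young's inequality. The
   pairing with [x - e - xs] is kept exactly, because its expectation vanishes. *)
have F6 : - (2 * eta * dot D (x' - xs)) <= - (2 * eta * dot (x - e - xs) D)
    + 2 * eta ^+ 2 * nsq D + 1 / 2 * nsq (x' - x + e).
  have -> : dot D (x' - xs) = dot (x - e - xs) D + dot D (x' - x + e).
    by rewrite (dotC D (x' - x + e)) (dotC D) -dotDl; congr dot; apply/rowP => j; rewrite !mxE; ring.
  have h0 : 0 < 1 / 2 :> R by lra.
  have := dot_young (x' - x + e) (- (eta *: D)) h0.
  have -> : (1 / 2 : R)^-1 = 2 by field.
  rewrite dotNr dotZr nsqN nsqZ (dotC _ D); lra.
(* Moves the strong convexity gain from [x'] to the virtual iterate: half of it remains, at the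
   price of [mu * eta * nsq e']. *)
have F7 : nsq (x' - e' - xs) <= 2 * nsq (x' - xs) + 2 * nsq e'.
  by have := nsqD_le2 (x' - xs) (- e'); rewrite nsqN addrAC.
have F8 : eta * Lf * nsq (x' - x) <= 1 / 2 * nsq (x' - x + e) + 2 * (eta * Lf) * nsq e.
  have := nsq_ge0 (x' - x + e) => N1; have := nsq_ge0 e => N2.
  have : 0 <= eta * Lf by rewrite mulr_ge0// ltW.
  move: F5 etaL; set b := eta * Lf; move=> F5 etaL b0.
  have := ler_wpM2l b0 F5; have := ler_wpM2r N1 etaL; lra.
have F9 : 0 <= mu * eta by rewrite mulr_ge0// ltW.
have := ler_wpM2l F9 F7; move: F4 F6 F8; lra.
Qed.

End OneStep.

(** * Weighted sums of the recurrences *)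

Section WeightedSums.
Context (R : realType) (rho : R).
Hypothesis rho0 : 0 <= rho.
Hypothesis rho1 : rho < 1.
Implicit Types a b : nat -> R.

Definition wt (k : nat) : R := (1 - rho) ^- k.
Definition wsum a (K : nat) : R := \sum_(k < K) wt k * a k.

Lemma wt_gt0 k : 0 < wt k.
Proof. by rewrite invr_gt0 exprn_gt0// subr_gt0. Qed.

Lemma wtS k : (1 - rho) * wt k.+1 = wt k.
Proof.
have N : 1 - rho != 0 by rewrite gt_eqF// subr_gt0.
by rewrite /wt exprS invfM mulVKf.
Qed.

Lemma wt0 : wt 0 = 1. Proof. by rewrite /wt expr0 invr1. Qed.

Lemma wsum_recr a K : wsum a K.+1 = wsum a K + wt K * a K.
Proof. exact: big_ord_recr. Qed.

Lemma wsumD a b K : wsum (fun k => a k + b k) K = wsum a K + wsum b K.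
Proof. by rewrite -big_split; apply: eq_bigr => k _; rewrite mulrDr. Qed.

Lemma wsumZ c a K : wsum (fun k => c * a k) K = c * wsum a K.
Proof. by rewrite mulr_sumr; apply: eq_bigr => k _; rewrite mulrCA. Qed.

Lemma wsum_le a b K : (forall k, a k <= b k) -> wsum a K <= wsum b K.
Proof. by move=> ab; apply: ler_sum => k _; rewrite ler_pM2l ?wt_gt0. Qed.

Lemma wsum_ge0 a K : (forall k, 0 <= a k) -> 0 <= wsum a K.
Proof. by move=> a0; apply: sumr_ge0 => k _; rewrite mulr_ge0// ltW// wt_gt0. Qed.

(** Shifting the index of the weighted sum costs one factor [1 - rho], so of the contraction rate
    [c] the amount [c - rho] is left. *)
Lemma wsum_recurrence a b c K : (forall k, 0 <= a k) ->
  (forall k, a k.+1 <= (1 - c) * a k + b k) ->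
  (c - rho) * wsum a K <= a 0%N + wsum b K.
Proof.
move=> a0 ab.
(* The boundary term at [K] is what makes the induction close; it is nonnegative and is dropped at
   the end. *)
suff H : (c - rho) * wsum a K + (1 - rho) * wt K * a K <= (1 - rho) * a 0%N + wsum b K.
  have A : 0 <= (1 - rho) * wt K * a K.
    by rewrite !mulr_ge0// ?subr_ge0 ltW// wt_gt0.
  have B : 0 <= rho * a 0%N by rewrite mulr_ge0.
  by move: H; lra.
elim: K => [|K IH].
  by rewrite /wsum !big_ord0 mulr0 wt0 mulr1 add0r addr0.
rewrite !wsum_recr wtS.
have := ler_wpM2l (ltW (wt_gt0 K)) (ab K); move: IH; lra.
Qed.

End WeightedSums.

Ltac nonneg_tac := repeat first [ assumption | exact: ler0n | exact: ler01 | exact: ltr01 | exact: sqr_ge0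
  | by apply: ltW; assumption | apply: addr_ge0
  | apply: mulr_ge0 | rewrite invr_ge0 ].

(** * Solving the coupled recurrences, for real sequences *)

Section ErrorRecursion.
Context (R : realType).
Variables (rho eta Lf Lb L dl d1 p n mu : R).
(** Expected values, in order: objective gap; Bregman distance to the optimum at [x] and at [w];
    squared distance of the virtual iterate to the optimum; squared averaged error; mean squared
    node error; sampling variance; squared distance from the gradient at [x] to the shifts, averaged
    ([A]) and per node ([B]); the same at [w] ([H], [Hb]). *)
Variables (g d dw X N Eb V A B H Hb : nat -> R).
Let s k := d k + dw k.
(** [p] times the factor [1 + a^-1] of Young's inequality with [a = d1 / (2 * p)]. *)
Let q := p * (1 + 2 * p / d1).
Let kap := (1 - dl) / dl.
Let Me := kap * (418 * Lf / dl + 3422 * Lb / (dl * n) + 1349 * L / n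
   + (1671 * Lf + 20364 * Lb / n) * p / (dl * d1) * (1 + 2 * p / d1)).
Hypothesis eta_gt0 : 0 < eta.
Hypothesis Lf_gt0 : 0 < Lf.
Hypothesis Lb_ge0 : 0 <= Lb.
Hypothesis L_ge0 : 0 <= L.
Hypothesis mu_ge0 : 0 <= mu.
Hypothesis mu_le : mu <= Lf.
Hypothesis dl01 : 0 < dl <= 1.
Hypothesis d101 : 0 < d1 <= 1.
Hypothesis p01 : 0 < p <= 1.
Hypothesis n_ge1 : 1 <= n.
Hypothesis rho0 : 0 <= rho.
Hypothesis rho_mu : rho <= mu * eta / 3.
Hypothesis rho_dl : rho <= dl / 4.
Hypothesis rho_d1 : rho <= d1 / 4.
Hypothesis rho_p : rho <= p / 4.
Hypothesis stepsize : eta * (Me + 4 * Lf + 42 * L / n) <= 1.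
Hypothesis nonneg : forall k,
  [/\ 0 <= g k, 0 <= d k, 0 <= dw k, 0 <= X k & 0 <= N k] /\
  [/\ 0 <= Eb k, 0 <= V k, 0 <= A k, 0 <= B k & 0 <= H k /\ 0 <= Hb k].
Hypothesis N0 : N 0%N = 0.
Hypothesis Eb0 : Eb 0%N = 0.
Hypothesis H0 : H 0%N <= Hb 0%N.
Hypothesis dw0 : dw 0%N <= g 0%N.
Hypothesis d_le : forall k, d k <= g k.
Hypothesis V_le : forall k, V k <= 4 * L * s k.
Hypothesis A_le : forall k, A k <= 8 * Lf * s k + 2 * H k.
Hypothesis B_le : forall k, B k <= 8 * Lb * s k + 2 * Hb k.
Hypothesis X_rec : forall k,
  2 * eta * g k.+1 + (1 + mu * eta / 2) * X k.+1 <=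
  X k + (1 + mu * eta) * N k.+1 + 2 * (eta * Lf) * N k + 2 * eta ^+ 2 * (V k / n).
Hypothesis N_rec : forall k, N k.+1 <= (1 - dl) * N k +
  (kap * eta ^+ 2 * A k + (1 - dl) * eta ^+ 2 * (V k / n)
   + dl * (1 - dl) / n * (2 * (Eb k + eta ^+ 2 * B k))).
Hypothesis Eb_rec : forall k, Eb k.+1 <= (1 - dl / 2) * Eb k +
  (2 * kap * eta ^+ 2 * B k + (1 - dl) * eta ^+ 2 * V k).
Hypothesis H_rec : forall k, H k.+1 <= (1 - d1 / 2) * H k +
  (d1 / n * Hb k + 4 * q * Lf * s k).
Hypothesis Hb_rec : forall k, Hb k.+1 <= (1 - d1 / 2) * Hb k + 4 * q * Lb * s k.
Hypothesis dw_rec : forall k, dw k.+1 <= (1 - p) * dw k + p * d k.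

Let dl_gt0 : 0 < dl. Proof. by case/andP: dl01. Qed.
Let d1_gt0 : 0 < d1. Proof. by case/andP: d101. Qed.
Let p_gt0 : 0 < p. Proof. by case/andP: p01. Qed.
Let n_gt0 : 0 < n. Proof. exact: lt_le_trans ltr01 n_ge1. Qed.
Let dl_le1 : 0 <= 1 - dl. Proof. by rewrite subr_ge0; case/andP: dl01. Qed.
Let p_le_q : p <= q.
Proof. by rewrite ler_peMr ?(ltW p_gt0)// lerDl; nonneg_tac. Qed.
Let in_ge0 : 0 <= n^-1. Proof. by rewrite invr_ge0 ltW. Qed.
Let in_le1 : n^-1 <= 1. Proof. by rewrite invf_le1. Qed.
Let idl_ge0 : 0 <= dl^-1. Proof. by rewrite invr_ge0 ltW. Qed.
Let id1_ge0 : 0 <= d1^-1. Proof. by rewrite invr_ge0 ltW. Qed.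
Let etaL : eta * Lf <= 1 / 4.
Proof.
have : 0 <= eta * (Me + 42 * L / n) by nonneg_tac.
by move: stepsize; rewrite !mulrDr; lra.
Qed.
Let etamu : mu * eta <= 1 / 4.
Proof. by apply: le_trans etaL; rewrite mulrC ler_pM2l. Qed.
Let rho_le : rho <= 1 / 12. Proof. by move: rho_mu etamu; lra. Qed.
Let rho1 : rho < 1. Proof. by move: rho_le; lra. Qed.

Variable K : nat.
Let W (a : nat -> R) := wsum rho a K.+1.

Let W_ge0 a : (forall k, 0 <= a k) -> 0 <= W a.
Proof. exact: wsum_ge0. Qed.

Let W_rec := fun a b c => @wsum_recurrence R rho rho0 rho1 a b c K.+1.

Let Wdw : 0 <= W dw. Proof. by apply: W_ge0 => k; case: (nonneg k) => -[]. Qed.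
Let WB : 0 <= W B. Proof. by apply: W_ge0 => k; case: (nonneg k) => _ []. Qed.
Let WV : 0 <= W V. Proof. by apply: W_ge0 => k; case: (nonneg k) => _ []. Qed.
Let WN : 0 <= W N. Proof. by apply: W_ge0 => k; case: (nonneg k) => -[]. Qed.
Let WHb : 0 <= W Hb. Proof. by apply: W_ge0 => k; case: (nonneg k) => _ [_ _ _ _ []]. Qed.
Let Hb0 : 0 <= Hb 0%N. Proof. by case: (nonneg 0) => _ [_ _ _ _ []]. Qed.
Let g0 : 0 <= g 0%N. Proof. by case: (nonneg 0) => -[]. Qed.
Let X0 : 0 <= X 0%N. Proof. by case: (nonneg 0) => -[]. Qed.
Let Ws : 0 <= W s.
Proof. by apply: W_ge0 => k; case: (nonneg k) => -[_ d0 dw0' _ _] _; exact: addr_ge0. Qed.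
Let sig := W s.

(** [rho <= p / 4] leaves three quarters of the rate [p], so [W dw] is at most 4/3 of
    [W d + g 0 / p]; adding [W d] gives 7/3. *)
Lemma sum_s : sig <= 7 / 3 * W g + 4 / 3 * (g 0%N / p).
Proof.
have Hw := W_rec (fun k => (let: conj (And5 _ _ a _ _) _ := nonneg k in a)) dw_rec.
rewrite wsumZ in Hw.
have Hd : W d <= W g by apply: wsum_le => // k.
have E : sig = W d + W dw by exact: wsumD.
have : 3 / 4 * (p * W dw) <= g 0%N + p * W d.
  apply: le_trans (_ : (p - rho) * W dw <= _).
    rewrite mulrA ler_wpM2r//; move: rho_p; lra.
  by apply: le_trans Hw _; rewrite lerD2r.
have {1}-> : g 0%N = p * (g 0%N / p) by rewrite mulrC divfK// gt_eqF.
move=> H1; have : p * (3 / 4 * W dw) <= p * (g 0%N / p + W d) by move: H1; lra.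
by rewrite ler_pM2l// E; move: Hd; lra.
Qed.

Lemma sum_V : W V <= 4 * L * sig.
Proof. by rewrite -wsumZ; exact: wsum_le. Qed.

Lemma sum_Hb : W Hb <= 4 / d1 * (Hb 0%N + 4 * q * Lb * sig).
Proof.
have Hw := W_rec (fun k => (let: conj _ (And5 _ _ _ _ (conj _ a)) := nonneg k in a)) Hb_rec.
rewrite wsumZ in Hw.
rewrite mulrAC ler_pdivlMr// mulrC.
suff : d1 / 4 * W Hb <= Hb 0%N + 4 * q * Lb * sig by lra.
by apply: le_trans Hw; rewrite ler_wpM2r//; move: rho_d1; lra.
Qed.

(** The node quantity enters with weight [d1 / n]; dividing by the remaining rate [d1 / 4] leaves
    [4 / n], free of [d1]. *)
Lemma sum_H : W H <= 4 / d1 * (Hb 0%N + 4 * q * Lf * sig) + 4 / n * W Hb.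
Proof.
have Hw := W_rec (fun k => (let: conj _ (And5 _ _ _ _ (conj a _)) := nonneg k in a)) H_rec.
rewrite wsumD !wsumZ in Hw.
have WH : 0 <= W H by apply: W_ge0 => k; case: (nonneg k) => _ [_ _ _ _ []].
have H1 : d1 / 4 * W H <= Hb 0%N + (d1 / n * W Hb + 4 * q * Lf * sig).
  apply: le_trans (le_trans Hw _); last by rewrite lerD2r.
  by rewrite ler_wpM2r//; move: rho_d1; lra.
rewrite -(ler_pM2l (_ : 0 < d1 / 4)) ?divr_gt0//.
have -> : d1 / 4 * (4 / d1 * (Hb 0%N + 4 * q * Lf * sig) + 4 / n * W Hb) =
  Hb 0%N + (d1 / n * W Hb + 4 * q * Lf * sig) by field; rewrite !gt_eqF.
exact: H1.
Qed.

Lemma sum_A : W A <= 8 * Lf * sig + 2 * W H.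
Proof. by rewrite -!wsumZ -wsumD; exact: wsum_le. Qed.

Lemma sum_B : W B <= 8 * Lb * sig + 2 * W Hb.
Proof. by rewrite -!wsumZ -wsumD; exact: wsum_le. Qed.

Lemma sum_Eb : dl * W Eb <= 8 * kap * eta ^+ 2 * W B + 4 * (1 - dl) * eta ^+ 2 * W V.
Proof.
have Hw := W_rec (fun k => (let: conj _ (And5 a _ _ _ _) := nonneg k in a)) Eb_rec.
rewrite wsumD !wsumZ Eb0 add0r in Hw.
have WE : 0 <= W Eb by apply: W_ge0 => k; case: (nonneg k) => _ [].
have : (dl / 4) * W Eb <= (dl / 2 - rho) * W Eb.
  by rewrite ler_wpM2r//; move: rho_dl; lra.
by move: Hw; rewrite /W; lra.
Qed.

Lemma sum_N : W N <=
  4 / 3 * (kap * eta ^+ 2) * (W A / dl + 9 * (W V / n) + 16 * (W B / (dl * n))).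
Proof.
have Hw := W_rec (fun k => (let: conj (And5 _ _ _ _ a) _ := nonneg k in a)) N_rec.
have E1 : 1 - dl = kap * dl by rewrite /kap divfK// gt_eqF.
have : 3 / 4 * (dl * W N) <= kap * eta ^+ 2 * W A + (1 - dl) * eta ^+ 2 * (W V / n)
   + dl * (1 - dl) / n * (2 * (W Eb + eta ^+ 2 * W B)).
  apply: le_trans (le_trans Hw _).
    by rewrite mulrA ler_wpM2r//; move: rho_dl; lra.
  rewrite N0 add0r !wsumD !wsumZ wsumD wsumZ.
  have -> : wsum rho (fun k => V k / n) K.+1 = W V / n.
    by rewrite mulrC -wsumZ; congr (wsum _ _ _); apply/funext => k; rewrite mulrC.
  by [].
(* After [sum_Eb] and [kap * dl = 1 - dl], the coefficient of [W B / n] is [kap * eta ^+ 2] times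
   [16 * (1 - dl) + 2 * dl ^+ 2], at most 16; that of [W V / n] is 8 times [dl * (1 - dl)]. The
   direct variance term of [N_rec] raises 8 to 9. *)
have H1 : dl * (1 - dl) / n * (2 * (W Eb + eta ^+ 2 * W B)) <=
    kap * eta ^+ 2 * dl * (8 * (W V / n) + 16 * (W B / (dl * n))).
  have D0 : 0 <= 2 * (1 - dl) / n by nonneg_tac.
  have := ler_wpM2l D0 sum_Eb.
  have e2 : 0 <= eta ^+ 2 by exact: sqr_ge0.
  have : 0 <= kap * eta ^+ 2 * (W B / n) * (2 * dl * (1 - dl) + 14 * dl).
    by nonneg_tac.
  have : 0 <= kap * eta ^+ 2 * dl * (W V / n) * dl.
    by nonneg_tac.
  have -> : 16 * (W B / (dl * n)) = 16 * dl^-1 * (W B / n) by field; rewrite !gt_eqF.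
  have -> : kap * eta ^+ 2 * dl * (8 * (W V / n) + 16 / dl * (W B / n)) =
    kap * eta ^+ 2 * (8 * dl * (W V / n) + 16 * (W B / n)) by field; rewrite !gt_eqF.
  rewrite E1; set v := W V / n; set b := W B / n.
  have -> : dl * (kap * dl) / n * (2 * (W Eb + eta ^+ 2 * W B)) =
     2 * (kap * dl) / n * (dl * W Eb) + 2 * kap * dl ^+ 2 * eta ^+ 2 * b.
    by rewrite /b; field; rewrite gt_eqF.
  have -> : 2 * (kap * dl) / n * (8 * kap * eta ^+ 2 * W B + 4 * (kap * dl) * eta ^+ 2 * W V) =
     16 * kap * (kap * dl) * eta ^+ 2 * b + 8 * kap * dl * (kap * dl) * eta ^+ 2 * v.
    by rewrite /v /b; field; rewrite gt_eqF.
  rewrite -E1; lra.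
rewrite E1; move: H1; rewrite E1 => H1 H2.
rewrite -(ler_pM2l (_ : 0 < 3 / 4 * dl)) ?mulr_gt0 ?divr_gt0//.
rewrite -[leLHS]mulrA; apply: le_trans H2 _.
apply: le_trans (lerD (lexx _) H1) _.
rewrite le_eqVlt; apply/orP; left; apply/eqP; field.
by rewrite !gt_eqF.
Qed.

(** The left sum of gaps starts at index 1 because a step bounds the gap of the new iterate, and one
    sum of [N] runs one index further than the other because a step involves both the old and the
    new error. *)
Lemma telescope J :
  2 * eta * (1 - rho) * (wsum rho g J.+1 - g 0%N) + wt rho J * X J <=
  X 0%N + (1 + mu * eta) * (1 - rho) * wsum rho N J.+1
  + 2 * (eta * Lf) * wsum rho N J + 2 * eta ^+ 2 * (wsum rho V J / n).
Proof.
elim: J => [|J IH].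
  rewrite !wsum_recr /wsum !big_ord0 wt0 N0 !mul1r add0r subrr mulr0 !add0r mul0r.
  by rewrite !mulr0 !addr0.
have w0 := ltW (wt_gt0 rho1 J).
have X1 : 0 <= X J.+1 by case: (nonneg J.+1) => -[].
have Hw := ler_wpM2l w0 (X_rec J).
have R1 : wt rho J.+1 * X J.+1 <= wt rho J * ((1 + mu * eta / 2) * X J.+1).
  have -> : wt rho J * ((1 + mu * eta / 2) * X J.+1) =
      (1 - rho) * (1 + mu * eta / 2) * (wt rho J.+1 * X J.+1).
    by rewrite -(wtS rho1 J); ring.
  rewrite ler_peMl//.
    by rewrite mulr_ge0// ltW// wt_gt0.
  (* With [b = mu * eta], [rho <= b / 3] gives [(1 - rho) * (1 + b / 2) >= 1 + b * (1 - b) / 6 >=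
     1]: strong convexity outweighs the growth of the weights, so the distances telescope. *)
  have := rho_mu; have := etamu; set b := mu * eta => H1 H2.
  have b0 : 0 <= b by rewrite mulr_ge0// ltW.
  have : 0 <= (b / 3 - rho) * (1 + b / 2) by rewrite mulr_ge0//; lra.
  have : 0 <= b * (1 - b) by rewrite mulr_ge0//; lra.
  lra.
rewrite (wsum_recr _ g) (wsum_recr _ N J.+1) (wsum_recr _ N J) (wsum_recr _ V).
have E1 := wtS rho1 J.
have Eg : (1 - rho) * (wt rho J.+1 * g J.+1) = wt rho J * g J.+1 by rewrite mulrA E1.
have EN : (1 - rho) * (wt rho J.+1 * N J.+1) = wt rho J * N J.+1 by rewrite mulrA E1.
have -> : 2 * eta * (1 - rho) * (wsum rho g J.+1 + wt rho J.+1 * g J.+1 - g 0%N) =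
  2 * eta * (1 - rho) * (wsum rho g J.+1 - g 0%N) + 2 * eta * (wt rho J * g J.+1).
  by rewrite -Eg; ring.
have -> : (1 + mu * eta) * (1 - rho) *
    (wsum rho N J + wt rho J * N J + wt rho J.+1 * N J.+1) =
  (1 + mu * eta) * (1 - rho) * (wsum rho N J.+1) + (1 + mu * eta) * (wt rho J * N J.+1).
  by rewrite -EN wsum_recr; ring.
move: IH Hw R1; lra.
Qed.

Let C := 8 * Lf / dl + 128 * Lb / (dl * n) + 36 * L / n + 32 * q * Lf / (dl * d1)
  + 640 * q * Lb / (dl * d1 * n).

(** Origin of the constants: 128 = 16 * 8, 36 = 9 * 4 and 32 = 2 * 4 * 4. [W Hb] occurs 8 times
    through [W H] and 32 times through [W B]; the total of 40 times [4 / d1] yields 640 for [q * Lb]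
    and 160 for the initial value, to which [W H] adds 8. *)
Lemma noise_budget :
  W A / dl + 9 * (W V / n) + 16 * (W B / (dl * n)) <=
  C * sig + 168 * (Hb 0%N / (dl * d1)).
Proof.
have a0 := idl_ge0; have b0 := id1_ge0; have c0 := in_ge0.
have HA := ler_wpM2r a0 sum_A.
have HV := ler_wpM2r c0 sum_V.
have ac0 : 0 <= dl^-1 * n^-1 by exact: mulr_ge0.
have HB := ler_wpM2r ac0 sum_B.
have HH := ler_wpM2r a0 sum_H.
have HHb := ler_wpM2r ac0 sum_Hb.
have Hc : 0 <= (1 - n^-1) * (Hb 0%N * dl^-1 * d1^-1).
  by rewrite mulr_ge0 ?subr_ge0 ?mulr_ge0.
rewrite /C !invfM; move: HA HV HB HH HHb Hc; lra.
Qed.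

(** 26 is the largest integer that works: the tightest coefficient is that of [Lb / (dl * n)], with
    26 * 128 = 3328 against 3422. *)
Let kapC : 26 * (kap * C) <= Me.
Proof.
rewrite -subr_ge0.
have -> : Me - 26 * (kap * C) = kap * (210 * Lf * dl^-1 + 94 * Lb * (dl^-1 * n^-1)
   + 413 * L * n^-1 + 839 * Lf * (q * (dl^-1 * d1^-1))
   + 3724 * Lb * (q * (dl^-1 * d1^-1 * n^-1))).
  by rewrite /Me /C /q !invfM; ring.
by nonneg_tac.
Qed.

(** Controls the contribution of the initial shifts: since [q >= p], the summand with 1671 in the
    step-size bound already dominates. *)
Let eta_kap : eta * (kap / (dl * d1)) <= 1 / (1671 * (Lf * p)).
Proof.
have Lp : 0 < 1671 * (Lf * p).
  by apply: mulr_gt0; [rewrite ltr0n|exact: mulr_gt0].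
rewrite (ler_pdivlMr _ _ Lp); apply: (le_trans _ stepsize).
rewrite -[leLHS]mulrA (ler_pM2l eta_gt0).
have r0 : 0 <= 4 * Lf + 42 * L / n by nonneg_tac.
apply: (@le_trans _ _ Me); last by rewrite -addrA lerDl.
rewrite -subr_ge0.
have -> : Me - kap / (dl * d1) * (1671 * (Lf * p)) =
   kap * (418 * Lf * dl^-1 + 3422 * Lb * (dl^-1 * n^-1)
   + 1349 * L * n^-1 + 1671 * Lf * ((q - p) * (dl^-1 * d1^-1))
   + 20364 * Lb * (q * (dl^-1 * d1^-1 * n^-1))).
  by rewrite /Me /q !invfM; ring.
have qp : 0 <= q - p by rewrite subr_ge0.
by nonneg_tac.
Qed.

Lemma gap_sum_bound : W g <=
  2 / p * g 0%N + 9 / (8 * eta) * X 0%N + 6 / (5 * Lf * p) * Hb 0%N.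
Proof.
have Wg0 : 0 <= W g - g 0%N.
  rewrite /W /wsum big_ord_recl wt0 mul1r addrC addKr.
  apply: sumr_ge0 => i _; rewrite mulr_ge0 ?(ltW (wt_gt0 rho1 _))//.
  by case: (nonneg (lift ord0 i)) => -[].
have NK : wsum rho N K <= W N.
  rewrite /W wsum_recr lerDl mulr_ge0 ?(ltW (wt_gt0 rho1 _))//.
  by case: (nonneg K) => -[].
have NK0 : 0 <= wsum rho N K.
  by apply: wsum_ge0 => // k; case: (nonneg k) => -[].
have VK : wsum rho V K <= W V.
  rewrite /W wsum_recr lerDl mulr_ge0 ?(ltW (wt_gt0 rho1 _))//.
  by case: (nonneg K) => _ [].
have XK : 0 <= wt rho K * X K.
  by rewrite mulr_ge0 ?(ltW (wt_gt0 rho1 _))//; case: (nonneg K) => -[].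
(* [rho <= mu * eta / 3 <= 1 / 12] gives 11/12; the two sums of [N] contribute 5/4 and 1/2, hence
   7/4. *)
have T1 : 2 * eta * (11 / 12) * (W g - g 0%N) <=
    X 0%N + 7 / 4 * W N + 2 * eta ^+ 2 * (W V / n).
  have H1 : 2 * eta * (11 / 12) * (W g - g 0%N) <= 2 * eta * (1 - rho) * (W g - g 0%N).
    by rewrite ler_wpM2r// ler_wpM2l ?mulr_ge0 ?(ltW eta_gt0)//; move: rho_le; lra.
  have H2 : (1 + mu * eta) * (1 - rho) * W N <= 5 / 4 * W N.
    rewrite ler_wpM2r//.
    have b0 : 0 <= mu * eta by rewrite mulr_ge0// ltW.
    move: b0 etamu; set b := mu * eta => b0 b1.
    have : 0 <= rho * (1 + b) by rewrite mulr_ge0 ?addr_ge0.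
    by lra.
  have H3 : 2 * (eta * Lf) * wsum rho N K <= 1 / 2 * W N.
    have := ler_wpM2r NK0 etaL; lra.
  have H4 : 2 * eta ^+ 2 * (wsum rho V K / n) <= 2 * eta ^+ 2 * (W V / n).
    by apply: ler_wpM2l; [nonneg_tac|exact: ler_wpM2r].
  by move: (telescope K) XK; rewrite -/(W g) -/(W N); move: H1 H2 H3 H4; lra.
have ke0 : 0 <= 4 / 3 * (kap * eta ^+ 2) by nonneg_tac.
have T2 := le_trans sum_N (ler_wpM2l ke0 noise_budget).
have T3 : eta * (11 / 12) * (W g - g 0%N) <= X 0%N / 2 + eta *
   (eta * (7 / 6) * (kap * C) * sig + 196 * (eta * (kap / (dl * d1))) * Hb 0%N
    + eta * (4 * L / n) * sig).
  have e2 : 0 <= eta ^+ 2 * n^-1 by nonneg_tac.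
  have := ler_wpM2l e2 sum_V.
  by move: T1 T2; rewrite !invfM; lra.
(* The ratio 4/42 = 2/21 comes from the term [42 * L / n] of the step-size bound; the other ratio,
   7/6 divided by 26, is smaller. *)
have T4 : eta * (7 / 6) * (kap * C) * sig + eta * (4 * L / n) * sig <= 2 / 21 * sig.
  rewrite -mulrDl ler_wpM2r//.
  have := ler_wpM2l (ltW eta_gt0) kapC.
  have : 0 <= eta * Me by nonneg_tac.
  have : 0 <= eta * Lf by nonneg_tac.
  have : 0 <= eta * (L * n^-1) by nonneg_tac.
  by move: stepsize; lra.
have T5 := ler_wpM2r Hb0 eta_kap.
have T6 : eta * (11 / 12) * (W g - g 0%N) <= eta * (X 0%N / (2 * eta)
   + 2 / 21 * sig + 196 * (1 / (1671 * (Lf * p)) * Hb 0%N)).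
  apply: le_trans T3 _.
  have -> : X 0%N / 2 = eta * (X 0%N / (2 * eta)) by field; rewrite gt_eqF.
  rewrite -mulrDr (ler_pM2l eta_gt0).
  by move: T4 T5; lra.
move: T6; rewrite -[_ * _ * (_ - _)]mulrA ler_pM2l// => T6.
have -> : 2 / p * g 0%N = 2 * (g 0%N / p) by rewrite mulrAC mulrA.
have gp : g 0%N <= g 0%N / p.
  by rewrite ler_pdivlMr// ler_piMr//; case/andP: p01.
have -> : 9 / (8 * eta) * X 0%N = 9 / 4 * (X 0%N / (2 * eta)) by field; rewrite gt_eqF.
have -> : 6 / (5 * Lf * p) * Hb 0%N = 6 / 5 * (Hb 0%N / (Lf * p)).
  by field; rewrite !gt_eqF.
have E : 1 / (1671 * (Lf * p)) * Hb 0%N = 1 / 1671 * (Hb 0%N / (Lf * p)).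
  by field; rewrite !gt_eqF.
rewrite E in T6.
have P1 : 0 <= X 0%N / (2 * eta) by nonneg_tac.
have P2 : 0 <= Hb 0%N / (Lf * p) by nonneg_tac.
(* By [sum_s], 2/21 of [sig] contains 2/9 of [W g], which is absorbed: 11/12 - 2/9 = 25/36 remains
   on the left. *)
by move: T6 P1 P2 gp sum_s g0; lra.
Qed.

End ErrorRecursion.

(** * Filtrations and independence *)

Section Filtration.
Context (R : realType) (dO : measure_display) (Omega : measurableType dO).
Variables (Pr : probability Omega R) (I : Type) (F : I -> set (set Omega)).
Variable src : nat -> I.
Hypothesis src_inj : injective src.
Hypothesis F_setT : forall i, F i setT.
Hypothesis F_setI : forall i, setI_closed (F i).
Hypothesis F_meas : forall i, F i `<=` measurable.
Hypothesis F_indep : mutually_independent Pr F.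

(** A pi-system generating the information of the first [t] sources. Finite intersections of source
    events are the sets on which mutual independence speaks directly. *)
Definition past (t : nat) : set (set Omega) :=
  [set B | exists2 A : nat -> set Omega,
     (forall i, F (src i) (A i)) & B = \bigcap_(i in `I_t) A i].

Notation Past t := (g_sigma_algebraType (past t)).

Lemma past_setI t : setI_closed (past t).
Proof.
move=> _ _ [A FA ->] [B FB ->].
exists (fun i => A i `&` B i); first by move=> i; exact: F_setI.
by rewrite bigcapI.
Qed.

Lemma past_setT t : past t setT.
Proof. by exists (fun=> setT) => //; rewrite bigcapT. Qed.

Lemma past_source s t A : (s < t)%N -> F (src s) A -> measurable (A : set (Past t)).
Proof.
move=> st FA; apply: sub_sigma_algebra.
exists (fun i => if i == s then A else setT).
  by move=> i; case: eqP => [->|].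
apply/seteqP; split=> [w Aw i /= _|w /(_ s st)]; last by rewrite eqxx.
by case: eqP.
Qed.

Lemma past_measurable t : past t `<=` measurable.
Proof.
move=> _ [A FA ->]; rewrite bigcap_mkcond; apply: bigcapT_measurable => i.
by case: ifP => _; [exact: F_meas | exact: measurableT].
Qed.

Lemma past_sub s t : (s <= t)%N -> past s `<=` past t.
Proof.
move=> st _ [A FA ->].
exists (fun i => if (i < s)%N then A i else setT) => [i|].
  by case: ifP.
apply/seteqP; split=> [w Aw i /= _|w Aw i /= si]; first by case: ifP => // /Aw.
by have := Aw i (leq_trans si st); rewrite si.
Qed.

Lemma sigma_past_sub s t (A : set Omega) : (s <= t)%N ->
  measurable (A : set (Past s)) -> measurable (A : set (Past t)).
Proof. by move=> st; apply: sub_smallest2r; [exact: smallest_sigma_algebra|exact: past_sub]. Qed.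

Lemma sigma_past_measurable t (A : set Omega) :
  measurable (A : set (Past t)) -> measurable A.
Proof.
move=> mA; have := @smallest_sub _ (sigma_algebra setT) (past t) measurable.
apply => //; last exact: past_measurable.
exact: sigma_algebra_measurable.
Qed.

(** Lets the whole past be handled as one random variable, with values in the coarser measurable
    space. *)
Lemma past_id_measurable t : measurable_fun setT (idfun : Omega -> Past t).
Proof. by move=> _ A mA; rewrite setTI; exact: (@sigma_past_measurable t). Qed.

Lemma past_indep_basis t (A C : set Omega) : past t A -> F (src t) C ->
  Pr (A `&` C) = (Pr A * Pr C)%E.
Proof.
move=> [B FB ->] FC.
pose B' i := if i == t then C else B i.
have FB' i : F (src i) (B' i) by rewrite /B'; case: eqP => [->|].
have inj N : injective (fun i : 'I_N => src i).
  by move=> i j /src_inj /val_inj.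
have := F_indep (inj t.+1) (fun i : 'I_t.+1 => FB' i).
rewrite big_ord_recr/= /B' eqxx => H.
have := F_indep (inj t) (fun i : 'I_t => FB i) => H2.
have E0 : \bigcap_(i in `I_t) B i = \bigcap_(i : 'I_t) B i.
  apply/seteqP; split=> w Bw i /=; first by move=> _; exact: (Bw _ (ltn_ord i)).
  by move=> it; exact: (Bw (Ordinal it)).
rewrite {2}E0 H2.
have -> : \bigcap_(i in `I_t) B i `&` C =
    \bigcap_(i : 'I_t.+1) (if val i == t then C else B i).
  apply/seteqP; split=> [w [Bw Cw] i /= _|w Bw].
    case: eqP => // it; apply: Bw => /=.
    by have := ltn_ord i; rewrite ltnS leq_eqVlt => /orP[/eqP|].
  split; last by have /= := Bw ord_max Logic.I; rewrite eqxx.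
  move=> i /= it; have /= := Bw (widen_ord (leqnSn t) (Ordinal it)) Logic.I.
  by rewrite /= ltn_eqF.
rewrite H; congr (_ * _)%E; apply: eq_bigr => i _.
by rewrite /= ltn_eqF.
Qed.

(** As functions of [A], both sides are finite measures; they agree on the pi-system [past t], hence
    on the sigma-algebra it generates. *)
Lemma past_indep t (A C : set Omega) : measurable (A : set (Past t)) ->
  F (src t) C -> Pr (A `&` C) = (Pr A * Pr C)%E.
Proof.
move=> mA FC.
have mC := F_meas FC.
have mid := @past_id_measurable t.
pose m1' : measure (Past t) R := pushforward (mrestr Pr mC) (idfun : Omega -> Past t).
pose m1 := m1' mid.
have PC0 : 0 <= fine (Pr C) by exact: fine_ge0.
pose m2' : measure (Past t) R :=
  mscale (NngNum PC0) (pushforward Pr (idfun : Omega -> Past t)).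
pose m2 := m2' mid.
have := @measure_unique _ _ (Past t) (past t) (fun=> setT) erefl
  (@past_setI t) (fun=> past_setT t) _ m1 m2 _ _ A mA.
have E1 B : m1 B = Pr (B `&` C) by [].
have E2 B : m2 B = (Pr B * Pr C)%E.
  rewrite [LHS](_ : _ = ((fine (Pr C))%:E * Pr B)%E)//.
  by rewrite fineK ?fin_num_measure// muleC.
rewrite E1 E2; apply.
- by rewrite bigcup_const.
- by move=> B /past_indep_basis -/(_ _ FC); rewrite E1 E2.
- by move=> _; rewrite setTI (le_lt_trans (probability_le1 _ _)) ?ltry.
Qed.

End Filtration.

(** * Integrating out an independent variable *)

Section Freezing.
Context (R : realType) (dO dG dT : measure_display).
Context (Omega : measurableType dO) (S : measurableType dG) (T : measurableType dT).
Variables (Pr : probability Omega R) (nu : probability T R).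
Variables (X : Omega -> S) (Y : Omega -> T).
Hypothesis mX : measurable_fun setT X.
Hypothesis mY : measurable_fun setT Y.
Hypothesis XY : forall (A : set S) (B : set T), measurable A -> measurable B ->
  Pr (X @^-1` A `&` Y @^-1` B) = (Pr (X @^-1` A) * nu B)%E.

Let XYw (w : Omega) : S * T := (X w, Y w).

Let mXY : measurable_fun setT XYw.
Proof. exact: measurable_fun_pair. Qed.

Let PX : probability S R := distribution Pr (mfun_Sub (mem_set mX)).

Let prod_law (A : set (S * T)) : measurable A ->
  (PX \x nu)%E A = pushforward Pr XYw A.
Proof.
move=> mA.
pose m' : measure (S * T)%type R := pushforward Pr XYw.
have := @product_measure_unique _ _ S T R PX nu (m' mXY) _ A mA.
by apply => // B C mB mC; exact: XY.
Qed.

Local Open Scope ereal_scope.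

(** By independence the law of the pair is a product measure, and Tonelli integrates [Y] out with
    [X] frozen. This replaces conditioning on [X]. *)
Lemma freeze_ge0 (F : S * T -> \bar R) : measurable_fun setT F ->
  (forall z, 0 <= F z) ->
  \int[Pr]_w F (X w, Y w) = \int[Pr]_w \int[nu]_y F (X w, y).
Proof.
move=> mF F0.
have -> : \int[Pr]_w F (X w, Y w) = \int[pushforward Pr XYw]_z F z.
  by rewrite (ge0_integral_pushforward mXY).
rewrite (eq_measure_integral (PX \x nu)); last first.
  by move=> A mA _; exact/esym/prod_law.
rewrite fubini_tonelli1// (ge0_integral_pushforward mX)//.
- exact: measurable_fun_fubini_tonelli_F.
- by move=> w _; exact: integral_ge0.
Qed.

Lemma freeze_integrable (F : S * T -> \bar R) : measurable_fun setT F ->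
  Pr.-integrable setT (fun w => F (X w, Y w)) ->
  \int[Pr]_w F (X w, Y w) = \int[Pr]_w \int[nu]_y F (X w, y).
Proof.
move=> mF iF.
have iF' : (pushforward Pr XYw).-integrable setT F.
  exact: (integrable_pushforward mXY).
have -> : \int[Pr]_w F (X w, Y w) = \int[pushforward Pr XYw]_z F z.
  by rewrite (integral_pushforward mXY).
have iP : (PX \x nu).-integrable setT F.
  apply/integrableP; split => //.
  move/integrableP : iF' => [_]; apply: le_lt_trans.
  rewrite (eq_measure_integral (pushforward Pr XYw))// => A mA _.
  exact: prod_law.
rewrite (eq_measure_integral (PX \x nu)); last first.
  by move=> A mA _; exact/esym/prod_law.
rewrite -integral12_prod_meas1//.
rewrite (integral_pushforward mX)//.
  exact: (measurable_fubini_F iP).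
have := integrable_fubini_F iP.
move=> /integrableP[mFF foo]; apply/integrableP; split.
  exact: measurableT_comp mX.
move: foo; rewrite (ge0_integral_pushforward mX)//.
exact: measurableT_comp.
Qed.

End Freezing.

(** * Random vectors *)

Section Borel.
Context (R : realType) (d : nat).

Notation Borel := (g_sigma_algebraType (@open 'rV[R]_d)).

Definition vmeas (dT : measure_display) (T : measurableType dT)
  (X : T -> 'rV[R]_d) := forall j, measurable_fun setT (fun w => X w 0 j).

Lemma ball_rVE (x y : 'rV[R]_d) (r : R) : 0 < r ->
  (forall j, `|x 0 j - y 0 j| < r) <-> ball x r y.
Proof.
move=> r0; split=> [H|[_ H] j]; last exact: H.
by split=> // i j; rewrite (ord1 i); exact: H.
Qed.

Lemma lsc_measurable (g : 'rV[R]_d -> \bar R) : lower_semicontinuous g ->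
  measurable_fun setT (g : Borel -> \bar R).
Proof.
move=> /lower_semicontinuousP sg.
apply: (measurability _ (ErealGenOInfty.measurableE R)).
move=> /= _ [_ [a ->]] <-; rewrite setTI preimage_itvoy.
exact: sub_sigma_algebra (sg a).
Qed.

Lemma continuous_lsc (g : 'rV[R]_d -> R) : continuous g ->
  lower_semicontinuous (EFin \o g).
Proof.
move=> cg x a; rewrite lte_fin => ag.
exists (g @^-1` `]a, +oo[%classic) => [|y /=].
  by apply: cg; apply: open_nbhs_nbhs; split; [exact: interval_open|rewrite /= in_itv/= ag].
by rewrite in_itv/= andbT lte_fin.
Qed.

(** An open set is a countable union of balls with rational centre and radius, and a ball of the sup
    norm is a finite intersection of coordinate conditions. [B] enumerates these balls by [pickle]
    and is empty for codes of no suitable ball. *)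
Lemma vmeas_borel (dT : measure_display) (T : measurableType dT)
  (X : T -> 'rV[R]_d) : vmeas X <-> measurable_fun setT (X : T -> Borel).
Proof.
split=> [mX|mX j]; last first.
  apply/measurable_EFinP.
  apply: (measurableT_comp (f := (fun x : Borel => (x 0 j)%:E))) => //.
  by apply: lsc_measurable; apply: continuous_lsc; exact: coord_continuous.
apply: (@measurability _ _ _ Borel _ _ open) => // _ [U oU <-]; rewrite setTI.
pose P (q : 'rV[rat]_d * rat) := 0 < (ratr q.2 : R) /\
   ball (map_mx ratr q.1 : 'rV[R]_d) (ratr q.2) `<=` U.
pose B (i : nat) : set 'rV[R]_d := match unpickle i with
  | Some q => if `[< P q >] then ball (map_mx ratr q.1 : 'rV[R]_d) (ratr q.2) else set0
  | None => set0 end.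
have -> : U = \bigcup_i B i.
  apply/seteqP; split=> [x Ux|x [i _]]; last first.
    rewrite /B; case: unpickle => // q; case: asboolP => // -[_ qU]; exact: qU.
  have [e /= e0 eU] : nbhs_ball x U by apply/nbhs_ballP; exact: open_nbhs_nbhs.
  have [r] : exists r : rat, (ratr r : R) \in `]0, (e / 2)[.
    by apply: rat_in_itvoo; rewrite divr_gt0.
  rewrite in_itv/= => /andP[r0 re].
  have Hq j : exists q : rat, (ratr q : R) \in `](x 0 j - ratr r), (x 0 j + ratr r)[.
    by apply: rat_in_itvoo; lra.
  have [q qE] : exists q : 'rV[rat]_d, forall j, `|(ratr (q 0 j) : R) - x 0 j| < ratr r.
    exists (\row_j xchoose (Hq j)) => j; rewrite mxE; have := xchooseP (Hq j); rewrite in_itv/= => /andP[].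
    by rewrite ltr_norml; lra.
  exists (pickle (q, r)) => //; rewrite /B pickleK.
  case: asboolP => [_|[]] /=.
    by apply/ball_rVE => // j; rewrite mxE.
  split=> //= y /ball_rVE-/(_ r0) qy; apply: eU; apply/ball_rVE => // j.
  have := qy j; have := qE j; rewrite mxE.
  by rewrite !ltr_norml; lra.
rewrite preimage_bigcup; apply: bigcupT_measurable => i; rewrite /B.
case: unpickle => [q|]; last by rewrite preimage_set0.
case: asboolP => [[q0 _]|_]; last by rewrite preimage_set0.
rewrite [X in measurable X](_ : _ = \bigcap_(j in [set: 'I_d])
   [set w | `|(ratr (q.1 0 j) : R) - X w 0 j| < ratr q.2]); last first.
  apply/seteqP; split=> w /=.
    by move=> /ball_rVE-/(_ q0) H j _ /=; have := H j; rewrite mxE.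
  by move=> H; apply/ball_rVE => // j; rewrite mxE; exact: H.
apply: fin_bigcap_measurable => // j _.
have : measurable_fun setT (fun w => `|(ratr (q.1 0 j) : R) - X w 0 j|).
  by apply: measurableT_comp => //; exact: measurable_funB.
move=> /(_ measurableT `]-oo, ratr q.2[%classic (measurable_itv _)).
by rewrite setTI; congr measurable; apply/seteqP; split=> w /=; rewrite in_itv.
Qed.

Lemma vmeas_comp_cont (dT : measure_display) (T : measurableType dT)
    (X : T -> 'rV[R]_d) (g : 'rV[R]_d -> R) :
  vmeas X -> continuous g -> measurable_fun setT (fun w => g (X w)).
Proof.
move=> /vmeas_borel mX /continuous_lsc /lsc_measurable mg.
by apply/measurable_EFinP; exact: (measurableT_comp mg mX).
Qed.

Section ops.
Context (dT : measure_display) (T : measurableType dT).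
Implicit Types X Y : T -> 'rV[R]_d.

Lemma vmeas_cst (v : 'rV[R]_d) : vmeas (fun _ : T => v).
Proof. by move=> j; exact: measurable_cst. Qed.

Lemma vmeasD X Y : vmeas X -> vmeas Y -> vmeas (fun w => X w + Y w).
Proof.
move=> mX mY j; under eq_fun do rewrite mxE.
exact: measurable_funD.
Qed.

Lemma vmeasZ a X : vmeas X -> vmeas (fun w => a *: X w).
Proof.
move=> mX j; under eq_fun do rewrite mxE.
exact: measurable_funM.
Qed.

Lemma vmeasN X : vmeas X -> vmeas (fun w => - X w).
Proof. by move=> /(vmeasZ (-1)); under eq_fun do rewrite scaleN1r. Qed.

Lemma vmeasB X Y : vmeas X -> vmeas Y -> vmeas (fun w => X w - Y w).
Proof. by move=> mX mY; apply: vmeasD => //; exact: vmeasN. Qed.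

Lemma vmeas_sum (I : Type) (s : seq I) (X : I -> T -> 'rV[R]_d) :
  (forall i, vmeas (X i)) -> vmeas (fun w => \sum_(i <- s) X i w).
Proof.
move=> mX; elim: s => [|i s IH].
  by under eq_fun do rewrite big_nil; exact: vmeas_cst.
by under eq_fun do rewrite big_cons; exact: vmeasD.
Qed.

Lemma vmeas_mean n (X : 'I_n -> T -> 'rV[R]_d) :
  (forall i, vmeas (X i)) -> vmeas (fun w => mean (fun i => X i w)).
Proof. by move=> mX; apply: vmeasZ; exact: vmeas_sum. Qed.

Lemma vmeas_dot X Y : vmeas X -> vmeas Y ->
  measurable_fun setT (fun w => dot (X w) (Y w)).
Proof.
move=> mX mY; rewrite /dot.
by apply: measurable_sum => j; exact: measurable_funM.
Qed.

Lemma vmeas_nsq X : vmeas X -> measurable_fun setT (fun w => nsq (X w)).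
Proof. by move=> mX; exact: vmeas_dot. Qed.

End ops.
End Borel.

(** * Expectations and square-integrable vectors *)

Section Expectation.
Context (R : realType) (dO : measure_display) (Omega : measurableType dO).
Variable Pr : probability Omega R.
Implicit Types f g : Omega -> R.

Definition L1 f : Prop := Pr.-integrable setT (EFin \o f).
Definition Ex f : R := (\int[Pr]_w f w)%R.

Lemma L1_measurable f : L1 f -> measurable_fun setT f.
Proof. by move=> /measurable_int /measurable_EFinP. Qed.

Lemma L1_integral f : L1 f -> (\int[Pr]_w (f w)%:E)%E = (Ex f)%:E.
Proof. by move=> Lf; rewrite /Ex fineK//; exact: integrable_fin_num. Qed.

Lemma L1_cst a : L1 (fun=> a).
Proof. exact: finite_measure_integrable_cst. Qed.

Lemma L1D f g : L1 f -> L1 g -> L1 (fun w => f w + g w).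
Proof. by move=> Lf Lg; exact: (integrableD measurableT Lf Lg). Qed.

Lemma L1Z a f : L1 f -> L1 (fun w => a * f w).
Proof. by move=> Lf; exact: (integrableZl measurableT a Lf). Qed.

Lemma L1B f g : L1 f -> L1 g -> L1 (fun w => f w - g w).
Proof. by move=> Lf Lg; exact: (integrableB measurableT Lf Lg). Qed.

Lemma L1_sum (I : Type) (s : seq I) (F : I -> Omega -> R) :
  (forall i, L1 (F i)) -> L1 (fun w => \sum_(i <- s) F i w).
Proof.
move=> LF; elim: s => [|i s IH].
  by under eq_fun do rewrite big_nil; exact: L1_cst.
by under eq_fun do rewrite big_cons; exact: L1D.
Qed.

Lemma L1_le f g : measurable_fun setT f -> (forall w, `|f w| <= g w) -> L1 g -> L1 f.
Proof.
move=> mf fg Lg; apply: (le_integrable _ _ _ Lg) => //; first exact/measurable_EFinP.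
move=> w _ /=; rewrite lee_fin; apply: le_trans (fg w) (ler_norm _).
Qed.

Lemma ExD f g : L1 f -> L1 g -> Ex (fun w => f w + g w) = Ex f + Ex g.
Proof. by move=> Lf Lg; exact: RintegralD. Qed.

Lemma ExB f g : L1 f -> L1 g -> Ex (fun w => f w - g w) = Ex f - Ex g.
Proof. by move=> Lf Lg; exact: RintegralB. Qed.

Lemma ExZ a f : L1 f -> Ex (fun w => a * f w) = a * Ex f.
Proof. by move=> Lf; exact: RintegralZl. Qed.

Lemma Ex_cst a : Ex (fun=> a) = a.
Proof. by rewrite /Ex Rintegral_cst// [X in fine X]probability_setT/= mulr1. Qed.

Lemma Ex_sum (I : Type) (s : seq I) (F : I -> Omega -> R) :
  (forall i, L1 (F i)) -> Ex (fun w => \sum_(i <- s) F i w) = \sum_(i <- s) Ex (F i).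
Proof.
move=> LF; elim: s => [|i s IH].
  by rewrite big_nil; under eq_fun do rewrite big_nil; exact: Ex_cst.
under eq_fun do rewrite big_cons.
by rewrite big_cons -IH ExD//; exact: L1_sum.
Qed.

Lemma Ex_le f g : L1 f -> L1 g -> (forall w, f w <= g w) -> Ex f <= Ex g.
Proof. by move=> Lf Lg fg; exact: le_Rintegral. Qed.

Lemma Ex_ge0 f : (forall w, 0 <= f w) -> 0 <= Ex f.
Proof. by move=> f0; exact: Rintegral_ge0. Qed.

Lemma L1_ge0_bounded f (c : R) : measurable_fun setT f -> (forall w, 0 <= f w) ->
  (\int[Pr]_w (f w)%:E <= c%:E)%E -> L1 f /\ Ex f <= c.
Proof.
move=> mf f0 fc.
have Lf : L1 f.
  apply/integrableP; split; first exact/measurable_EFinP.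
  under eq_integral do rewrite /= ger0_norm//.
  by rewrite (le_lt_trans fc)// ltry.
by split => //; rewrite -lee_fin -L1_integral.
Qed.

Section vectors.
Context (d : nat).
Implicit Types X Y Z : Omega -> 'rV[R]_d.

Definition L2 X : Prop := vmeas X /\ L1 (fun w => nsq (X w)).

Lemma L2_le X (g : Omega -> R) : vmeas X -> (forall w, nsq (X w) <= g w) -> L1 g -> L2 X.
Proof.
move=> mX Xg Lg; split=> //; apply: (L1_le _ _ Lg); first exact: vmeas_nsq.
by move=> w; rewrite ger0_norm// nsq_ge0.
Qed.

Lemma L2_cst v : L2 (fun=> v).
Proof. by split; [exact: vmeas_cst|exact: L1_cst]. Qed.

Lemma L2Z a X : L2 X -> L2 (fun w => a *: X w).
Proof.
move=> [mX LX]; apply: (@L2_le _ (fun w => a ^+ 2 * nsq (X w))).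
- exact: vmeasZ.
- by move=> w; rewrite nsqZ.
- exact: L1Z.
Qed.

Lemma L2D X Y : L2 X -> L2 Y -> L2 (fun w => X w + Y w).
Proof.
move=> [mX LX] [mY LY].
apply: (@L2_le _ (fun w => 2 * nsq (X w) + 2 * nsq (Y w))).
- exact: vmeasD.
- by move=> w; exact: nsqD_le2.
- by apply: L1D; exact: L1Z.
Qed.

Lemma L2N X : L2 X -> L2 (fun w => - X w).
Proof. by move=> /(L2Z (-1)); under eq_fun do rewrite scaleN1r. Qed.

Lemma L2B X Y : L2 X -> L2 Y -> L2 (fun w => X w - Y w).
Proof. by move=> LX LY; apply: L2D => //; exact: L2N. Qed.

Lemma L2_sum (I : Type) (s : seq I) (X : I -> Omega -> 'rV[R]_d) :
  (forall i, L2 (X i)) -> L2 (fun w => \sum_(i <- s) X i w).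
Proof.
move=> LX; elim: s => [|i s IH].
  by under eq_fun do rewrite big_nil; exact: L2_cst.
by under eq_fun do rewrite big_cons; exact: L2D.
Qed.

Lemma L2_mean n (X : 'I_n -> Omega -> 'rV[R]_d) :
  (forall i, L2 (X i)) -> L2 (fun w => mean (fun i => X i w)).
Proof. by move=> LX; apply: L2Z; exact: L2_sum. Qed.

Lemma L1_nsq X : L2 X -> L1 (fun w => nsq (X w)). Proof. by case. Qed.

Lemma L1_dot X Y : L2 X -> L2 Y -> L1 (fun w => dot (X w) (Y w)).
Proof.
move=> [mX LX] [mY LY].
apply: (@L1_le _ (fun w => nsq (X w) + nsq (Y w))); first exact: vmeas_dot.
  move=> w; have := dot_young (X w) (Y w) ltr01.
  have := dot_young (X w) (- Y w) ltr01.
  rewrite dotNr nsqN invr1 !mul1r.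
  have := nsq_ge0 (X w); have := nsq_ge0 (Y w).
  by rewrite ler_norml; lra.
exact: L1D.
Qed.

Lemma L1_coord X j : L2 X -> L1 (fun w => X w 0 j).
Proof.
move=> LX; have := L1_dot LX (L2_cst (delta_mx 0 j)).
congr L1; apply/funext => w; rewrite /dot (bigD1 j)//= big1 => [|i ij].
  by rewrite mxE !eqxx mulr1 addr0.
by rewrite mxE eqxx (negPf ij) mulr0.
Qed.

Lemma Ex_nsqD X Y : L2 X -> L2 Y ->
  Ex (fun w => nsq (X w + Y w)) =
  Ex (fun w => nsq (X w)) + 2 * Ex (fun w => dot (X w) (Y w)) + Ex (fun w => nsq (Y w)).
Proof.
move=> LX LY; under eq_fun do rewrite nsqD.
have L1X := L1_nsq LX; have L1Y := L1_nsq LY; have L1XY := L1_dot LX LY.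
rewrite !ExD ?ExZ//; [exact: L1Z|apply: L1D => //; exact: L1Z].
Qed.

Lemma Ex_nsqZ a X : L2 X -> Ex (fun w => nsq (a *: X w)) = a ^+ 2 * Ex (fun w => nsq (X w)).
Proof. by move=> LX; under eq_fun do rewrite nsqZ; rewrite ExZ//; exact: L1_nsq. Qed.

Lemma Ex_nsqD_le (a : R) X Y : 0 < a -> L2 X -> L2 Y ->
  Ex (fun w => nsq (X w + Y w)) <=
  (1 + a) * Ex (fun w => nsq (X w)) + (1 + a^-1) * Ex (fun w => nsq (Y w)).
Proof.
move=> a0 LX LY.
have L1X := L1_nsq LX; have L1Y := L1_nsq LY.
rewrite -!ExZ// -ExD; [|exact: L1Z|exact: L1Z].
apply: Ex_le; [exact/L1_nsq/L2D|by apply: L1D; exact: L1Z|].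
by move=> w; exact: nsqD_le.
Qed.

End vectors.
End Expectation.

(** * Compressors and sampling *)

Section Compressor.
Context (R : realType) (d : nat) (Q : random_map R d) (dl : R).
Hypothesis Qc : contraction_compressor dl Q.
Hypothesis Qm : mean_scaling dl Q.

Lemma rmap_section (v : 'rV[R]_d) : vmeas (fun s => rmap (r := Q) s v).
Proof.
move=> j; have H : measurable_fun setT
    (fun s => (s, v) : seed Q * g_sigma_algebraType (@open 'rV[R]_d)).
  by apply: measurable_fun_pair => //; exact: measurable_cst.
exact: (measurableT_comp (rmap_measurable j) H).
Qed.

(** The contraction bound makes the error [v - rmap s v] square-integrable, and the output is [v]
    minus the error. *)
Lemma rmap_L2 (v : 'rV[R]_d) : L2 (seed_law Q) (fun s => rmap (r := Q) s v).
Proof.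
have [_ /(_ v)] := Qc; rewrite unlock => H.
have mQ := vmeasB (vmeas_cst v) (rmap_section v).
have [LQ _] : L1 (seed_law Q) (fun s => nsq (v - rmap s v)) /\
    Ex (seed_law Q) (fun s => nsq (v - rmap s v)) <= (1 - dl) * enorm v ^+ 2.
  apply: L1_ge0_bounded => //; first exact: vmeas_nsq.
  - by move=> s; exact: nsq_ge0.
  - by under eq_integral do rewrite -enorm_sq.
have : L2 (seed_law Q) (fun s => v - (v - rmap s v)).
  by apply: L2B; [exact: L2_cst|split].
by under eq_fun do rewrite subKr.
Qed.

Lemma rmap_dot_mean (z v : 'rV[R]_d) :
  Ex (seed_law Q) (fun s => dot z (dl *: v - rmap s v)) = 0.
Proof.
rewrite /dot Ex_sum => [|j]; last first.
  apply: L1Z; apply: (L1_coord (X := fun s => dl *: v - rmap s v)).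
  by apply: L2B; [exact: L2_cst|exact: rmap_L2].
apply: big1 => j _; under eq_fun do rewrite !mxE.
have LQ := L1_coord j (rmap_L2 v).
rewrite ExZ; last by apply: L1B; [exact: L1_cst|].
rewrite ExB//; last exact: L1_cst.
rewrite Ex_cst; have := Qm v j; rewrite unlock L1_integral// => -[->].
by rewrite subrr mulr0.
Qed.

End Compressor.

(** * Adapted and centred random vectors *)

Section Adapted.
Context (R : realType) (dO : measure_display) (Omega : measurableType dO).
Variables (Pr : probability Omega R) (I : Type) (F : I -> set (set Omega)).
Variable src : nat -> I.
Hypothesis src_inj : injective src.
Hypothesis F_setT : forall i, F i setT.
Hypothesis F_setI : forall i, setI_closed (F i).
Hypothesis F_meas : forall i, F i `<=` measurable.
Hypothesis F_indep : mutually_independent Pr F.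

Notation Past t := (g_sigma_algebraType (past F src t)).
Notation E := (Ex Pr).

Definition pastfun (t : nat) (f : Omega -> R) :=
  measurable_fun setT (f : Past t -> R).

Let mid t : measurable_fun setT (idfun : Omega -> Past t).
Proof. exact: past_id_measurable. Qed.

Lemma pastfun_measurable t f : pastfun t f -> measurable_fun setT f.
Proof.
by move=> mf; exact: (measurableT_comp mf (@mid t)).
Qed.

Lemma past_mono (dT : measure_display) (T : measurableType dT) s t (f : Omega -> T) :
  (s <= t)%N ->
  measurable_fun setT (f : Past s -> T) -> measurable_fun setT (f : Past t -> T).
Proof.
move=> st mf _ B mB; have := mf measurableT B mB; rewrite !setTI.
exact: sigma_past_sub.
Qed.

Definition from_source (dT : measure_display) (T : measurableType dT) (t : nat)
  (Y : Omega -> T) := forall B, measurable B -> F (src t) (Y @^-1` B).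

Lemma from_source_past (dT : measure_display) (T : measurableType dT) s t
    (Y : Omega -> T) : (s < t)%N -> from_source s Y ->
  measurable_fun setT (Y : Past t -> T).
Proof.
by move=> st FY _ B mB; rewrite setTI; apply: (past_source F_setT st); exact: FY.
Qed.

Section freeze.
Context (dT : measure_display) (T : measurableType dT) (nu : probability T R).
Variables (t : nat) (Y : Omega -> T).
Hypothesis FY : from_source t Y.
Hypothesis Ynu : forall B, measurable B -> Pr (Y @^-1` B) = nu B.

Let mY : measurable_fun setT Y.
Proof. by move=> _ B mB; rewrite setTI; apply: F_meas; exact: FY. Qed.

Let XY (A : set (Past t)) (B : set T) : measurable A -> measurable B ->
  Pr ((idfun : Omega -> Past t) @^-1` A `&` Y @^-1` B) =
  (Pr ((idfun : Omega -> Past t) @^-1` A) * nu B)%E.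
Proof.
move=> mA mB; rewrite -Ynu//.
exact: (past_indep src_inj F_setT F_setI F_meas F_indep mA (FY mB)).
Qed.

Lemma past_freeze_ge0 (G : Omega -> T -> \bar R) :
  measurable_fun setT (fun z : (Past t * T)%type => G z.1 z.2) ->
  (forall w y, 0 <= G w y)%E ->
  (\int[Pr]_w G w (Y w) = \int[Pr]_w \int[nu]_y G w y)%E.
Proof.
move=> mG G0.
exact: (freeze_ge0 (@mid t) mY XY mG).
Qed.

Lemma past_freeze_integrable (G : Omega -> T -> \bar R) :
  measurable_fun setT (fun z : (Past t * T)%type => G z.1 z.2) ->
  Pr.-integrable setT (fun w => G w (Y w)) ->
  (\int[Pr]_w G w (Y w) = \int[Pr]_w \int[nu]_y G w y)%E.
Proof.
move=> mG iG.
exact: (freeze_integrable (@mid t) mY XY mG).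
Qed.

End freeze.

(** An event of the current source factors out of the expectation of a past function. Coin tosses
    and index draws are sums of such terms. *)
Lemma Ex_event (dT : measure_display) (T : measurableType dT) t (Y : Omega -> T)
    (B : set T) (f : Omega -> R) : from_source t Y -> measurable B ->
  pastfun t f -> L1 Pr f ->
  L1 Pr (fun w => \1_B (Y w) * f w) /\
  E (fun w => \1_B (Y w) * f w) = fine (Pr (Y @^-1` B)) * E f.
Proof.
move=> FY mB mf Lf.
have mY : measurable_fun setT Y.
  by move=> _ C mC; rewrite setTI; apply: F_meas; exact: FY.
have mI : measurable_fun setT (\1_B : T -> R) by exact: measurable_indic.
have LB : L1 Pr (fun w => \1_B (Y w) * f w).
  apply: (@L1_le _ _ _ _ _ (fun w => `|f w|)).
  - apply: measurable_funM; last exact: L1_measurable Lf.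
    exact: (measurableT_comp mI mY).
  - move=> w; rewrite normrM indicE; case: (_ \in _); rewrite ?normr1 ?mul1r//.
    by rewrite normr0 mul0r.
  - exact: integrable_abse Lf.
split => //.
(* The law of [Y] itself plays the part of [nu]. *)
pose nu : probability T R := distribution Pr (mfun_Sub (mem_set mY)).
have := @past_freeze_integrable _ _ nu t Y FY (fun _ _ => erefl)
  (fun w y => (\1_B y * f w)%:E).
rewrite /= => H; apply: EFin_inj; rewrite -L1_integral// H => [|//|]; last first.
- exact: LB.
- apply/measurable_EFinP; apply: measurable_funM.
    exact: (measurableT_comp mI).
  exact: (measurableT_comp mf).
rewrite EFinM -L1_integral// -integralZl//.
apply: eq_integral => w _.
under eq_integral do rewrite EFinM muleC.
rewrite integralZl//; last first.
  apply: (@L1_le _ _ _ nu _ (cst 1)) => //.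
  - by move=> y; rewrite indicE; case: (_ \in _); rewrite ?normr1 ?normr0.
  - exact: L1_cst.
rewrite integral_indic// setIT muleC fineK//.
by rewrite fin_num_measure// -[X in measurable X]setTI; exact: (mY measurableT B mB).
Qed.

Section vectors.
Context (d : nat).
Implicit Types X Y Z D : Omega -> 'rV[R]_d.

Definition adapted t X := @vmeas R d _ (Past t) X.

Lemma adapted_mono s t X : (s <= t)%N -> adapted s X -> adapted t X.
Proof. by move=> st aX j; exact: past_mono (aX j). Qed.

Lemma adapted_vmeas t X : adapted t X -> vmeas X.
Proof. by move=> aX j; exact: pastfun_measurable (aX j). Qed.

(** The martingale-difference property in weak form: orthogonality to all past square-integrable
    vectors stands in for a vanishing conditional expectation. *)
Definition centered t D := L2 Pr D /\
  forall Z, adapted t Z -> L2 Pr Z -> E (fun w => dot (Z w) (D w)) = 0.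

Lemma centered_nsqD t Z D : centered t D -> adapted t Z -> L2 Pr Z ->
  E (fun w => nsq (Z w + D w)) = E (fun w => nsq (Z w)) + E (fun w => nsq (D w)).
Proof.
by move=> [LD DZ] aZ LZ; rewrite Ex_nsqD// DZ// mulr0 addr0.
Qed.

(** Pythagoras, peeling off the last summand: all the others are known when it is drawn, so it is
    orthogonal to them. *)
Lemma centered_nsq_sum n t (D : 'I_n -> Omega -> 'rV[R]_d) Z :
  (forall i : 'I_n, centered (t + i) (D i)) ->
  (forall i : 'I_n, adapted (t + i).+1 (D i)) ->
  adapted t Z -> L2 Pr Z ->
  E (fun w => nsq (Z w + \sum_(i < n) D i w)) =
  E (fun w => nsq (Z w)) + \sum_(i < n) E (fun w => nsq (D i w)).
Proof.
elim: n D => [|n IH] D cD aD aZ LZ.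
  by rewrite big_ord0 addr0; congr E; apply/funext => w; rewrite big_ord0 addr0.
under eq_fun do rewrite big_ord_recr addrA.
rewrite (centered_nsqD (cD ord_max)).
- rewrite IH// ?big_ord_recr ?addrA// => i; [exact: (cD (widen_ord (leqnSn n) i))|exact: (aD (widen_ord (leqnSn n) i))].
- apply: vmeasD; first by apply: adapted_mono aZ; exact: leq_addr.
  apply: vmeas_sum => i; apply: adapted_mono (aD (widen_ord (leqnSn n) i)).
  by rewrite -addnS leq_add2l; exact: (ltn_ord i).
- by apply: L2D => //; apply: L2_sum => i; exact: (cD _).1.
Qed.

Lemma centered_dot_sum n t (D : 'I_n -> Omega -> 'rV[R]_d) Z :
  (forall i : 'I_n, centered (t + i) (D i)) -> adapted t Z -> L2 Pr Z ->
  E (fun w => dot (Z w) (\sum_(i < n) D i w)) = 0.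
Proof.
move=> cD aZ LZ; under eq_fun do rewrite dotC dot_suml.
rewrite Ex_sum => [|i]; last by apply: L1_dot => //; exact: (cD i).1.
apply: big1 => i _; under eq_fun do rewrite dotC.
by apply: (cD i).2 => //; apply: adapted_mono aZ; exact: leq_addr.
Qed.

Section compress.
Variables (Q : random_map R d) (dl : R) (t : nat) (Y : Omega -> seed Q).
Hypothesis Qc : contraction_compressor dl Q.
Hypothesis Qm : mean_scaling dl Q.
Hypothesis FY : from_source t Y.
Hypothesis Ynu : forall B, measurable B -> Pr (Y @^-1` B) = seed_law Q B.
Variable u : Omega -> 'rV[R]_d.
Hypothesis au : adapted t u.
Hypothesis Lu : L2 Pr u.

Let mrmap : @vmeas R d _ (Past t * seed Q)%type (fun z => rmap z.2 (u z.1)).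
Proof.
move=> j; have H : measurable_fun setT
    (fun z : Past t * seed Q => (z.2, u z.1) : seed Q * g_sigma_algebraType (@open 'rV[R]_d)).
  apply: measurable_fun_pair => //.
  exact: (measurableT_comp ((vmeas_borel _).1 au)).
exact: (measurableT_comp (rmap_measurable j) H).
Qed.

Let mu' : @vmeas R d _ (Past t * seed Q)%type (fun z => u z.1).
Proof. by move=> j; apply: (measurableT_comp (au j)). Qed.

Lemma compress_adapted : adapted t.+1 (fun w => rmap (Y w) (u w)).
Proof.
move=> j; have H : measurable_fun setT
    (fun w : Past t.+1 => (Y w, u w) : seed Q * g_sigma_algebraType (@open 'rV[R]_d)).
  apply: measurable_fun_pair; first exact: (from_source_past _ FY).
  by apply/vmeas_borel; apply: adapted_mono au.
exact: (measurableT_comp (rmap_measurable j) H).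
Qed.

(** With the input frozen, the compressor inequality for deterministic vectors applies and is then
    integrated over the past. *)
Lemma compress_error : L2 Pr (fun w => u w - rmap (Y w) (u w)) /\
  E (fun w => nsq (u w - rmap (Y w) (u w))) <= (1 - dl) * E (fun w => nsq (u w)).
Proof.
have mD := vmeasB (adapted_vmeas au) (adapted_vmeas compress_adapted).
have [L H] : L1 Pr (fun w => nsq (u w - rmap (Y w) (u w))) /\
  E (fun w => nsq (u w - rmap (Y w) (u w))) <= (1 - dl) * E (fun w => nsq (u w));
  last by [].
apply: L1_ge0_bounded; [exact: vmeas_nsq|by move=> w; exact: nsq_ge0|].
rewrite (past_freeze_ge0 FY Ynu (G := fun w s => (nsq (u w - rmap s (u w)))%:E)).
- have L1u := L1_nsq Lu; rewrite EFinM -L1_integral// -integralZl//.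
  apply: ge0_le_integral => //.
  + move=> w _; by apply: integral_ge0 => s _; rewrite lee_fin nsq_ge0.
  + have := @measurable_fun_fubini_tonelli_F _ _ (Past t) (seed Q) R (seed_law Q)
      (fun z => (nsq (u z.1 - rmap z.2 (u z.1)))%:E).
    move=> H; apply: (measurableT_comp (H _ _) (@mid t)).
    * by apply/measurable_EFinP; apply: vmeas_nsq; exact: vmeasB.
    * by move=> z; rewrite lee_fin nsq_ge0.
  + exact: (measurable_int _ (integrableZl measurableT (1 - dl) L1u)).
  + move=> w _; have [_ /(_ (u w))] := Qc; rewrite unlock.
    by under eq_integral do rewrite enorm_sq; rewrite enorm_sq EFinM.
- by apply/measurable_EFinP; apply: vmeas_nsq; exact: vmeasB.
- by move=> w s; rewrite lee_fin nsq_ge0.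
Qed.

Lemma compress_centered : centered t (fun w => dl *: u w - rmap (Y w) (u w)).
Proof.
have LD : L2 Pr (fun w => dl *: u w - rmap (Y w) (u w)).
  (* [dl *: u - Q u] is [(dl - 1) *: u] plus the compression error. *)
  have := L2D (L2Z (dl - 1) Lu) compress_error.1.
  congr L2; apply/funext => w; rewrite addrA -[X in _ + X - _]scale1r -scalerDl.
  by rewrite subrK.
split => // Z aZ LZ; apply: EFin_inj.
have LZD := L1_dot LZ LD; rewrite -L1_integral//.
rewrite (past_freeze_integrable FY Ynu
  (G := fun w s => (dot (Z w) (dl *: u w - rmap s (u w)))%:E)) => [|//|//].
- rewrite integral0_eq// => w _.
  have L : L1 (seed_law Q) (fun s => dot (Z w) (dl *: u w - rmap s (u w))).
    apply: (L1_dot (X := fun=> Z w)); first exact: L2_cst.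
    by apply: L2B; [exact: L2_cst|exact: rmap_L2 Qc _].
  by rewrite (L1_integral L) rmap_dot_mean.
- apply/measurable_EFinP; apply: vmeas_dot; last by apply: vmeasB => //; exact: vmeasZ.
  by move=> j; apply: (measurableT_comp (aZ j)).
Qed.

End compress.
End vectors.
End Adapted.

(** * Coin, sample index, and averaged compression *)

Section Sampling.
Context (R : realType) (dO : measure_display) (Omega : measurableType dO).
Variables (Pr : probability Omega R) (I : Type) (F : I -> set (set Omega)).
Variable src : nat -> I.
Hypothesis src_inj : injective src.
Hypothesis F_setT : forall i, F i setT.
Hypothesis F_setI : forall i, setI_closed (F i).
Hypothesis F_meas : forall i, F i `<=` measurable.
Hypothesis F_indep : mutually_independent Pr F.

Notation Past t := (g_sigma_algebraType (past F src t)).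
Notation E := (Ex Pr).

Lemma adapted_pastfun d t (X : Omega -> 'rV[R]_d) (g : 'rV[R]_d -> R) :
  adapted F src t X -> continuous g -> pastfun F src t (fun w => g (X w)).
Proof. by move=> aX cg; exact: (vmeas_comp_cont (T := Past t) aX cg). Qed.

(** The conditional is [f0] plus the indicator of heads times [f1 - f0], to which [Ex_event]
    applies. *)
Lemma Ex_coin t (c : Omega -> bool) (p : R) (f1 f0 : Omega -> R) :
  from_source F src t c -> Pr [set w | c w] = p%:E ->
  pastfun F src t f1 -> pastfun F src t f0 -> L1 Pr f1 -> L1 Pr f0 ->
  L1 Pr (fun w => if c w then f1 w else f0 w) /\
  E (fun w => if c w then f1 w else f0 w) = p * E f1 + (1 - p) * E f0.
Proof.
move=> Fc pc m1 m0 L1f L0f.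
have md : pastfun F src t (fun w => f1 w - f0 w) by exact: measurable_funB.
have Ld := L1B L1f L0f.
have mB : measurable [set true] by [].
have [LB EB] := Ex_event src_inj F_setT F_setI F_meas F_indep Fc mB md Ld.
have E1 : (fun w => if c w then f1 w else f0 w) =
    (fun w => \1_[set true] (c w) * (f1 w - f0 w) + f0 w).
  apply/funext => w; rewrite indicE; case: (c w).
    by rewrite mem_set// mul1r subrK.
  by rewrite memNset// mul0r add0r.
rewrite E1; split; first exact: L1D.
have -> : p = fine (Pr (c @^-1` [set true])).
  by rewrite (_ : _ @^-1` _ = [set w | c w]) ?pc.
by rewrite ExD// EB ExB//; ring.
Qed.

Section index.
Variables (m t : nat) (Y : Omega -> 'I_m).
Hypothesis FY : from_source F src t (fun w => nat_of_ord (Y w)).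
Hypothesis Yu : forall i, Pr [set w | Y w = i] = (m%:R^-1)%:E.

Let pY (i : 'I_m) : fine (Pr ((fun w => nat_of_ord (Y w)) @^-1` [set nat_of_ord i])) = m%:R^-1.
Proof.
rewrite (_ : _ @^-1` _ = [set w | Y w = i]) ?Yu//.
by apply/seteqP; split=> w /= => [/ord_inj//|->].
Qed.

Let expand (V : lmodType R) (a : 'I_m -> V) w :
  a (Y w) = \sum_(i < m) (\1_[set nat_of_ord i] (nat_of_ord (Y w)) : R) *: a i.
Proof.
rewrite (bigD1 (Y w))//= big1 => [|i iY].
  by rewrite addr0 indicE mem_set// scale1r.
rewrite indicE memNset ?scale0r// => /= /ord_inj E.
by rewrite E eqxx in iY.
Qed.

Lemma Ex_index (f : 'I_m -> Omega -> R) :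
  (forall i, pastfun F src t (f i)) -> (forall i, L1 Pr (f i)) ->
  L1 Pr (fun w => f (Y w) w) /\
  E (fun w => f (Y w) w) = m%:R^-1 * \sum_(i < m) E (f i).
Proof.
move=> mf Lf.
have mB (i : 'I_m) : measurable [set nat_of_ord i] by [].
have H i := Ex_event src_inj F_setT F_setI F_meas F_indep FY
  (mB i) (mf i) (Lf i).
have E1 : (fun w => f (Y w) w) =
    (fun w => \sum_(i < m) \1_[set nat_of_ord i] (nat_of_ord (Y w)) * f i w).
  by apply/funext => w; exact: (@expand R^o (fun i => f i w)).
rewrite E1; split; first by apply: L1_sum => i; exact: (H i).1.
rewrite Ex_sum => [|i]; last exact: (H i).1.
by rewrite mulr_sumr; apply: eq_bigr => i _; rewrite (H i).2 pY.
Qed.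

(** A uniformly drawn element of a family summing to zero has mean zero given the past. *)
Lemma index_centered d (a : 'I_m -> Omega -> 'rV[R]_d) :
  (forall i, adapted F src t (a i)) -> (forall i, L2 Pr (a i)) ->
  (forall w, \sum_(i < m) a i w = 0) ->
  [/\ centered Pr F src t (fun w => a (Y w) w),
      adapted F src t.+1 (fun w => a (Y w) w) &
      E (fun w => nsq (a (Y w) w)) = m%:R^-1 * \sum_(i < m) E (fun w => nsq (a i w))].
Proof.
move=> aa La a0.
have [L EL] := @Ex_index (fun i w => nsq (a i w))
  (fun i => vmeas_nsq (T := Past t) (aa i)) (fun i => L1_nsq (La i)).
have aY : adapted F src t.+1 (fun w => a (Y w) w).
  move=> j; have -> : (fun w => a (Y w) w 0 j) = (fun w =>
     \sum_(i < m) \1_[set nat_of_ord i] (nat_of_ord (Y w)) * a i w 0 j).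
    by apply/funext => w; exact: (@expand R^o (fun i => a i w 0 j)).
  apply: measurable_sum => i; apply: measurable_funM.
    have mI : measurable_fun setT (\1_[set nat_of_ord i] : nat -> R).
      exact: measurable_indic.
    by apply: (measurableT_comp mI); exact: (from_source_past F_setT _ FY).
  exact: (adapted_mono F_setT (leqnSn t) (aa i)).
split=> //; split; first by split; [exact: (adapted_vmeas F_meas aY)|].
move=> Z aZ LZ.
have [_ ->] := @Ex_index (fun i w => dot (Z w) (a i w))
  (fun i => vmeas_dot (T := Past t) aZ (aa i)) (fun i => L1_dot LZ (La i)).
rewrite -Ex_sum => [|i]; last exact: L1_dot.
rewrite (_ : (fun w => _) = fun=> 0) ?Ex_cst ?mulr0//.
apply/funext => w; under eq_bigr do rewrite dotC.
by rewrite -dot_suml a0 dot0l.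
Qed.

End index.

Section average.
Context (d n : nat).

Lemma centeredZ t c (D : Omega -> 'rV[R]_d) :
  centered Pr F src t D -> centered Pr F src t (fun w => c *: D w).
Proof.
move=> [LD DZ]; split=> [|Z aZ LZ]; first exact: L2Z.
by under eq_fun do rewrite dotZr; rewrite ExZ ?DZ ?mulr0//; exact: L1_dot.
Qed.

Lemma centered_nsq_mean t (D : 'I_n -> Omega -> 'rV[R]_d) Z :
  (forall i : 'I_n, centered Pr F src (t + i) (D i)) ->
  (forall i : 'I_n, adapted F src (t + i).+1 (D i)) ->
  adapted F src t Z -> L2 Pr Z ->
  E (fun w => nsq (Z w + mean (fun i => D i w))) =
  E (fun w => nsq (Z w)) +
    n%:R^-1 * (n%:R^-1 * \sum_(i < n) E (fun w => nsq (D i w))).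
Proof.
move=> cD aD aZ LZ.
have aD' (i : 'I_n) : adapted F src (t + i).+1 (fun w => n%:R^-1 *: D i w).
  exact: (vmeasZ _ (aD i)).
have := centered_nsq_sum F_setT (fun i => centeredZ n%:R^-1 (cD i)) aD' aZ LZ.
under eq_fun do rewrite -scaler_sumr.
rewrite /mean => ->; congr (_ + _); rewrite mulrA mulr_sumr; apply: eq_bigr => i _.
by rewrite Ex_nsqZ ?expr2//; exact: (cD i).1.
Qed.

Lemma centered_dot_mean t (D : 'I_n -> Omega -> 'rV[R]_d) Z :
  (forall i : 'I_n, centered Pr F src (t + i) (D i)) ->
  adapted F src t Z -> L2 Pr Z ->
  E (fun w => dot (Z w) (mean (fun i => D i w))) = 0.
Proof.
move=> cD aZ LZ.
have := centered_dot_sum F_setT (fun i => centeredZ n%:R^-1 (cD i)) aZ LZ.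
by under eq_fun do rewrite -scaler_sumr.
Qed.

(** The averaged error is [(1 - dl)] times the averaged input plus the average of the centred [D i],
    whose squares add up with weight [n ^- 2]. For a single node the same splitting reads [E|u - Q
    u|^2 = (1 - dl)^2 E|u|^2 + E|D|^2]; as the left side is at most [(1 - dl) E|u|^2], the centred
    part is at most [dl * (1 - dl) E|u|^2]. *)
Lemma compress_mean (Q : random_map R d) (dl : R) t (Y : 'I_n -> Omega -> seed Q)
    (u : 'I_n -> Omega -> 'rV[R]_d) :
  contraction_compressor dl Q -> mean_scaling dl Q ->
  (forall i : 'I_n, from_source F src (t + i) (Y i)) ->
  (forall i B, measurable B -> Pr (Y i @^-1` B) = seed_law Q B) ->
  (forall i, adapted F src t (u i)) -> (forall i, L2 Pr (u i)) ->
  E (fun w => nsq (mean (fun i => u i w - rmap (Y i w) (u i w)))) <=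
  (1 - dl) ^+ 2 * E (fun w => nsq (mean (fun i => u i w))) +
  dl * (1 - dl) / n%:R * (n%:R^-1 * \sum_(i < n) E (fun w => nsq (u i w))).
Proof.
move=> Qc Qm FY Ynu au Lu.
have dl01 := Qc.1.
pose D (i : 'I_n) w := dl *: u i w - rmap (Y i w) (u i w).
have au' (i : 'I_n) : adapted F src (t + i) (u i).
  by apply: adapted_mono (au i) => //; exact: leq_addr.
have cD (i : 'I_n) : centered Pr F src (t + i) (D i).
  exact: (compress_centered src_inj F_setT F_setI F_meas F_indep Qc Qm (FY i)
    (Ynu i) (au' i) (Lu i)).
have aD (i : 'I_n) : adapted F src (t + i).+1 (D i).
  have aq := compress_adapted F_setT (FY i) (au' i).
  have au'' := adapted_mono F_setT (leqnSn (t + i)) (au' i).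
  exact: (vmeasB (vmeasZ _ au'') aq).
have aZ : adapted F src t (fun w => (1 - dl) *: mean (fun i => u i w)).
  exact: (vmeasZ _ (vmeas_mean (T := Past t) au)).
have LM : L2 Pr (fun w => mean (fun i => u i w)) by exact: L2_mean.
have := centered_nsq_mean cD aD aZ (L2Z (1 - dl) LM).
have -> : (fun w => nsq ((1 - dl) *: mean (fun i => u i w) + mean (fun i => D i w))) =
    (fun w => nsq (mean (fun i => u i w - rmap (Y i w) (u i w)))).
  apply/funext => w; congr nsq; rewrite /mean scalerA mulrC -scalerA -scalerDr.
  congr (_ *: _); rewrite scaler_sumr -big_split; apply: eq_bigr => i _.
  by rewrite /D scalerBl scale1r; apply/rowP => j; rewrite !mxE; ring.
move=> ->; rewrite Ex_nsqZ// lerD2l.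
have n0 : 0 <= n%:R^-1 :> R by rewrite invr_ge0.
rewrite [leRHS](_ : _ = n%:R^-1 * (n%:R^-1 * \sum_(i < n)
   (dl * (1 - dl) * E (fun w => nsq (u i w))))); last by rewrite -mulr_sumr; ring.
do 2 (rewrite ler_wpM2l//).
apply: ler_sum => i _.
have [LE HE] := compress_error src_inj F_setT F_setI F_meas F_indep Qc (FY i)
  (Ynu i) (au' i) (Lu i).
have := centered_nsqD (cD i) (vmeasZ (1 - dl) (au' i)) (L2Z (1 - dl) (Lu i)).
rewrite Ex_nsqZ//.
have -> : (fun w => nsq ((1 - dl) *: u i w + D i w)) =
    (fun w => nsq (u i w - rmap (Y i w) (u i w))).
  by apply/funext => w; rewrite /D scalerBl scale1r addrA subrK.
by move: HE => /[swap] ->; lra.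
Qed.

End average.

End Sampling.

(** * The iterates *)

Section Sources.
Context (n : nat).
Hypothesis n_gt0 : (0 < n)%N.

(** Each round uses [n] indices, [n] seeds for each of the two compressors and one coin. *)
Definition round_start (k : nat) : nat := (k * (3 * n).+1)%N.

(* Enumerates the sources round by round: the sample indices, the seeds of [Q],
   the seeds of [Q1] and the coin. *)
Definition nth_source (t : nat) : source n :=
  let k := (t %/ (3 * n).+1)%N in
  let j := (t %% (3 * n).+1)%N in
  let i := Ordinal (ltn_pmod j n_gt0) in
  match (j %/ n)%N with
  | 0 => IdxSource k i
  | 1 => QSource k i
  | 2 => Q1Source k i
  | _ => CoinSource n k
  end.

Definition source_rank (s : source n) : nat :=
  match s with
  | IdxSource k i => round_start k + i
  | QSource k i => round_start k + n + i
  | Q1Source k i => round_start k + 2 * n + i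
  | CoinSource k => round_start k + 3 * n
  end.

Lemma nth_sourceK : cancel nth_source source_rank.
Proof.
move=> t; rewrite /nth_source.
have Et := divn_eq t (3 * n).+1.
have Hj : (t %% (3 * n).+1 < (3 * n).+1)%N by rewrite ltn_mod.
move: (t %% _)%N (t %/ _)%N Et Hj => j k -> Hj.
have Ej := divn_eq j n.
have Hi : (j %% n < n)%N by rewrite ltn_mod.
move: Ej; case E : (j %/ n)%N => [|[|[|q]]] Ej /=; rewrite /round_start.
- by rewrite {2}Ej mul0n add0n.
- by rewrite {2}Ej mul1n addnA.
- by rewrite {2}Ej addnA.
(* A quotient of at least 3 together with [j < 3 * n + 1] leaves only [j = 3 * n], the coin. *)
- congr (_ + _)%N; apply/eqP; rewrite eqn_leq; apply/andP; split; last by rewrite -ltnS.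
  by rewrite Ej; apply: leq_trans (leq_addr _ _); rewrite leq_mul2r orbT.
Qed.

Lemma nth_source_inj : injective nth_source.
Proof. exact: can_inj nth_sourceK. Qed.

Let decode k q (i : nat) : (i < n)%N -> (q < 3)%N ->
  [/\ ((round_start k + q * n + i) %/ (3 * n).+1)%N = k,
      ((round_start k + q * n + i) %% (3 * n).+1)%N = (q * n + i)%N,
      ((q * n + i) %/ n)%N = q & ((q * n + i) %% n)%N = i].
Proof.
move=> ilt q3.
have H : (q * n + i < (3 * n).+1)%N.
  rewrite ltnS; apply: (@leq_trans (q * n + n)); first by rewrite leq_add2l ltnW.
  by rewrite -mulSnr leq_mul2r q3 orbT.
split.
- by rewrite -addnA divnMDl// divn_small// addn0.
- by rewrite -addnA modnMDl modn_small.
- by rewrite divnMDl// divn_small// addn0.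
- by rewrite modnMDl modn_small.
Qed.

Lemma nth_source_idx k (i : 'I_n) : nth_source (round_start k + i) = IdxSource k i.
Proof.
have [E1 E2 E3 E4] := @decode k 0 i (ltn_ord i) isT.
rewrite mul0n addn0 add0n in E1 E2 E3 E4.
rewrite /nth_source E1; move: (ltn_pmod _ n_gt0); rewrite E2 E3 E4 => ii.
by congr IdxSource; exact: val_inj.
Qed.

Lemma nth_source_Q k (i : 'I_n) : nth_source (round_start k + n + i) = QSource k i.
Proof.
have [E1 E2 E3 E4] := @decode k 1 i (ltn_ord i) isT.
rewrite mul1n in E1 E2 E3 E4.
rewrite /nth_source E1; move: (ltn_pmod _ n_gt0); rewrite E2 E3 E4 => ii.
by congr QSource; exact: val_inj.
Qed.

Lemma nth_source_Q1 k (i : 'I_n) :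
  nth_source (round_start k + 2 * n + i) = Q1Source k i.
Proof.
have [E1 E2 E3 E4] := @decode k 2 i (ltn_ord i) isT.
rewrite /nth_source E1; move: (ltn_pmod _ n_gt0); rewrite E2 E3 E4 => ii.
by congr Q1Source; exact: val_inj.
Qed.

Lemma nth_source_coin k : nth_source (round_start k + 3 * n) = CoinSource n k.
Proof.
have E1 : ((round_start k + 3 * n) %/ (3 * n).+1 = k)%N.
  by rewrite divnMDl// divn_small ?ltnSn// addn0.
have E2 : ((round_start k + 3 * n) %% (3 * n).+1 = 3 * n)%N.
  by rewrite modnMDl modn_small.
by rewrite /nth_source E1; move: (ltn_pmod _ n_gt0); rewrite E2 mulnK.
Qed.

End Sources.

Section Invariants.
Context (R : realType) (A : ec_lsvrg R).
Hypothesis HA : ec_lsvrg_assumptions A.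

Notation d := (Defs.dim A).
Notation n := (nodes A).
Notation m := (samples A).
Notation P := (pb A).
Notation Rv := ('rV[R]_d).

Let HP : erm_assumptions P := A_problem HA.
Let HS := A_sampling HA.
Let ngt0 : (0 < n)%N := n_gt0 HP.

Definition evs := source_events (@draws R A).
Definition nsrc := nth_source ngt0.
Notation adap t X := (adapted evs nsrc t X).
Notation E := (Ex (Pr A)).
Notation T k := (round_start n k).

Lemma nsrc_inj : injective nsrc. Proof. exact: nth_source_inj. Qed.

Lemma evs_setT s : evs s setT.
Proof.
by case: s => [k i|k i|k i|k]; exists setT; rewrite ?setTI ?preimage_setT//; exact: measurableT.
Qed.

Lemma evs_setI s : setI_closed (evs s).
Proof.
by case: s => [k i|k i|k i|k] _ _ [B mB <-] [C mC <-]; exists (B `&` C);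
  rewrite ?setTI ?preimage_setI//; exact: measurableI.
Qed.

Lemma evs_meas s : evs s `<=` measurable.
Proof. exact: (sources_measurable HS). Qed.

Lemma evs_indep : mutually_independent (Pr A) evs.
Proof. exact: (sources_independent HS). Qed.

Lemma idx_source k (i : 'I_n) :
  from_source evs nsrc (T k + i) (fun w => nat_of_ord (idx (draws k w) i)).
Proof.
move=> B mB; rewrite /nsrc nth_source_idx.
by exists ((fun a : 'I_m => nat_of_ord a) @^-1` B) => //; rewrite setTI.
Qed.

Lemma Q_source k (i : 'I_n) :
  from_source evs nsrc (T k + n + i) (fun w => seedQ (draws k w) i).
Proof. by move=> B mB; rewrite /nsrc nth_source_Q; exists B => //; rewrite setTI. Qed.

Lemma Q1_source k (i : 'I_n) :
  from_source evs nsrc (T k + 2 * n + i) (fun w => seedQ1 (draws k w) i).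
Proof. by move=> B mB; rewrite /nsrc nth_source_Q1; exists B => //; rewrite setTI. Qed.

Lemma coin_source k : from_source evs nsrc (T k + 3 * n) (fun w => coin (draws k w)).
Proof. by move=> B mB; rewrite /nsrc nth_source_coin; exists B => //; rewrite setTI. Qed.

Lemma Q_law k i B : measurable B ->
  Pr A ((fun w => seedQ (draws k w) i) @^-1` B) = seed_law (compQ A) B.
Proof. exact: (seedQ_law HS). Qed.

Lemma Q1_law k i B : measurable B ->
  Pr A ((fun w => seedQ1 (draws k w) i) @^-1` B) = seed_law (compQ1 A) B.
Proof. exact: (seedQ1_law HS). Qed.

Definition xk k w : Rv := st_x (iterate k w).
Definition wk k w : Rv := st_w (iterate k w).
Definition ek k (i : 'I_n) w : Rv := st_e (iterate k w) i.
Definition hk k (i : 'I_n) w : Rv := st_h (iterate k w) i.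
Definition hb k w : Rv := mean (fun i => hk k i w).
Definition gk k i w : Rv := grad (loss P i (idx (draws k w) i)) (xk k w)
  - grad (loss P i (idx (draws k w) i)) (wk k w) + grad (fnode P i) (wk k w) - hk k i w.
Definition uk k i w : Rv := eta A *: gk k i w + ek k i w.
Definition vk k i w : Rv := grad (fnode P i) (wk k w) - hk k i w.
Definition yk k i w : Rv := rmap (seedQ (draws k w) i) (uk k i w).
Definition zk k i w : Rv := rmap (seedQ1 (draws k w) i) (vk k i w).

(** The server's shift is always the average of the node shifts, so it needs no recurrence of its
    own. *)
Lemma st_hbarE k w : st_hbar (iterate k w) = hb k w.
Proof.
rewrite /hb /hk; elim: k => [|k]; first by [].
rewrite /=; case: (iterate k w) => x w' e h h' /= ->.
by rewrite /mean -scalerDr -big_split.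
Qed.

Lemma xkS k w : xk k.+1 w = prox (eta A) (psi P)
  (xk k w - (mean (fun i => yk k i w) + eta A *: hb k w)).
Proof.
rewrite -st_hbarE /yk /uk /gk /xk /wk /ek /hk /=.
by case: (iterate k w).
Qed.

Lemma wkS k w : wk k.+1 w = if coin (draws k w) then xk k w else wk k w.
Proof. by rewrite /wk /xk /=; case: (iterate k w). Qed.

Lemma ekS k i w : ek k.+1 i w = uk k i w - yk k i w.
Proof.
rewrite /yk /uk /gk /ek /xk /wk /hk /=.
by case: (iterate k w) => x w' e h h' /=; congr (_ - _); rewrite addrC.
Qed.

Lemma hkS k i w : hk k.+1 i w = hk k i w + zk k i w.
Proof. by rewrite /zk /vk /hk /wk /=; case: (iterate k w). Qed.

Lemma fnode_convex i : convex_fun (fnode P i).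
Proof.
by apply: convex_avg => [|j]; [rewrite invr_ge0|exact: loss_convex HP _ _].
Qed.

Lemma favg_convex : convex_fun (favg P).
Proof.
by apply: convex_avg => [|j]; [rewrite invr_ge0|exact: fnode_convex].
Qed.

Lemma grad_fnode i x : grad (fnode P i) x = mean (fun j => grad (loss P i j) x).
Proof. by apply: grad_avg => j z; exact: (loss_smooth HP i j).1. Qed.

Lemma grad_favg x : grad (favg P) x = mean (fun i => grad (fnode P i) x).
Proof. by apply: grad_avg => j z; exact: (fnode_smooth HP j).1. Qed.

Lemma bregman_fnode i x y :
  bregman (fnode P i) x y = m%:R^-1 * \sum_(j < m) bregman (loss P i j) x y.
Proof. by apply: bregman_avg => j z; exact: (loss_smooth HP i j).1. Qed.

Lemma bregman_favg x y :
  bregman (favg P) x y = n%:R^-1 * \sum_(i < n) bregman (fnode P i) x y.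
Proof. by apply: bregman_avg => j z; exact: (fnode_smooth HP j).1. Qed.

Notation xs := (xstar P).
Notation gs := (grad (favg P) xs).

Lemma xstar_first_order : dom (psi P) xs /\ forall y, dom (psi P) y ->
  psir (psi P) xs - dot gs (y - xs) + sc_mu P / 2 * nsq (y - xs) <= psir (psi P) y.
Proof.
have L0 := ltW (Lf_gt0 HP).
apply: (min_subgradient (mu_ge0 HP) (psi_proper HP) (psi_strongly_convex HP)
  (h := favg P) (C := smLf P / 2)).
- by rewrite divr_ge0.
- by move=> y; have := bregman_le y xs L0 (favg_smooth HP); rewrite /bregman; lra.
- exact: (xstar_opt HP).
Qed.

(** Optimality of [xstar] provides the affine minorant from which existence and nonexpansiveness of
    the prox are derived. *)
Lemma psi_minorant y :
  ((psir (psi P) xs + dot (- gs) (y - xs))%:E <= psi P y)%E.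
Proof.
have [ds H] := xstar_first_order.
have [dy|dy] := boolP (psi P y < +oo)%E; last first.
  have -> : psi P y = +oo%E by move: dy; rewrite ltNge negbK leye_eq => /eqP.
  exact: leey.
rewrite (psirE (psi_proper HP) dy) lee_fin dotNl; have := H y dy.
have : 0 <= sc_mu P / 2 * nsq (y - xs).
  by rewrite mulr_ge0 ?nsq_ge0// divr_ge0// (mu_ge0 HP).
by lra.
Qed.

Lemma prox_adapted t (X : Omega A -> Rv) : adap t X -> adap t (fun w => prox (eta A) (psi P) (X w)).
Proof.
move=> aX j; apply: (adapted_pastfun (g := fun v => prox (eta A) (psi P) v 0 j) aX).
exact: (prox_continuous (mu_ge0 HP) (psi_proper HP) (psi_closed HP)
  (psi_strongly_convex HP) (A_eta HA) psi_minorant xstar_first_order.1).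
Qed.

Lemma prox_L2 (X : Omega A -> Rv) : L2 (Pr A) X -> vmeas (fun w => prox (eta A) (psi P) (X w)) ->
  L2 (Pr A) (fun w => prox (eta A) (psi P) (X w)).
Proof.
move=> LX mp; set c := prox (eta A) (psi P) 0.
apply: (@L2_le _ _ _ _ _ _ (fun w => 2 * nsq (X w) + 2 * nsq c)) => //; last first.
  by apply: L1D; [exact/L1Z/L1_nsq|exact: L1_cst].
move=> w; have := nsqD_le2 (prox (eta A) (psi P) (X w) - c) c; rewrite subrK.
have := prox_nonexpansive (mu_ge0 HP) (psi_proper HP) (psi_closed HP)
  (psi_strongly_convex HP) (A_eta HA) psi_minorant xstar_first_order.1 (X w) 0.
rewrite subr0 -/c; move: (prox _ _ _) => z; lra.
Qed.

Lemma grad_adapted t (X : Omega A -> Rv) (L : R) (f : Rv -> R) : 0 <= L -> smooth L f -> adap t X ->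
  adap t (fun w => grad f (X w)).
Proof.
move=> L0 Lf aX j; apply: (adapted_pastfun (g := fun v => grad f v 0 j) aX).
exact: grad_continuous Lf.
Qed.

Lemma grad_L2 (X : Omega A -> Rv) (L : R) (f : Rv -> R) : 0 <= L -> smooth L f -> L2 (Pr A) X ->
  L2 (Pr A) (fun w => grad f (X w)).
Proof.
move=> L0 Lf [mX LX].
apply: (@L2_le _ _ _ _ _ _ (fun w => 2 * (L ^+ 2 * nsq (X w)) + 2 * nsq (grad f 0))).
- by move=> j; apply: (vmeas_comp_cont (g := fun v => grad f v 0 j) mX);
    exact: grad_continuous Lf.
- move=> w; have := nsqD_le2 (grad f (X w) - grad f 0) (grad f 0); rewrite subrK.
  have := smooth_nsq (X w) 0 L0 Lf; rewrite subr0; move: (grad _ _) => z; lra.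
- by apply: L1D; [exact/L1Z/L1Z|exact: L1_cst].
Qed.

End Invariants.

(** * Measurability and integrability of the iterates *)

Section Integrability.
Context (R : realType) (A : ec_lsvrg R).
Hypothesis HA : ec_lsvrg_assumptions A.

Notation d := (Defs.dim A).
Notation n := (nodes A).
Notation m := (samples A).
Notation P := (pb A).
Notation Rv := ('rV[R]_d).

Let HP : erm_assumptions P := A_problem HA.
Let HS := A_sampling HA.

Notation F := (@evs R A).
Notation src := (nsrc HA).
Notation adap t X := (adapted F src t X).
Notation E := (Ex (Pr A)).
Notation T k := (round_start n k).

Let F_setT := @evs_setT R A.
Let F_meas := evs_meas HA.

Definition good t (X : Omega A -> Rv) := adap t X /\ L2 (Pr A) X.

Lemma good_mono s t X : (s <= t)%N -> good s X -> good t X.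
Proof. by move=> st [aX LX]; split=> //; exact: (adapted_mono F_setT st aX). Qed.

Lemma goodD t X Y : good t X -> good t Y -> good t (fun w => X w + Y w).
Proof. by move=> [aX LX] [aY LY]; split; [exact: vmeasD aX aY|exact: L2D]. Qed.

Lemma goodB t X Y : good t X -> good t Y -> good t (fun w => X w - Y w).
Proof. by move=> [aX LX] [aY LY]; split; [exact: vmeasB aX aY|exact: L2B]. Qed.

Lemma goodZ t a X : good t X -> good t (fun w => a *: X w).
Proof. by move=> [aX LX]; split; [exact: (vmeasZ a aX)|exact: L2Z]. Qed.

Lemma good_cst t v : good t (fun=> v).
Proof. by split; [exact: vmeas_cst|exact: L2_cst]. Qed.

Lemma good_mean t k (X : 'I_k -> Omega A -> Rv) : (forall i, good t (X i)) ->
  good t (fun w => mean (fun i => X i w)).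
Proof.
move=> gX; split; last by apply: L2_mean => i; exact: (gX i).2.
exact: (vmeas_mean (T := g_sigma_algebraType (past F src t)) (fun i => (gX i).1)).
Qed.

Lemma good_grad t X (L : R) (f : Rv -> R) : 0 <= L -> smooth L f ->
  good t X -> good t (fun w => grad f (X w)).
Proof.
by move=> L0 Lf [aX LX]; split; [exact: (grad_adapted L0 Lf aX)|exact: (grad_L2 L0 Lf LX)].
Qed.

Lemma good_prox t X : good t X -> good t (fun w => prox (eta A) (psi P) (X w)).
Proof.
move=> [aX LX]; have aP := prox_adapted aX; split=> //.
by apply: (prox_L2 HA) => //; exact: (adapted_vmeas F_meas aP).
Qed.

(** The sampling noise if index [j] is drawn: the gradient difference of one loss minus the average
    of these differences over the node. *)
Definition ak k i (j : 'I_m) w : Rv :=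
  grad (loss P i j) (xk k w) - grad (loss P i j) (wk k w)
  - (grad (fnode P i) (xk k w) - grad (fnode P i) (wk k w)).
Definition xik k i w : Rv := ak k i (idx (draws k w) i) w.
(** The part of the estimator [gk] that is known before the index is drawn; the remainder is the
    noise [xik]. *)
Definition mk k i w : Rv := grad (fnode P i) (xk k w) - hk k i w.

Lemma gkE k i w : gk k i w = mk k i w + xik k i w.
Proof. by rewrite /gk /mk /xik /ak; apply/rowP => j; rewrite !mxE; ring. Qed.

Lemma sum_ak k i w : \sum_(j < m) ak k i j w = 0.
Proof.
rewrite /ak !sumrB !sumr_const card_ord !(grad_fnode HA) /mean.
have m0 : m%:R != 0 :> R by rewrite pnatr_eq0 -lt0n (m_gt0 HP).
have K (v : Rv) : (m%:R^-1 *: v) *+ m = v by rewrite -scaler_nat scalerA divff// scale1r.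
by rewrite !K subrr.
Qed.

(** All components of the state are square-integrable and determined by the sources of earlier
    rounds. *)
Definition invariant k := [/\ good (T k) (xk k), good (T k) (wk k),
  forall i, good (T k) (ek k i) & forall i, good (T k) (hk k i)].

Section step.
Variable k : nat.
Hypothesis Ik : invariant k.

Let gx : good (T k) (xk k). Proof. by case: Ik. Qed.
Let gw : good (T k) (wk k). Proof. by case: Ik. Qed.
Let ge i : good (T k) (ek k i). Proof. by case: Ik. Qed.
Let gh i : good (T k) (hk k i). Proof. by case: Ik. Qed.

Lemma good_ak i j : good (T k) (ak k i j).
Proof.
have Gl X (gX : good (T k) X) : good (T k) (fun w => grad (loss P i j) (X w)).
  exact: (good_grad (L_ge0 HP) (loss_smooth HP i j) gX).
have Gf X (gX : good (T k) X) : good (T k) (fun w => grad (fnode P i) (X w)).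
  exact: (good_grad (Lbar_ge0 HP) (fnode_smooth HP i) gX).
exact: (goodB (goodB (Gl _ gx) (Gl _ gw)) (goodB (Gf _ gx) (Gf _ gw))).
Qed.

Lemma xik_centered (i : 'I_n) : [/\ centered (Pr A) F src (T k + i) (xik k i),
  adap (T k + i).+1 (xik k i) &
  E (fun w => nsq (xik k i w)) = m%:R^-1 * \sum_(j < m) E (fun w => nsq (ak k i j w))].
Proof.
have aa j : adap (T k + i) (ak k i j).
  exact: (good_mono (leq_addr i (T k)) (good_ak i j)).1.
have [c1 c2 c3] := (index_centered (@nsrc_inj R A HA) F_setT (@evs_setI R A) F_meas (evs_indep HA)
  (idx_source HA k i) (idx_uniform HS k i) aa (fun j => (good_ak i j).2) (sum_ak k i)).
by split; [exact: c1|exact: c2|exact: c3].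
Qed.

Lemma good_xik (i : 'I_n) : good (T k + n) (xik k i).
Proof.
have [[LD _] aD _] := xik_centered i; split=> //.
by apply: (adapted_mono F_setT _ aD); rewrite -addnS leq_add2l.
Qed.

Lemma good_mk i : good (T k) (mk k i).
Proof.
exact: (goodB (good_grad (Lbar_ge0 HP) (fnode_smooth HP i) gx) (gh i)).
Qed.

Lemma good_vk i : good (T k) (vk k i).
Proof.
exact: (goodB (good_grad (Lbar_ge0 HP) (fnode_smooth HP i) gw) (gh i)).
Qed.

Lemma good_uk i : good (T k + n) (uk k i).
Proof.
have -> : uk k i = (fun w => eta A *: (mk k i w + xik k i w) + ek k i w).
  by apply/funext => w; rewrite /uk gkE.
apply: goodD; last exact: good_mono (leq_addr _ _) (ge i).
apply: goodZ; apply: goodD; last exact: good_xik.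
exact: good_mono (leq_addr _ _) (good_mk i).
Qed.

Lemma yk_error (i : 'I_n) : L2 (Pr A) (fun w => uk k i w - yk k i w) /\
  E (fun w => nsq (uk k i w - yk k i w)) <= (1 - delta A) * E (fun w => nsq (uk k i w)).
Proof.
have [au Lu] := good_mono (leq_addr i _) (good_uk i).
exact: (compress_error (@nsrc_inj R A HA) F_setT (@evs_setI R A) F_meas (evs_indep HA)
  (A_compressor HA) (Q_source HA k i) (Q_law HA k i) au Lu).
Qed.

Lemma good_yk (i : 'I_n) : good (T k + 2 * n) (yk k i).
Proof.
have [au Lu] := good_mono (leq_addr i _) (good_uk i).
split.
  apply: (adapted_mono F_setT _ (compress_adapted F_setT (Q_source HA k i) au)).
  by rewrite -addnS -addnA leq_add2l mul2n -addnn leq_add2l.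
have := L2B Lu (yk_error i).1.
by under eq_fun do rewrite subKr.
Qed.

Lemma zk_error (i : 'I_n) : L2 (Pr A) (fun w => vk k i w - zk k i w) /\
  E (fun w => nsq (vk k i w - zk k i w)) <= (1 - delta1 A) * E (fun w => nsq (vk k i w)).
Proof.
have le : (T k <= T k + 2 * n + i)%N by rewrite -addnA leq_addr.
have [au Lu] := good_mono le (good_vk i).
exact: (compress_error (@nsrc_inj R A HA) F_setT (@evs_setI R A) F_meas (evs_indep HA)
  (A_compressor1 HA) (Q1_source HA k i) (Q1_law HA k i) au Lu).
Qed.

Lemma good_zk (i : 'I_n) : good (T k + 3 * n) (zk k i).
Proof.
have le : (T k <= T k + 2 * n + i)%N by rewrite -addnA leq_addr.
have [au Lu] := good_mono le (good_vk i).
split.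
  apply: (adapted_mono F_setT _ (compress_adapted F_setT (Q1_source HA k i) au)).
  by rewrite -addnS -addnA leq_add2l [(3 * n)%N]mulSn addnC leq_add2r.
have := L2B Lu (zk_error i).1.
by under eq_fun do rewrite subKr.
Qed.

Lemma good_hb : good (T k) (hb k).
Proof. exact: good_mean. Qed.

Let le2 : (T k + 2 * n <= T k + 3 * n)%N.
Proof. by rewrite leq_add2l leq_mul2r orbT. Qed.

Lemma good_xS : good (T k + 3 * n) (xk k.+1).
Proof.
have -> : xk k.+1 = (fun w => prox (eta A) (psi P)
  (xk k w - (mean (fun i => yk k i w) + eta A *: hb k w))).
  by apply/funext => w; exact: xkS.
have le : (T k <= T k + 2 * n)%N by exact: leq_addr.
apply: (good_mono le2); apply: good_prox; apply: goodB.
  exact: good_mono le gx.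
apply: goodD; first by apply: good_mean => i; exact: good_yk.
by apply: goodZ; exact: good_mono le good_hb.
Qed.

(** The time [T k + 3 * n] is just before the coin: [refresh_bound] compares the refreshed gradient
    with the new shift and needs the latter to be known already. *)
Lemma good_hS i : good (T k + 3 * n) (hk k.+1 i).
Proof.
have -> : hk k.+1 i = (fun w => hk k i w + zk k i w).
  by apply/funext => w; exact: hkS.
by apply: goodD; [exact: good_mono (leq_addr _ _) (gh i)|exact: good_zk].
Qed.

Lemma good_eS i : good (T k + 3 * n) (ek k.+1 i).
Proof.
have -> : ek k.+1 i = (fun w => uk k i w - yk k i w).
  by apply/funext => w; exact: ekS.
apply: (good_mono le2); apply: goodB (good_yk i).
by apply: good_mono (good_uk i); rewrite leq_add2l leq_pmull.
Qed.

Lemma T_succ : T k.+1 = (T k + 3 * n).+1.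
Proof. by rewrite /round_start mulSnr addnS. Qed.

Lemma invariant_succ : invariant k.+1.
Proof.
have le : (T k + 3 * n <= T k.+1)%N by rewrite T_succ.
split.
- exact: good_mono le good_xS.
(* Writing the refresh with an indicator exhibits it as a measurable product plus a known vector. *)
- have -> : @wk R A k.+1 = (fun w => (\1_[set true] (coin (draws k w)) : R) *: (xk k w - wk k w)
       + wk k w).
    apply/funext => w; rewrite wkS indicE; case: (coin _).
      by rewrite mem_set// scale1r subrK.
    by rewrite memNset// scale0r add0r.
  have le' : (T k <= T k.+1)%N by apply: leq_trans le; exact: leq_addr.
  have [ad Ld] := good_mono le' (goodB gx gw).
  apply: goodD; last exact: good_mono le' gw.
  split.
    move=> j; under eq_fun do rewrite mxE.
    apply: measurable_funM; last exact: ad.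
    have mI : measurable_fun setT (\1_[set true] : bool -> R) by exact: measurable_indic.
    apply: (measurableT_comp mI); apply: (from_source_past F_setT _ (coin_source HA k)).
    by rewrite T_succ.
  apply: (@L2_le _ _ _ _ _ _ (fun w => nsq (xk k w - wk k w))); last exact: L1_nsq.
    move=> j; under eq_fun do rewrite mxE.
    apply: measurable_funM; last exact: (Ld.1 j).
    have mI : measurable_fun setT (\1_[set true] : bool -> R) by exact: measurable_indic.
    apply: (measurableT_comp mI) => _ B mB; rewrite setTI; apply: F_meas.
    exact: (coin_source HA k).
  move=> w; rewrite nsqZ indicE; case: (_ \in _).
    by rewrite expr1n mul1r.
  by rewrite expr0n mul0r nsq_ge0.
- by move=> i; exact: good_mono le (good_eS i).
- by move=> i; exact: good_mono le (good_hS i).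
Qed.

End step.

Lemma invariant_all k : invariant k.
Proof.
elim: k => [|k /invariant_succ//].
by split; [| |move=> i|move=> i]; exact: good_cst.
Qed.

End Integrability.

(** * One-step inequalities *)

Section OneStepInequalities.
Context (R : realType) (A : ec_lsvrg R).
Hypothesis HA : ec_lsvrg_assumptions A.

Notation d := (Defs.dim A).
Notation n := (nodes A).
Notation P := (pb A).
Notation Rv := ('rV[R]_d).

Let HP : erm_assumptions P := A_problem HA.

Notation E := (Ex (Pr A)).
Notation T k := (round_start n k).
Notation xs := (xstar P).
Notation psr := (psir (psi P)).

Hypothesis dx0 : dom (psi P) (x_init A).
Hypothesis stepsize : eta A <= 1 / bigM A.

Let F_setT := @evs_setT R A.
Let F_meas := evs_meas HA.
Let inj := @nsrc_inj R A HA.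
Let Lf0 := ltW (Lf_gt0 HP).
Let eta0 := A_eta HA.
Let n0 : 0 < n%:R :> R. Proof. by rewrite ltr0n (n_gt0 HP). Qed.
Let iv := invariant_all HA.

Definition ebar k w : Rv := mean (fun i => ek (A := A) k i w).
Definition br (x : Rv) : R := bregman (favg P) x xs.
(** Real-valued because [dom_xk] keeps every iterate in the domain of [psi]. *)
Definition gap k w : R :=
  favg P (xk (A := A) k w) + psr (xk k w) - (favg P xs + psr xs).

Lemma good_x k : good HA (T k) (xk k). Proof. by case: (iv k). Qed.
Lemma good_w k : good HA (T k) (wk k). Proof. by case: (iv k). Qed.
Lemma good_e k i : good HA (T k) (ek k i). Proof. by case: (iv k). Qed.
Lemma good_h k i : good HA (T k) (hk k i). Proof. by case: (iv k). Qed.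
Lemma good_ebar k : good HA (T k) (ebar k).
Proof. exact: (good_mean (fun i => good_e k i)). Qed.
Lemma good_h_mean k : good HA (T k) (hb k).
Proof. exact: (good_mean (fun i => good_h k i)). Qed.

Lemma dom_xk k w : dom (psi P) (xk (A := A) k w).
Proof.
case: k => [|k]; first exact: dx0.
rewrite xkS.
by have [] := prox_spec (mu_ge0 HP) (psi_proper HP) (psi_closed HP)
  (psi_strongly_convex HP)
  (xk k w - (mean (fun i => yk k i w) + eta A *: hb k w)) eta0 (psi_minorant HA)
  (xstar_first_order HA).1.
Qed.

Lemma br_ge0 x : 0 <= br x.
Proof. exact: bregman_ge0 Lf0 (favg_smooth HP) (favg_convex HA). Qed.

(** The negative gradient at [xstar] is a subgradient of [psi] there, so the linear term of the
    Bregman distance is covered by the increase of [psi]. *)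
Lemma br_le_gap k (w : Omega A) : br (xk k w) <= gap k w.
Proof.
have [_ H] := xstar_first_order HA.
have := H _ (dom_xk k w); rewrite /br /gap /bregman.
have : 0 <= sc_mu P / 2 * nsq (xk k w - xs).
  by rewrite mulr_ge0 ?nsq_ge0// divr_ge0// (mu_ge0 HP).
lra.
Qed.

Lemma gap_ge0 k w : 0 <= gap k w.
Proof. exact: le_trans (br_ge0 _) (br_le_gap k w). Qed.

Lemma br_measurable (dT : measure_display) (S : measurableType dT) (X : S -> Rv) :
  vmeas X -> measurable_fun setT (fun w => br (X w)).
Proof.
move=> mX; rewrite /br /bregman.
apply: measurable_funB.
  apply: measurable_funB => //.
  exact: (vmeas_comp_cont mX (smooth_continuous (favg_smooth HP))).
by apply: vmeas_dot; [exact: vmeas_cst|apply: vmeasB => //; exact: vmeas_cst].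
Qed.

Lemma br_L1 X : L2 (Pr A) X -> L1 (Pr A) (fun w => br (X w)).
Proof.
move=> LX.
apply: (@L1_le _ _ _ _ _ (fun w => smLf P / 2 * nsq (X w - xs))).
- exact: br_measurable LX.1.
- move=> w; rewrite ger0_norm ?br_ge0//.
  exact: bregman_le Lf0 (favg_smooth HP).
- by apply/L1Z/L1_nsq; apply: L2B => //; exact: L2_cst.
Qed.

Lemma gap_measurable k : measurable_fun setT (gap k).
Proof.
have mX : vmeas (xk (A := A) k) := adapted_vmeas F_meas (good_x k).1.
apply: measurable_funB => //; apply: measurable_funD.
  exact: (vmeas_comp_cont mX (smooth_continuous (favg_smooth HP))).
apply/measurable_EFinP.
have -> : (EFin \o (fun w => psr (xk k w))) = (fun w => psi P (xk k w)).
  by apply/funext => w /=; rewrite -psirE//; [exact: (psi_proper HP)|exact: dom_xk].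
exact: (measurableT_comp (lsc_measurable (psi_closed HP)) ((vmeas_borel _).1 mX)).
Qed.

Lemma bigM_lower : 4 * smLf P <= bigM A.
Proof.
have [/andP[dl0 dl1] _] := A_compressor HA.
have [/andP[d10 _] _] := A_compressor1 HA.
have /andP[p0 _] := A_p HA.
have L0 := L_ge0 HP; have Lb0 := Lbar_ge0 HP.
have d10' : 0 <= 1 - delta A by rewrite subr_ge0.
have n0' := n0; have Lf0' := Lf0.
rewrite /bigM addrAC lerDr.
by nonneg_tac.
Qed.

Lemma bigM_gt0 : 0 < bigM A.
Proof.
by apply: lt_le_trans bigM_lower; apply: mulr_gt0 (Lf_gt0 HP); rewrite ltr0n.
Qed.

Lemma eta_bigM : eta A * bigM A <= 1.
Proof. by rewrite -ler_pdivlMr ?bigM_gt0. Qed.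

Lemma eta_Lf : eta A * smLf P <= 1 / 4.
Proof.
have := le_trans (ler_wpM2l (ltW eta0) bigM_lower) eta_bigM.
by rewrite mulrCA; lra.
Qed.

Lemma mean_mk k (w : Omega A) : mean (fun i => mk k i w) = grad (favg P) (xk k w) - hb k w.
Proof. by rewrite (grad_favg HA) /hb /mean -scalerBr -sumrB. Qed.

Lemma mean_vk k (w : Omega A) : mean (fun i => vk k i w) = grad (favg P) (wk k w) - hb k w.
Proof. by rewrite (grad_favg HA) /hb /mean -scalerBr -sumrB. Qed.

Lemma mean_uk k (w : Omega A) : mean (fun i => uk k i w) =
  ebar k w + eta A *: (grad (favg P) (xk k w) - hb k w)
  + mean (fun i => eta A *: xik k i w).
Proof.
rewrite -mean_mk /ebar /mean scalerA mulrC -scalerA -!scalerDr; congr (_ *: _).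
rewrite scaler_sumr -!big_split; apply: eq_bigr => i _.
by rewrite /= /uk gkE scalerDr [LHS]addrC addrA.
Qed.

Lemma ebarS k (w : Omega A) : ebar k.+1 w = mean (fun i => uk k i w) - mean (fun i => yk k i w).
Proof.
rewrite /ebar /mean -scalerBr -sumrB; congr (_ *: _).
by apply: eq_bigr => i _; rewrite ekS.
Qed.

Lemma mean_eta_xik k (w : Omega A) :
  mean (fun i => eta A *: xik k i w) = eta A *: mean (fun i => xik k i w).
Proof. by rewrite /mean -scaler_sumr scalerA mulrC -scalerA. Qed.

Lemma gap_step k (w : Omega A) :
  2 * eta A * gap k.+1 w + (1 + sc_mu P * eta A / 2)
     * nsq (xk k.+1 w - ebar k.+1 w - xs) <=
  nsq (xk k w - ebar k w - xs) + (1 + sc_mu P * eta A) * nsq (ebar k.+1 w)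
  + 2 * (eta A * smLf P) * nsq (ebar k w)
  + 2 * eta A ^+ 2 * nsq (mean (fun i => xik k i w))
  - 2 * eta A * dot (xk k w - ebar k w - xs) (mean (fun i => xik k i w)).
Proof.
set V := xk k w - (mean (fun i => yk k i w) + eta A *: hb k w).
have [_ H] := prox_spec (mu_ge0 HP) (psi_proper HP) (psi_closed HP)
  (psi_strongly_convex HP) V eta0 (psi_minorant HA) (xstar_first_order HA).1.
have sub := H xs (xstar_first_order HA).1.
rewrite /V -xkS -/V in sub.
rewrite /gap; apply: (prox_step (mu_ge0 HP) Lf0 eta0 eta_Lf (favg_smooth HP)
  (favg_convex HA) sub).
rewrite ebarS mean_uk mean_eta_xik /V.
move: (mean _) (mean _) (ebar k w) (hb k w) (xk k w) (xk k.+1 w) (grad _ _).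
move=> a b c h x x' g.
by apply/rowP => j; rewrite !mxE; ring.
Qed.

Let LX k := L2B (L2B (good_x k).2 (good_ebar k).2) (L2_cst (Pr A) xs).
Let Lxi k (i : 'I_n) := (good_xik (iv k) i).2.
Let Lmxi k : L2 (Pr A) (fun w => mean (fun i => xik k i w)).
Proof. by apply: L2_mean => i; exact: Lxi. Qed.

(** The gap contains [psi] at a random point, which no growth condition bounds from above. The
    one-step inequality does: its right side is integrable, and the gap is nonnegative. *)
Lemma gap_L1 k : L1 (Pr A) (gap k).
Proof.
case: k => [|k].
  exact: (L1_cst (Pr A) (favg P (x_init A) + psr (x_init A) - (favg P xs + psr xs))).
pose rhs w := nsq (xk k w - ebar k w - xs) + (1 + sc_mu P * eta A) * nsq (ebar k.+1 w)
  + 2 * (eta A * smLf P) * nsq (ebar k w)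
  + 2 * eta A ^+ 2 * nsq (mean (fun i => xik k i w))
  - 2 * eta A * dot (xk k w - ebar k w - xs) (mean (fun i => xik k i w)).
have Lr : L1 (Pr A) rhs.
  apply: L1B; last by apply: L1Z; exact: L1_dot (LX k) (Lmxi k).
  apply: L1D; last by apply: L1Z; exact: L1_nsq (Lmxi k).
  apply: L1D; last by apply: L1Z; exact: L1_nsq (good_ebar k).2.
  apply: L1D; last by apply: L1Z; exact: L1_nsq (good_ebar k.+1).2.
  exact: L1_nsq (LX k).
apply: (L1_le (gap_measurable k.+1) _ (L1Z (2 * eta A)^-1 Lr)) => w.
rewrite ger0_norm ?gap_ge0// mulrC ler_pdivlMr ?mulr_gt0// mulrC.
have := gap_step k w; rewrite -/(rhs w) => /(le_trans _); apply.
rewrite lerDl mulr_ge0 ?nsq_ge0// addr_ge0// divr_ge0// mulr_ge0 ?(mu_ge0 HP)//.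
exact: ltW.
Qed.

(** This and the following definitions are the sequences to which [gap_sum_bound] is applied. *)
Definition gS k := E (gap k).
Definition dS k := E (fun w => br (xk k w)).
Definition dwS k := E (fun w => br (wk k w)).
Definition XS k := E (fun w => nsq (xk k w - ebar k w - xs)).
Definition NS k := E (fun w => nsq (ebar k w)).
Definition EbS k := n%:R^-1 * \sum_(i < n) E (fun w => nsq (ek k i w)).
Definition VS k := n%:R^-1 * \sum_(i < n) E (fun w => nsq (xik k i w)).
Definition AS k := E (fun w => nsq (grad (favg P) (xk k w) - hb k w)).
Definition BS k := n%:R^-1 * \sum_(i < n) E (fun w => nsq (mk k i w)).
Definition HS k := E (fun w => nsq (grad (favg P) (wk k w) - hb k w)).
Definition HbS k := n%:R^-1 * \sum_(i < n) E (fun w => nsq (vk k i w)).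



Lemma gS_ge0 k : 0 <= gS k.
Proof. by apply: Ex_ge0 => w; exact: gap_ge0. Qed.

Lemma dS_ge0 k : 0 <= dS k.
Proof. by apply: Ex_ge0 => w; exact: br_ge0. Qed.

Lemma dwS_ge0 k : 0 <= dwS k.
Proof. by apply: Ex_ge0 => w; exact: br_ge0. Qed.

Lemma dS_le k : dS k <= gS k.
Proof. by apply: Ex_le; [exact: br_L1 (good_x k).2|exact: gap_L1|exact: br_le_gap]. Qed.

Lemma dwS_rec k : dwS k.+1 <= (1 - prob_w A) * dwS k + prob_w A * dS k.
Proof.
have leT : (T k <= T k + 3 * n)%N by exact: leq_addr.
have [ax Lx] := good_mono leT (good_x k).
have [aw Lw] := good_mono leT (good_w k).
have [_] := Ex_coin inj F_setT (@evs_setI R A) F_meas (evs_indep HA)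
  (coin_source HA k) (coin_law (A_sampling HA) k)
  (br_measurable ax) (br_measurable aw) (br_L1 Lx) (br_L1 Lw).
rewrite /dwS (_ : (fun w => br (wk k.+1 w)) =
  (fun w => if coin (draws k w) then br (xk k w) else br (wk k w))).
  by move=> ->; rewrite addrC.
by apply/funext => w; rewrite wkS; case: ifP.
Qed.

End OneStepInequalities.

(** * Recurrences for the expected quantities *)

Section Recurrences.
Context (R : realType) (A : ec_lsvrg R).
Hypothesis HA : ec_lsvrg_assumptions A.

Notation d := (Defs.dim A).
Notation n := (nodes A).
Notation m := (samples A).
Notation P := (pb A).
Notation Rv := ('rV[R]_d).

Let HP : erm_assumptions P := A_problem HA.

Notation F := (@evs R A).
Notation src := (nsrc HA).
Notation adap t X := (adapted F src t X).
Notation E := (Ex (Pr A)).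
Notation T k := (round_start n k).
Notation xs := (xstar P).

Hypothesis dx0 : dom (psi P) (x_init A).
Hypothesis stepsize : eta A <= 1 / bigM A.

Let F_setT := @evs_setT R A.
Let F_setI := @evs_setI R A.
Let F_meas := evs_meas HA.
Let F_ind := evs_indep HA.
Let inj := @nsrc_inj R A HA.
Let Lf0 := ltW (Lf_gt0 HP).
Let n0 : 0 < n%:R :> R. Proof. by rewrite ltr0n (n_gt0 HP). Qed.
Let m0 : 0 < m%:R :> R. Proof. by rewrite ltr0n (m_gt0 HP). Qed.
Let iv := invariant_all HA.
Let dl01 : 0 < delta A <= 1 := (A_compressor HA).1.
Let d101 : 0 < delta1 A <= 1 := (A_compressor1 HA).1.
Let dl1 : 0 <= 1 - delta A. Proof. by rewrite subr_ge0; case/andP: dl01. Qed.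
Let d11 : 0 <= 1 - delta1 A. Proof. by rewrite subr_ge0; case/andP: d101. Qed.
Let dl0 : 0 < delta A. Proof. by case/andP: dl01. Qed.
Let d10 : 0 < delta1 A. Proof. by case/andP: d101. Qed.
Let p0 : 0 < prob_w A. Proof. by case/andP: (A_p HA). Qed.

Notation x k := (@xk R A k).
Notation wr k := (@wk R A k).
Notation e k := (@ek R A k).
Notation h k := (@hk R A k).
Notation hbar k := (@hb R A k).
Notation eb k := (@ebar R A k).
Notation xi k := (@xik R A k).
Notation mv k := (@mk R A k).
Notation vv k := (@vk R A k).
Notation uu k := (@uk R A k).
Notation yy k := (@yk R A k).
Notation zz k := (@zk R A k).
Notation brx := (br (A := A)).

Let gx k : good HA (T k) (x k) := good_x HA k.
Let gw k : good HA (T k) (wr k) := good_w HA k.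
Let ge k i : good HA (T k) (e k i) := good_e HA k i.
Let geb k : good HA (T k) (eb k) := good_ebar HA k.
Let gh k : good HA (T k) (hbar k) := good_h_mean HA k.
Let gxi k i : good HA (T k + n) (xi k i) := good_xik (iv k) i.
Let gm k i : good HA (T k) (mv k i) := good_mk (iv k) i.
Let gv k i : good HA (T k) (vv k i) := good_vk (iv k) i.
Let gu k i : good HA (T k + n) (uu k i) := good_uk (iv k) i.

Let gf k (X : Omega A -> Rv) (gX : good HA (T k) X) :
  good HA (T k) (fun w => grad (favg P) (X w)).
Proof. exact: good_grad Lf0 (favg_smooth HP) gX. Qed.

Let gfn k i (X : Omega A -> Rv) (gX : good HA (T k) X) :
  good HA (T k) (fun w => grad (fnode P i) (X w)).
Proof. exact: good_grad (Lbar_ge0 HP) (fnode_smooth HP i) gX. Qed.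

Let xi_centered k (i : 'I_n) : centered (Pr A) F src (T k + i) (xi k i).
Proof. by have [] := xik_centered (iv k) i. Qed.

Let xi_adapted k (i : 'I_n) : adap (T k + i).+1 (xi k i).
Proof. by have [] := xik_centered (iv k) i. Qed.

Lemma xi_mean_nsq k (Z : Omega A -> Rv) : good HA (T k) Z ->
  E (fun w => nsq (Z w + eta A *: mean (fun i => xi k i w))) =
  E (fun w => nsq (Z w)) + eta A ^+ 2 * (n%:R^-1 * VS A k).
Proof.
move=> [aZ LZ].
have cD (i : 'I_n) : centered (Pr A) F src (T k + i) (fun w => eta A *: xi k i w).
  exact: centeredZ (xi_centered k i).
have aD (i : 'I_n) : adap (T k + i).+1 (fun w => eta A *: xi k i w).
  exact: (vmeasZ (eta A) (@xi_adapted k i)).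
have := centered_nsq_mean F_setT cD aD aZ LZ.
under eq_fun do rewrite mean_eta_xik.
move=> ->; congr (_ + _); rewrite /VS.
have -> : \sum_(i < n) E (fun w => nsq (eta A *: xi k i w)) =
    eta A ^+ 2 * \sum_(i < n) E (fun w => nsq (xi k i w)).
  by rewrite mulr_sumr; apply: eq_bigr => i _; rewrite Ex_nsqZ//; exact: (gxi k i).2.
by ring.
Qed.

Lemma XS_rec k :
  2 * eta A * gS A k.+1 + (1 + sc_mu P * eta A / 2) * XS A k.+1 <=
  XS A k + (1 + sc_mu P * eta A) * NS A k.+1 + 2 * (eta A * smLf P) * NS A k
  + 2 * eta A ^+ 2 * (VS A k / n%:R).
Proof.
have LX j : L2 (Pr A) (fun w => x j w - eb j w - xs).
  by apply: L2B; [exact: L2B (gx j).2 (geb j).2|exact: L2_cst].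
have Lxi : L2 (Pr A) (fun w => mean (fun i => xi k i w)).
  by apply: L2_mean => i; exact: (gxi k i).2.
(* The Pythagorean identity with the zero vector in place of [Z]. *)
have EV : E (fun w => nsq (mean (fun i => xi k i w))) = n%:R^-1 * VS A k.
  have := centered_nsq_mean F_setT (xi_centered k) (@xi_adapted k)
    (good_cst HA (T k) 0).1 (good_cst HA (T k) 0).2.
  under eq_fun do rewrite add0r.
  by rewrite nsq0 Ex_cst add0r.
have E0 : E (fun w => dot (x k w - eb k w - xs) (mean (fun i => xi k i w))) = 0.
  apply: (centered_dot_mean F_setT (xi_centered k)); last exact: LX.
  by have [] := goodB (goodB (gx k) (geb k)) (good_cst HA (T k) xs).
have L1X j := L1_nsq (LX j).
have L1e j := L1_nsq (geb j).2.
have L1xi := L1_nsq Lxi.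
have L1d := L1_dot (LX k) Lxi.
have := Ex_le (L1D (L1Z (2 * eta A) (gap_L1 HA dx0 stepsize k.+1))
    (L1Z (1 + sc_mu P * eta A / 2) (L1X k.+1)))
  (L1B (L1D (L1D (L1D (L1X k) (L1Z (1 + sc_mu P * eta A) (L1e k.+1)))
     (L1Z (2 * (eta A * smLf P)) (L1e k))) (L1Z (2 * eta A ^+ 2) L1xi))
     (L1Z (2 * eta A) L1d)) (gap_step HA stepsize k).
rewrite ExB; [|by do ?apply: L1D => //; exact: L1Z|exact: L1Z].
rewrite !ExD; do ?[exact: L1Z | exact: L1X | exact: L1D | by apply: L1D => //; exact: L1Z
  | by apply: L1D; [by apply: L1D => //; exact: L1Z|exact: L1Z]].
  rewrite !ExZ// ?E0 ?EV ?mulr0 ?subr0.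
    by rewrite [VS A k / _]mulrC.
  exact: gap_L1.
exact: L1Z (gap_L1 HA dx0 stepsize k.+1).
Qed.

Lemma uu_nsq k i : E (fun w => nsq (uu k i w)) =
  E (fun w => nsq (e k i w + eta A *: mv k i w)) + eta A ^+ 2 * E (fun w => nsq (xi k i w)).
Proof.
have gZ := goodD (ge k i) (goodZ (eta A) (gm k i)).
have [aZ LZ] := good_mono (leq_addr i (T k)) gZ.
have := centered_nsqD (centeredZ (eta A) (xi_centered k i)) aZ LZ.
rewrite Ex_nsqZ; last exact: (gxi k i).2.
move=> <-; congr E; apply/funext => w; congr nsq.
by rewrite /uk gkE scalerDr [LHS]addrC addrA.
Qed.

Lemma uu_avg_nsq k : n%:R^-1 * \sum_(i < n) E (fun w => nsq (uu k i w)) <=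
  2 * EbS A k + 2 * eta A ^+ 2 * BS A k + eta A ^+ 2 * VS A k.
Proof.
rewrite /EbS /BS /VS.
rewrite [leRHS](_ : _ = n%:R^-1 * \sum_(i < n) (2 * E (fun w => nsq (e k i w))
  + 2 * eta A ^+ 2 * E (fun w => nsq (mv k i w))
  + eta A ^+ 2 * E (fun w => nsq (xi k i w)))); last first.
  by rewrite !big_split/= -!mulr_sumr; ring.
rewrite ler_wpM2l ?invr_ge0// ?(ltW n0)//; apply: ler_sum => i _.
rewrite uu_nsq lerD2r.
have := Ex_nsqD_le ltr01 (ge k i).2 (L2Z (eta A) (gm k i).2).
by rewrite Ex_nsqZ ?invr1; [rewrite mulrA|exact: (gm k i).2].
Qed.

(** Three splittings: the centred compression noise yields the [1/n] term with the node inputs, the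
    sampling noise yields the variance over [n], and Young's inequality separates the old error from
    the gradient term. *)
Lemma NS_rec k : NS A k.+1 <= (1 - delta A) * NS A k +
  ((1 - delta A) / delta A * eta A ^+ 2 * AS A k
   + (1 - delta A) * eta A ^+ 2 * (VS A k / n%:R)
   + delta A * (1 - delta A) / n%:R * (2 * (EbS A k + eta A ^+ 2 * BS A k))).
Proof.
have H1 := compress_mean inj F_setT F_setI F_meas F_ind (A_compressor HA) (A_mean HA)
  (Q_source HA k) (Q_law HA k) (fun i => (gu k i).1) (fun i => (gu k i).2).
have E1 : (fun w => mean (fun i => uu k i w - rmap (seedQ (draws k w) i) (uu k i w))) =
    eb k.+1.
  by apply/funext => w; rewrite ebarS /mean -scalerBr -sumrB.
rewrite (_ : E _ = NS A k.+1) in H1; last by rewrite /NS -E1.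
have gZ : good HA (T k)
    (fun w => eb k w + eta A *: (grad (favg P) (x k w) - hbar k w)).
  by apply: goodD => //; apply: goodZ; apply: goodB (gh k); exact: gf (gx k).
have E2 : E (fun w => nsq (mean (fun i => uu k i w))) =
   E (fun w => nsq (eb k w + eta A *: (grad (favg P) (x k w) - hbar k w)))
   + eta A ^+ 2 * (n%:R^-1 * VS A k).
  rewrite -xi_mean_nsq//; congr E; apply/funext => w; congr nsq.
  by rewrite (mean_uk HA) mean_eta_xik.
have LA : L2 (Pr A) (fun w => grad (favg P) (x k w) - hbar k w).
  by apply: L2B (gh k).2; exact: (gf (gx k)).2.
(* One of the two factors [1 - delta] is spent in [contract_young1]; the other multiplies the
   result, is kept on the old error and is bounded by 1 on the gradient term. *)
have H2 : (1 - delta A) ^+ 2 *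
    E (fun w => nsq (eb k w + eta A *: (grad (favg P) (x k w) - hbar k w))) <=
    (1 - delta A) * NS A k + (1 - delta A) / delta A * eta A ^+ 2 * AS A k.
  rewrite expr2 -mulrA -ExZ; last exact: L1_nsq gZ.2.
  have Y : E (fun w => (1 - delta A) *
     nsq (eb k w + eta A *: (grad (favg P) (x k w) - hbar k w))) <=
     NS A k + (1 - delta A) / delta A * (eta A ^+ 2 * AS A k).
    rewrite /NS /AS -[X in _ * (X)]Ex_nsqZ// -ExZ; last exact/L1_nsq/L2Z.
    rewrite -ExD; [|exact: L1_nsq (geb k).2|exact/L1Z/L1_nsq/L2Z].
    apply: Ex_le => [||w]; last exact: contract_young1.
    - exact: L1Z (L1_nsq gZ.2).
    - by apply: L1D; [exact: L1_nsq (geb k).2|exact/L1Z/L1_nsq/L2Z].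
  apply: le_trans (ler_wpM2l dl1 Y) _.
  rewrite mulrDr lerD2l [leRHS](_ : _ =
     1 * ((1 - delta A) / delta A * (eta A ^+ 2 * AS A k))); last by ring.
  rewrite ler_wpM2r//; last by rewrite gerBl (ltW dl0).
  rewrite mulr_ge0 ?divr_ge0 ?(ltW dl0)// mulr_ge0 ?sqr_ge0//.
  by apply: Ex_ge0 => w; exact: nsq_ge0.
have c0 : 0 <= delta A * (1 - delta A) / n%:R.
  by rewrite divr_ge0 ?mulr_ge0 ?(ltW dl0) ?(ltW n0).
have H3 := ler_wpM2l c0 (uu_avg_nsq k).
apply: (le_trans H1); rewrite E2.
by move: H2 H3; lra.
Qed.

Lemma EbS_rec k : EbS A k.+1 <= (1 - delta A / 2) * EbS A k +
  (2 * ((1 - delta A) / delta A) * eta A ^+ 2 * BS A k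
   + (1 - delta A) * eta A ^+ 2 * VS A k).
Proof.
rewrite /EbS /BS /VS.
rewrite [leRHS](_ : _ = n%:R^-1 * \sum_(i < n) (
  (1 - delta A / 2) * E (fun w => nsq (e k i w))
  + 2 * ((1 - delta A) / delta A) * eta A ^+ 2 * E (fun w => nsq (mv k i w))
  + (1 - delta A) * eta A ^+ 2 * E (fun w => nsq (xi k i w)))); last first.
  by rewrite !big_split/= -!mulr_sumr; ring.
rewrite ler_wpM2l ?invr_ge0// ?(ltW n0)//; apply: ler_sum => i _.
have [_ H] := yk_error (iv k) i.
have -> : (fun w => nsq (e k.+1 i w)) = (fun w => nsq (uu k i w - yy k i w)).
  by apply/funext => w; rewrite ekS.
apply: (le_trans H); rewrite uu_nsq mulrDr [(1 - delta A) * (eta A ^+ 2 * _)]mulrA lerD2r.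
have gZ := goodD (ge k i) (goodZ (eta A) (gm k i)).
have L1e := L1_nsq (ge k i).2.
have L1m := L1_nsq (L2Z (eta A) (gm k i).2).
rewrite -ExZ; last exact: L1_nsq gZ.2.
rewrite -[_ * _ * E _]mulrA -[X in _ + _ * X]Ex_nsqZ; last exact: (gm k i).2.
rewrite -!ExZ// -ExD; [|exact: L1Z|exact: L1Z].
apply: Ex_le => [||w]; last exact: contract_young2.
- exact: L1Z (L1_nsq gZ.2).
- by apply: L1D; exact: L1Z.
Qed.

Lemma favg_diff (a b : Rv) :
  nsq (grad (favg P) a - grad (favg P) b) <= 4 * smLf P * (brx a + brx b).
Proof. exact: smooth_diff Lf0 (favg_smooth HP) (favg_convex HA). Qed.

Lemma fnode_diff (a b : Rv) :
  n%:R^-1 * \sum_(i < n) nsq (grad (fnode P i) a - grad (fnode P i) b) <=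
  4 * smLbar P * (brx a + brx b).
Proof.
rewrite /br !(bregman_favg HA) [leRHS](_ : _ = n%:R^-1 * \sum_(i < n)
  (4 * smLbar P * (bregman (fnode P i) a xs + bregman (fnode P i) b xs))); last first.
  by rewrite -mulr_sumr [in RHS]big_split/=; ring.
rewrite ler_wpM2l ?invr_ge0 ?(ltW n0)//; apply: ler_sum => i _.
exact: smooth_diff (Lbar_ge0 HP) (fnode_smooth HP i) (fnode_convex HA i).
Qed.

Lemma loss_diff (a b : Rv) :
  n%:R^-1 * \sum_(i < n) (m%:R^-1 * \sum_(j < m)
    nsq (grad (loss P i j) a - grad (loss P i j) b)) <=
  4 * smL P * (brx a + brx b).
Proof.
rewrite /br !(bregman_favg HA) [leRHS](_ : _ = n%:R^-1 * \sum_(i < n)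
  (4 * smL P * (bregman (fnode P i) a xs + bregman (fnode P i) b xs))); last first.
  by rewrite -mulr_sumr [in RHS]big_split/=; ring.
rewrite ler_wpM2l ?invr_ge0 ?(ltW n0)//; apply: ler_sum => i _.
rewrite !(bregman_fnode HA) [leRHS](_ : _ = m%:R^-1 * \sum_(j < m)
  (4 * smL P * (bregman (loss P i j) a xs + bregman (loss P i j) b xs))); last first.
  by rewrite -mulr_sumr [in RHS]big_split/=; ring.
rewrite ler_wpM2l ?invr_ge0 ?(ltW m0)//; apply: ler_sum => j _.
exact: smooth_diff (L_ge0 HP) (loss_smooth HP i j) (loss_convex HP i j).
Qed.

Let sS k := dS A k + dwS A k.

Let Lbr k : L1 (Pr A) (fun w => brx (x k w) + brx (wr k w)).
Proof. by apply: L1D; [exact: (br_L1 HA (gx k).2)|exact: (br_L1 HA (gw k).2)]. Qed.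

Let Ebr c k : E (fun w => c * (brx (x k w) + brx (wr k w))) = c * sS k.
Proof.
by rewrite ExZ// ExD//; [exact: (br_L1 HA (gx k).2)|exact: (br_L1 HA (gw k).2)].
Qed.

Lemma favg_diff_E k :
  E (fun w => nsq (grad (favg P) (x k w) - grad (favg P) (wr k w))) <=
  4 * smLf P * sS k.
Proof.
rewrite -Ebr; apply: Ex_le; last by move=> w; exact: favg_diff.
- exact/L1_nsq/(L2B (gf (gx k)).2 (gf (gw k)).2).
- exact: L1Z.
Qed.

Lemma fnode_diff_E k :
  n%:R^-1 * \sum_(i < n)
    E (fun w => nsq (grad (fnode P i) (x k w) - grad (fnode P i) (wr k w))) <=
  4 * smLbar P * sS k.
Proof.
have L i : L1 (Pr A) (fun w => nsq (grad (fnode P i) (x k w) - grad (fnode P i) (wr k w))).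
  exact/L1_nsq/(L2B (gfn i (gx k)).2 (gfn i (gw k)).2).
rewrite -Ebr -Ex_sum// -ExZ; last exact: L1_sum.
apply: Ex_le; last by move=> w; exact: fnode_diff.
- by apply: L1Z; exact: L1_sum.
- exact: L1Z.
Qed.

(** A uniform variance is at most the second moment, and for each loss the gradient difference is
    bounded by smoothness of that loss. The Bregman distances of the losses then average to that of
    the full objective's smooth part. *)
Lemma VS_le k : VS A k <= 4 * smL P * sS k.
Proof.
have gl i j (X : Omega A -> Rv) (gX : good HA (T k) X) :
    good HA (T k) (fun w => grad (loss P i j) (X w)).
  exact: good_grad (L_ge0 HP) (loss_smooth HP i j) gX.
have L i j : L1 (Pr A) (fun w => nsq (grad (loss P i j) (x k w) - grad (loss P i j) (wr k w))).
  exact/L1_nsq/(L2B (gl i j _ (gx k)).2 (gl i j _ (gw k)).2).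
apply: (@le_trans _ _ (n%:R^-1 * \sum_(i < n) (m%:R^-1 * \sum_(j < m)
    E (fun w => nsq (grad (loss P i j) (x k w) - grad (loss P i j) (wr k w)))))).
  rewrite /VS ler_wpM2l ?invr_ge0 ?(ltW n0)//; apply: ler_sum => i _.
  have [_ _ ->] := xik_centered (iv k) i.
  rewrite ler_wpM2l ?invr_ge0 ?(ltW m0)//.
  have La j : L1 (Pr A) (fun w => nsq (@ak R A k i j w)).
    exact: L1_nsq (good_ak (iv k) i j).2.
  rewrite -!Ex_sum//; apply: Ex_le => [||w]; [exact: L1_sum|exact: L1_sum|].
  have := nsq_center_le (fun j => grad (loss P i j) (x k w) - grad (loss P i j) (wr k w)).
  apply: le_trans; rewrite le_eqVlt; apply/orP; left; apply/eqP.
  apply: eq_bigr => j _; congr nsq; rewrite /ak !(grad_fnode HA); congr (_ - _).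
  by rewrite /mean -scalerBr -sumrB.
have L2' i : L1 (Pr A) (fun w => m%:R^-1 * \sum_(j < m)
    nsq (grad (loss P i j) (x k w) - grad (loss P i j) (wr k w))).
  by apply: L1Z; exact: L1_sum.
rewrite (eq_bigr (fun i => E (fun w => m%:R^-1 * \sum_(j < m)
    nsq (grad (loss P i j) (x k w) - grad (loss P i j) (wr k w))))); last first.
  by move=> i _; rewrite ExZ ?Ex_sum//; exact: L1_sum.
rewrite -Ex_sum// -ExZ; last exact: L1_sum.
rewrite -Ebr; apply: Ex_le; last by move=> w; exact: loss_diff.
- by apply: L1Z; exact: L1_sum.
- exact: L1Z.
Qed.

Lemma AS_le k : AS A k <= 8 * smLf P * sS k + 2 * HS A k.
Proof.
have H := Ex_nsqD_le ltr01 (L2B (gf (gx k)).2 (gf (gw k)).2) (L2B (gf (gw k)).2 (gh k).2).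
rewrite invr1 in H.
rewrite /AS (_ : (fun w => nsq (grad (favg P) (x k w) - hbar k w)) = (fun w =>
  nsq (grad (favg P) (x k w) - grad (favg P) (wr k w)
       + (grad (favg P) (wr k w) - hbar k w)))); last first.
  by apply/funext => w; rewrite addrA subrK.
apply: (le_trans H); rewrite -/(HS A k); have := favg_diff_E k.
by move: (HS A k) (sS k) (E _) => a s b; lra.
Qed.

Lemma BS_le k : BS A k <= 8 * smLbar P * sS k + 2 * HbS A k.
Proof.
have H : BS A k <= 2 * (n%:R^-1 * \sum_(i < n)
    E (fun w => nsq (grad (fnode P i) (x k w) - grad (fnode P i) (wr k w))))
    + 2 * HbS A k.
  rewrite /BS /HbS [leRHS](_ : _ = n%:R^-1 * \sum_(i < n)
    (2 * E (fun w => nsq (grad (fnode P i) (x k w) - grad (fnode P i) (wr k w)))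
     + 2 * E (fun w => nsq (vv k i w)))); last by rewrite big_split/= -!mulr_sumr; ring.
  rewrite ler_wpM2l ?invr_ge0 ?(ltW n0)//; apply: ler_sum => i _.
  have H := Ex_nsqD_le ltr01 (L2B (gfn i (gx k)).2 (gfn i (gw k)).2) (gv k i).2.
  rewrite invr1 in H.
  rewrite (_ : (fun w => nsq (mv k i w)) = (fun w =>
    nsq (grad (fnode P i) (x k w) - grad (fnode P i) (wr k w) + vv k i w))) //.
  by apply/funext => w; rewrite /mk /vk addrA subrK.
apply: (le_trans H); have := fnode_diff_E k.
by move: (HbS A k) (sS k) (_^-1 * _) => a s b; lra.
Qed.

Let q := prob_w A * (1 + 2 * prob_w A / delta1 A).

(* Splitting with the weight [delta1 / (2 p)] makes the refresh of [w] cost only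
   half of the contraction gained by the compressor. *)
Lemma refresh_bound k (f : Rv -> R) (L : R) (g : Omega A -> Rv) :
  0 <= L -> smooth L f -> good HA (T k + 3 * n) g ->
  E (fun w => nsq (grad f (wr k.+1 w) - g w)) <=
  (1 + delta1 A / 2) * E (fun w => nsq (grad f (wr k w) - g w))
  + q * E (fun w => nsq (grad f (x k w) - grad f (wr k w))).
Proof.
move=> L0 Lf gg.
have le3 : (T k <= T k + 3 * n)%N by exact: leq_addr.
have gX := good_grad L0 Lf (good_mono le3 (gx k)).
have gW := good_grad L0 Lf (good_mono le3 (gw k)).
have [a1 L1'] := goodB gX gg; have [a0 L0'] := goodB gW gg.
have [_ EC] := Ex_coin inj F_setT F_setI F_meas F_ind (coin_source HA k)
  (coin_law (A_sampling HA) k) (vmeas_nsq a1) (vmeas_nsq a0) (L1_nsq L1') (L1_nsq L0').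
rewrite (_ : (fun w => nsq (grad f (wr k.+1 w) - g w)) = (fun w =>
  if coin (draws k w) then nsq (grad f (x k w) - g w)
  else nsq (grad f (wr k w) - g w))); last first.
  by apply/funext => w; rewrite wkS; case: ifP.
rewrite EC.
have c0 : 0 < delta1 A / (2 * prob_w A) by rewrite divr_gt0 ?mulr_gt0.
have H := Ex_nsqD_le c0 L0' (goodB gX gW).2.
rewrite (_ : (fun w => nsq (grad f (wr k w) - g w + (grad f (x k w) - grad f (wr k w)))) =
   (fun w => nsq (grad f (x k w) - g w))) in H; last first.
  by apply/funext => w; rewrite addrC addrA subrK.
have := ler_wpM2l (ltW p0) H.
set a := E _; set b := E _; set c := E _ => H'; clearbody a b c.
have -> : (1 + delta1 A / 2) * b + q * c =
  prob_w A * ((1 + delta1 A / (2 * prob_w A)) * b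
   + (1 + (delta1 A / (2 * prob_w A))^-1) * c) + (1 - prob_w A) * b.
  by rewrite /q; field; rewrite !gt_eqF.
by rewrite lerD2r.
Qed.

Let contract1 : (1 + delta1 A / 2) * (1 - delta1 A) <= 1 - delta1 A / 2.
Proof. by have := sqr_ge0 (delta1 A); rewrite expr2; lra. Qed.

(** The averaged residual after compression has the factor [(1 - delta1) ^+ 2]. Against the factor
    [1 + delta1 / 2] of the refresh, one [1 - delta1] already gives the rate [delta1 / 2]; the term
    with the node residuals is absorbed in the same way. *)
Lemma HS_rec k : HS A k.+1 <= (1 - delta1 A / 2) * HS A k +
  (delta1 A / n%:R * HbS A k + 4 * q * smLf P * sS k).
Proof.
have gh' : good HA (T k + 3 * n) (hbar k.+1).
  by apply: good_mean => i; exact: good_hS (iv k) i.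
have H1 := refresh_bound Lf0 (favg_smooth HP) gh'.
have le2 : (T k <= T k + 2 * n)%N by exact: leq_addr.
have gv' i := good_mono le2 (gv k i).
have H2 := compress_mean inj F_setT F_setI F_meas F_ind (A_compressor1 HA) (A_mean1 HA)
  (Q1_source HA k) (Q1_law HA k) (fun i => (gv' i).1) (fun i => (gv' i).2).
have E1 w : mean (fun i => vv k i w - rmap (seedQ1 (draws k w) i) (vv k i w)) =
    grad (favg P) (wr k w) - hbar k.+1 w.
  rewrite /hb /mean (grad_favg HA) -scalerBr -sumrB.
  by congr (_ *: _); apply: eq_bigr => i _; rewrite hkS opprD addrA.
rewrite (_ : E _ = E (fun w => nsq (grad (favg P) (wr k w) - hbar k.+1 w))) in H2;
  last by congr E; apply/funext => w; rewrite E1.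
have E2 : E (fun w => nsq (mean (fun i => vv k i w))) = HS A k.
  by congr E; apply/funext => w; rewrite (mean_vk HA).
rewrite E2 -/(HbS A k) in H2.
have c0 : 0 <= 1 + delta1 A / 2 by rewrite addr_ge0// divr_ge0// ltW.
have H3 := ler_wpM2l c0 H2.
have q0 : 0 <= q by rewrite mulr_ge0 ?(ltW p0)// addr_ge0// divr_ge0 ?mulr_ge0 ?(ltW p0) ?(ltW d10).
have H4 := ler_wpM2l q0 (favg_diff_E k).
have HS0 : 0 <= HS A k by apply: Ex_ge0 => w; exact: nsq_ge0.
have Hb0 : 0 <= n%:R^-1 * HbS A k.
  rewrite mulr_ge0 ?invr_ge0 ?(ltW n0)// mulr_ge0 ?invr_ge0 ?(ltW n0)// sumr_ge0// => i _.
  by apply: Ex_ge0 => w; exact: nsq_ge0.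
have H5 : (1 + delta1 A / 2) * ((1 - delta1 A) ^+ 2 * HS A k) <=
    (1 - delta1 A / 2) * HS A k.
  rewrite mulrA ler_wpM2r// expr2 mulrA; apply: le_trans contract1.
  by rewrite ler_piMr ?mulr_ge0 ?gerBl ?(ltW d10).
have H6 : (1 + delta1 A / 2) * (delta1 A * (1 - delta1 A) / n%:R * HbS A k) <=
    delta1 A / n%:R * HbS A k.
  have -> : (1 + delta1 A / 2) * (delta1 A * (1 - delta1 A) / n%:R * HbS A k) =
     (1 + delta1 A / 2) * (1 - delta1 A) * (delta1 A * (n%:R^-1 * HbS A k)) by ring.
  have D0 := mulr_ge0 (ltW d10) Hb0; rewrite -[leRHS]mulrA ler_piMl//.
  by apply: (le_trans contract1); rewrite gerBl divr_ge0 ?(ltW d10).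
apply: (le_trans H1); apply: (le_trans (lerD H3 H4)).
clear H1 H2 H3 H4 HS0 Hb0 E2; move: H5 H6; move: (HS A k) (HbS A k) (sS k) => a b s; rewrite mulrDr; lra.
Qed.

Lemma HbS_rec k : HbS A k.+1 <= (1 - delta1 A / 2) * HbS A k + 4 * q * smLbar P * sS k.
Proof.
have q0 : 0 <= q by rewrite mulr_ge0 ?(ltW p0)// addr_ge0// divr_ge0 ?mulr_ge0 ?(ltW p0) ?(ltW d10).
have H : HbS A k.+1 <= (1 - delta1 A / 2) * HbS A k + q * (n%:R^-1 * \sum_(i < n)
    E (fun w => nsq (grad (fnode P i) (x k w) - grad (fnode P i) (wr k w)))).
  rewrite /HbS [leRHS](_ : _ = n%:R^-1 * \sum_(i < n)
    ((1 - delta1 A / 2) * E (fun w => nsq (vv k i w)) + q *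
     E (fun w => nsq (grad (fnode P i) (x k w) - grad (fnode P i) (wr k w))))); last first.
    by rewrite big_split/= -!mulr_sumr; ring.
  rewrite ler_wpM2l ?invr_ge0 ?(ltW n0)//; apply: ler_sum => i _.
  have H1 := refresh_bound (Lbar_ge0 HP) (fnode_smooth HP i) (good_hS (iv k) i).
  have [_ H2] := zk_error (iv k) i.
  have E1 : (fun w => nsq (vv k i w - zz k i w)) =
      (fun w => nsq (grad (fnode P i) (wr k w) - h k.+1 i w)).
    by apply/funext => w; rewrite hkS opprD addrA.
  rewrite E1 in H2; apply: (le_trans H1); rewrite lerD2r.
  have c0 : 0 <= 1 + delta1 A / 2 by rewrite addr_ge0// divr_ge0// ltW.
  apply: (le_trans (ler_wpM2l c0 H2)); rewrite mulrA ler_wpM2r ?contract1//.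
  by apply: Ex_ge0 => w; exact: nsq_ge0.
apply: (le_trans H); have := ler_wpM2l q0 (fnode_diff_E k).
by move: (HbS A k) (sS k) (_^-1 * _) => a s b; lra.
Qed.

End Recurrences.

(** * Convergence rates *)

Section ExpectedGap.
Context (R : realType) (A : ec_lsvrg R).
Hypothesis HA : ec_lsvrg_assumptions A.

Notation n := (nodes A).
Notation P := (pb A).
Notation Rv := ('rV[R]_(Defs.dim A)).
Notation E := (Ex (Pr A)).
Notation xs := (xstar P).
Notation psr := (psir (psi P)).

Let HP : erm_assumptions P := A_problem HA.
Let dl01 : 0 < delta A <= 1 := (A_compressor HA).1.
Let d101 : 0 < delta1 A <= 1 := (A_compressor1 HA).1.
Let eta0 := A_eta HA.
Let p01 := A_p HA.
Let n_ge1 : 1 <= n%:R :> R. Proof. by rewrite ler1n (n_gt0 HP). Qed.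

Lemma rho_ge0 : 0 <= rho A.
Proof.
have [/andP[a0 _] /andP[b0 _]] := (dl01, d101); have /andP[c0 _] := p01.
by rewrite /rho !le_min !divr_ge0 ?(ltW a0) ?(ltW b0) ?(ltW c0)// mulr_ge0 ?(mu_ge0 HP) ?(ltW eta0).
Qed.

Lemma rho_le_mu : rho A <= sc_mu P * eta A / 3.
Proof. by rewrite /rho ge_min lexx. Qed.

Lemma rho_le_delta : rho A <= delta A / 4.
Proof. by rewrite /rho !ge_min lexx orbT. Qed.

Lemma rho_le_delta1 : rho A <= delta1 A / 4.
Proof. by rewrite /rho !ge_min lexx !orbT. Qed.

Lemma rho_le_p : rho A <= prob_w A / 4.
Proof. by rewrite /rho !ge_min lexx !orbT. Qed.

Lemma rho_lt1 : rho A < 1.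
Proof. have := rho_le_p; have /andP[_ p1] := p01; lra. Qed.

Section finite_start.
Hypothesis dx0 : dom (psi P) (x_init A).
Hypothesis stepsize : eta A <= 1 / bigM A.

Definition gap0 : R := favg P (x_init A) + psr (x_init A) - (favg P xs + psr xs).

(** At the start the errors vanish and [w] equals [x], so the initial values reduce to the gap, the
    distance and the shifts of the starting point. *)
Lemma weighted_gap_bound K : wsum (rho A) (gS A) K.+1 <=
  2 / prob_w A * gap0 + 9 / (8 * eta A) * init_dist A
  + 6 / (5 * smLf P * prob_w A) * (n%:R^-1 * init_shift A).
Proof.
have n0 : 0 <= n%:R^-1 :> R by rewrite invr_ge0.
have ann (a : 'I_n -> R) : (forall i, 0 <= a i) -> 0 <= n%:R^-1 * \sum_(i < n) a i.
  by move=> a0; rewrite mulr_ge0// sumr_ge0.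
have Enn (X : Omega A -> Rv) : 0 <= E (fun w => nsq (X w)).
  by apply: Ex_ge0 => w; exact: nsq_ge0.
have mean0 : mean (fun _ : 'I_n => 0 : Rv) = 0.
  by rewrite /mean big1// scaler0.
have E0 : gS A 0 = gap0 by rewrite /gS -[RHS](Ex_cst (Pr A)).
have X0 : XS A 0 = init_dist A.
  rewrite /init_dist enorm_sq -[RHS](Ex_cst (Pr A)); congr E; apply/funext => w.
  by congr nsq; rewrite /ebar /ek /= mean0 subr0.
have Hb0 : HbS A 0 = n%:R^-1 * init_shift A.
  congr (_ * _); apply: eq_bigr => i _; rewrite enorm_sq.
  by rewrite -[RHS](Ex_cst (Pr A)).
rewrite -E0 -X0 -Hb0.
apply: (gap_sum_bound eta0 (Lf_gt0 HP) (Lbar_ge0 HP) (L_ge0 HP) (mu_ge0 HP)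
  (mu_le_Lf HP) dl01 d101 p01 n_ge1 rho_ge0 rho_le_mu rho_le_delta rho_le_delta1
  rho_le_p (eta_bigM HA stepsize) _ _ _ _ _ (dS_le HA dx0 stepsize) (VS_le HA)
  (AS_le HA) (BS_le HA) (XS_rec HA dx0 stepsize) (NS_rec HA) (EbS_rec HA) (HS_rec HA)
  (HbS_rec HA) (dwS_rec HA)).
- move=> k; do 2?split; try exact: Enn; try (by apply: ann => i; exact: Enn).
  + exact: gS_ge0.
  + exact: dS_ge0.
  + exact: dwS_ge0.
  + by split; [exact: Enn|apply: ann => i; exact: Enn].
- rewrite /NS -[RHS](Ex_cst (Pr A)); congr E; apply/funext => w.
  by rewrite /ebar /ek /= mean0 nsq0.
- rewrite /EbS big1 ?mulr0// => i _; rewrite -[RHS](Ex_cst (Pr A)); congr E.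
  by apply/funext => w; rewrite /ek /= nsq0.
- rewrite Hb0 /HS.
  have -> : (fun w => nsq (grad (favg P) (wk 0 w) - hb 0 w)) =
     (fun _ : Omega A => nsq (mean (fun i => grad (fnode P i) (x_init A) - @h_init R A i))).
    apply/funext => w; congr nsq.
    by rewrite /wk /hb /hk /= (grad_favg HA) /mean -scalerBr -sumrB.
  rewrite Ex_cst; apply: (le_trans (nsq_mean_le _)).
  by rewrite ler_wpM2l//; apply: ler_sum => i _; rewrite enorm_sq.
- rewrite E0 /dwS -[leRHS](Ex_cst (Pr A)).
  apply: Ex_le; [exact: (L1_cst (Pr A) (br (x_init A)))|exact: L1_cst|move=> w].
  exact: (@br_le_gap R A HA dx0 0 w).
Qed.

End finite_start.

Lemma objective_dom x : dom (psi P) x -> objective P x = (favg P x + psr x)%:E.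
Proof. by move=> dx; rewrite /objective (psirE (psi_proper HP) dx) EFinD. Qed.

Lemma dom_xs : dom (psi P) xs. Proof. exact: (xstar_first_order HA).1. Qed.

(** Induction on the number of points: the new average lies on the segment from the old one to the
    new point, at parameter [t = c k.+1 / (S + c k.+1)]. Finiteness of [psi] at the average is
    carried along. *)
Lemma jensen (c : nat -> R) (y : nat -> Rv) k :
  (forall i, 0 < c i) -> (forall i, dom (psi P) (y i)) ->
  let S := \sum_(i < k.+1) c i in
  let z := S^-1 *: \sum_(i < k.+1) c i *: y i in
  dom (psi P) z /\
  favg P z + psr z <= S^-1 * \sum_(i < k.+1) c i * (favg P (y i) + psr (y i)).
Proof.
move=> c0 dy; elim: k => [|k] /=.
  rewrite !big_ord_recl !big_ord0 !addr0 scalerA mulrA.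
  by rewrite mulVf ?gt_eqF// scale1r mul1r.
set S := \sum_(i < k.+1) c i; set Y := \sum_(i < k.+1) c i *: y i.
set z := S^-1 *: Y => -[dz Hz].
rewrite !(big_ord_recr k.+1)/= -/S -/Y.
have S0 : 0 < S.
  by rewrite /S big_ord_recl ltr_pwDl// sumr_ge0// => i _; exact: ltW.
have S1 : 0 < S + c k.+1 by rewrite addr_gt0.
pose t := c k.+1 / (S + c k.+1).
have t01 : 0 <= t <= 1.
  by rewrite divr_ge0 ?(ltW (c0 _)) ?(ltW S1)//= ler_pdivrMr// mul1r lerDr ltW.
have zE : (S + c k.+1)^-1 *: (Y + c k.+1 *: y k.+1) = t *: y k.+1 + (1 - t) *: z.
  rewrite scalerDr scalerA addrC mulrC -/t; congr (_ + _).
  rewrite /z scalerA; congr (_ *: _); rewrite /t; field.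
  by rewrite !gt_eqF.
rewrite zE.
have [d1 H1] := psir_strongly_convex (psi_proper HP) (psi_strongly_convex HP)
  dz (dy k.+1) t01.
split=> //.
have H2 := convex_funE (y k.+1) z (favg_convex HA) t01.
have N0 : 0 <= sc_mu P / 2 * (t * (1 - t)) * nsq (y k.+1 - z).
  case/andP: t01 => t0 t1.
  have t1' : 0 <= 1 - t by rewrite subr_ge0.
  by have mu0 := mu_ge0 HP; apply: mulr_ge0 (nsq_ge0 _); nonneg_tac.
have H3 := ler_wpM2l (_ : 0 <= 1 - t) Hz; rewrite subr_ge0 in H3.
have {}H3 := H3 (andP t01).2.
apply: (@le_trans _ _ (t * (favg P (y k.+1) + psr (y k.+1)) + (1 - t) * (favg P z + psr z))).
  by move: H1 H2 N0; lra.
apply: (le_trans (lerD (lexx _) H3)).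
rewrite le_eqVlt; apply/orP; left; apply/eqP; rewrite /t; field.
by rewrite !gt_eqF.
Qed.

(** Jensen's inequality for each outcome. Optimality of [xstar] makes the left integrand
    nonnegative, so its measurability suffices to compare the integrals. *)
Lemma expected_gap_le k : dom (psi P) (x_init A) -> eta A <= 1 / bigM A ->
  (expected_gap A k <= ((weight_sum A k)^-1 * wsum (rho A) (gS A) k.+1)%:E)%E.
Proof.
move=> dx0 step.
have w0 i : 0 < weight A i by exact: (wt_gt0 rho_lt1).
have H w := jensen k w0 (fun i => dom_xk HA dx0 i w).
have W0 : 0 <= (weight_sum A k)^-1.
  by rewrite invr_ge0 sumr_ge0// => i _; exact: ltW.
have Lg i : L1 (Pr A) (fun w => weight A i * gap i w).
  by apply: L1Z; exact: gap_L1.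
have LS : L1 (Pr A) (fun w => (weight_sum A k)^-1 * \sum_(i < k.+1) weight A i * gap i w).
  by apply: L1Z; apply: L1_sum => i; exact: Lg.
have ES : ((weight_sum A k)^-1 * wsum (rho A) (gS A) k.+1) =
   E (fun w => (weight_sum A k)^-1 * \sum_(i < k.+1) weight A i * gap i w).
  rewrite ExZ; last by apply: L1_sum => i; exact: Lg.
  rewrite Ex_sum => [|i]; last exact: Lg.
  by congr (_ * _); apply: eq_bigr => i _; rewrite ExZ//; exact: gap_L1.
rewrite ES -L1_integral// /expected_gap.
have objE w : (objective P (xbar k w) - objective P xs)%E =
    (favg P (xbar k w) + psr (xbar k w) - (favg P xs + psr xs))%:E.
  by rewrite !objective_dom ?EFinB//; [exact: dom_xs|exact: (H w).1].
have W1 : (weight_sum A k)^-1 * weight_sum A k = 1.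
  rewrite mulVf// gt_eqF// /weight_sum big_ord_recl ltr_pwDl//.
  by apply: sumr_ge0 => i _; exact: ltW.
have bnd w : favg P (xbar k w) + psr (xbar k w) - (favg P xs + psr xs) <=
   (weight_sum A k)^-1 * \sum_(i < k.+1) weight A i * gap i w.
  have [_ Hw] := H w.
  rewrite lerBlDr; apply: (le_trans Hw).
  rewrite /gap; under [in leRHS]eq_bigr do rewrite mulrBr.
  rewrite sumrB -mulr_suml mulrBr -/(weight_sum A k) [X in _ - X]mulrA W1 mul1r subrK.
  by [].
under eq_integral do rewrite objE.
apply: ge0_le_integral => //.
- move=> w _; rewrite lee_fin subr_ge0.
  have := xstar_opt HP (xbar k w).
  by rewrite (objective_dom dom_xs) (objective_dom (H w).1) lee_fin.
- apply/measurable_EFinP.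
  have mX : vmeas (@xbar R A k).
    apply: vmeasZ; apply: vmeas_sum => i; apply: vmeasZ.
    exact: (adapted_vmeas (evs_meas HA) (good_x HA i).1).
  apply: measurable_funB => //; apply: measurable_funD.
    exact: (vmeas_comp_cont mX (smooth_continuous (favg_smooth HP))).
  apply/measurable_EFinP.
  have -> : (EFin \o (fun w => psr (xbar k w))) = (fun w => psi P (xbar k w)).
    by apply/funext => w /=; rewrite -psirE//; [exact: (psi_proper HP)|exact: (H w).1].
  exact: (measurableT_comp (lsc_measurable (psi_closed HP)) ((vmeas_borel _).1 mX)).
- exact: (measurable_int _ LS).
- by move=> w _; rewrite lee_fin; exact: bnd.
Qed.

End ExpectedGap.

(** * Explicit bounds, and the size of M *)

Section Bounds.
Context (R : realType) (A : ec_lsvrg R).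
Hypothesis HA : ec_lsvrg_assumptions A.

Notation n := (nodes A).
Notation P := (pb A).

Let HP : erm_assumptions P := A_problem HA.
Let eta0 := A_eta HA.
Let n0 : 0 < n%:R :> R. Proof. by rewrite ltr0n (n_gt0 HP). Qed.
Let Lf0 := Lf_gt0 HP.
Let p0 : 0 < prob_w A. Proof. by case/andP: (A_p HA). Qed.
Let dl0 : 0 < delta A. Proof. by case: (A_compressor HA) => /andP[]. Qed.
Let dl1 : 0 <= 1 - delta A.
Proof. by rewrite subr_ge0; case: (A_compressor HA) => /andP[]. Qed.
Let d10 : 0 < delta1 A. Proof. by case: (A_compressor1 HA) => /andP[]. Qed.
Let L0 := L_ge0 HP.
Let Lb0 := Lbar_ge0 HP.

Lemma init_gap_fin : dom (psi P) (x_init A) -> init_gap A = (gap0 A)%:E.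
Proof.
move=> dx0; rewrite /init_gap (objective_dom HA dx0) (objective_dom HA (dom_xs HA)).
by rewrite -EFinB.
Qed.

Lemma init_gap_infty : ~~ (psi P (x_init A) < +oo)%E -> init_gap A = +oo%E.
Proof.
rewrite ltNge negbK leye_eq => /eqP E.
by rewrite /init_gap (objective_dom HA (dom_xs HA)) /objective E.
Qed.

Lemma gap0_ge0 : dom (psi P) (x_init A) -> 0 <= gap0 A.
Proof.
move=> dx0; have := xstar_opt HP (x_init A).
by rewrite (objective_dom HA dx0) (objective_dom HA (dom_xs HA)) lee_fin subr_ge0.
Qed.

Lemma init_dist_ge0 : 0 <= init_dist A. Proof. exact: sqr_ge0. Qed.
Lemma init_grad_ge0 : 0 <= init_grad A. Proof. exact: sqr_ge0. Qed.
Lemma init_shift_ge0 : 0 <= init_shift A.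
Proof. by apply: sumr_ge0 => i _; exact: sqr_ge0. Qed.

(** The geometric sum, in the form that produces the factor [(1 - rho)^k / (1 - (1 - rho)^(k+1))] of
    the linear rate. *)
Lemma weight_sumE k :
  rho A * weight_sum A k * (1 - rho A) ^+ k = 1 - (1 - rho A) ^+ k.+1.
Proof.
rewrite /weight_sum /weight; have := rho_lt1 HA; move: (rho A) => r r1.
have N : 1 - r != 0 by rewrite gt_eqF// subr_gt0.
elim: k => [|k IH]; first by rewrite big_ord1 !expr0 invr1; ring.
rewrite big_ord_recr/=; set s := \sum_(_ < _) _ in IH *.
have -> : r * (s + (1 - r) ^- k.+1) * (1 - r) ^+ k.+1 =
    (1 - r) * (r * s * (1 - r) ^+ k) + r * ((1 - r) ^- k.+1 * (1 - r) ^+ k.+1).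
  by rewrite exprS; ring.
by rewrite IH mulVf ?expf_neq0// !exprS; ring.
Qed.

Lemma gap_strong : eta A <= 1 / bigM A -> 0 < sc_mu P -> forall k : nat,
  (expected_gap A k <=
    Delta0 A * ((1 - (1 - rho A) ^+ k.+1)^-1 * (1 - rho A) ^+ k)%:E)%E.
Proof.
move=> step mu0 k.
have r0 : 0 < rho A.
  by rewrite /rho !lt_min !divr_gt0// mulr_gt0.
have r1 := rho_lt1 HA.
have q0 : 0 < 1 - rho A by rewrite subr_gt0.
have q1 : 1 - rho A < 1 by rewrite gtrBl.
have c0 : 0 < (1 - (1 - rho A) ^+ k.+1)^-1 * (1 - rho A) ^+ k.
  by rewrite mulr_gt0 ?exprn_gt0// invr_gt0 subr_gt0 exprn_ilt1// ltW.
(* Outside the domain of [psi] the initial gap, hence [Delta0], is infinite, and a positive factor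
   keeps the right side at [+oo]. *)
have [dx0|ndx0] := boolP (psi P (x_init A) < +oo)%E; last first.
  rewrite /Delta0 (init_gap_infty ndx0) gt0_muley ?lte_fin; last lra.
  by rewrite addey// addye// gt0_mulye ?lte_fin// leey.
apply: (le_trans (expected_gap_le HA k dx0 step)).
rewrite /Delta0 (init_gap_fin dx0) -EFinM lee_fin.
have W0 : 0 < weight_sum A k.
  rewrite /weight_sum big_ord_recl ltr_pwDl ?(wt_gt0 r1)// sumr_ge0// => i _.
  exact: ltW (wt_gt0 r1 _).
have WE : (weight_sum A k)^-1 =
    rho A * ((1 - (1 - rho A) ^+ k.+1)^-1 * (1 - rho A) ^+ k).
  by rewrite -weight_sumE; field; rewrite !gt_eqF// exprn_gt0.
rewrite WE mulrAC ler_wpM2r ?(ltW c0)//.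
apply: (le_trans (ler_wpM2l (ltW r0) (weighted_gap_bound HA dx0 step k))).
have G0 := gap0_ge0 dx0.
(* The division by the weights supplies a factor [rho]: [rho <= p / 4] turns 2/p into 1/2 and 6/(5
   Lf p) into 3/(10 Lf), and [rho <= mu * eta / 3] turns 9/(8 eta) into 3 mu/8. *)
have H1 : rho A * (2 / prob_w A * gap0 A) <= 1 / 2 * gap0 A.
  rewrite mulrA ler_wpM2r// mulrA ler_pdivrMr//.
  by have := rho_le_p A; lra.
have H2 : rho A * (9 / (8 * eta A) * init_dist A) <= sc_mu P / 2 * init_dist A.
  rewrite mulrA ler_wpM2r ?init_dist_ge0// mulrA ler_pdivrMr ?mulr_gt0//.
  have := rho_le_mu A; have := mulr_gt0 mu0 eta0; lra.
have H3 : rho A * (6 / (5 * smLf P * prob_w A) * (n%:R^-1 * init_shift A)) <=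
    3 / (10 * smLf P * n%:R) * init_shift A.
  have -> : rho A * (6 / (5 * smLf P * prob_w A) * (n%:R^-1 * init_shift A)) =
      rho A * (6 / (5 * smLf P * prob_w A) / n%:R) * init_shift A.
    by field; rewrite !gt_eqF.
  rewrite ler_wpM2r ?init_shift_ge0//.
  have -> : 3 / (10 * smLf P * n%:R) =
      prob_w A / 4 * (6 / (5 * smLf P * prob_w A) / n%:R).
    by field; rewrite !gt_eqF.
  rewrite ler_wpM2r ?rho_le_p//.
  have Lf1 := Lf0; have p1 := p0; have n1 := n0; by nonneg_tac.
have H4 : 0 <= 1 / (40 * smLf P) * init_grad A.
  have g0 := init_grad_ge0; have Lf1 := Lf0; by nonneg_tac.
by move: H1 H2 H3 H4; rewrite !mulrDr; lra.
Qed.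

Lemma gap_convex : eta A <= 1 / bigM A -> sc_mu P = 0 -> forall k : nat,
  (expected_gap A k <= (1 / k.+1%:R)%:E *
    ((9 / (8 * eta A) * init_dist A
      + 1 / (10 * smLf P * prob_w A) * init_grad A
      + 6 / (5 * smLf P * prob_w A * n%:R) * init_shift A)%:E
     + (8 / (3 * prob_w A))%:E * init_gap A))%E.
Proof.
move=> step mu0 k.
have r0 : rho A = 0.
  rewrite /rho mu0 !mul0r min_l// !le_min.
  by rewrite !divr_ge0// ltW.
have [dx0|ndx0] := boolP (psi P (x_init A) < +oo)%E; last first.
  rewrite (init_gap_infty ndx0) gt0_muley ?lte_fin ?divr_gt0 ?mulr_gt0//.
  by rewrite addey// gt0_muley ?lte_fin// ?leey// divr_gt0.
apply: (le_trans (expected_gap_le HA k dx0 step)).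
rewrite (init_gap_fin dx0) -EFinM lee_fin.
have -> : weight_sum A k = k.+1%:R.
  rewrite /weight_sum; under eq_bigr do rewrite /weight r0 subr0 expr1n invr1.
  by rewrite sumr_const card_ord.
rewrite mul1r ler_wpM2l ?invr_ge0//.
apply: (le_trans (weighted_gap_bound HA dx0 step k)).
have G0 := gap0_ge0 dx0.
have H1 : 2 / prob_w A * gap0 A <= 8 / (3 * prob_w A) * gap0 A.
  rewrite ler_wpM2r// invfM mulrA ler_wpM2r ?invr_ge0 ?(ltW p0)//; lra.
have H4 : 0 <= 1 / (10 * smLf P * prob_w A) * init_grad A.
  have g0 := init_grad_ge0; have Lf1 := Lf0; have p1 := p0; by nonneg_tac.
have -> : 6 / (5 * smLf P * prob_w A * n%:R) * init_shift A =
   6 / (5 * smLf P * prob_w A) * (n%:R^-1 * init_shift A).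
  by field; rewrite !gt_eqF.
by move: H1 H4; lra.
Qed.

(** Bregman distances of the nodes are nonnegative and sum to [n] times that of the average, so each
    alone obeys the quadratic bound with [n * smLf]. *)
Lemma fnode_smooth_sum i : smooth (n%:R * smLf P) (fnode P i).
Proof.
apply: smooth_of_bregman.
- by rewrite mulr_ge0 ?ltW.
- exact: (fnode_smooth HP i).1.
move=> u v.
have B j : 0 <= bregman (fnode P j) u v.
  exact: bregman_ge0 Lb0 (fnode_smooth HP j) (fnode_convex HA j).
rewrite B/=.
have := bregman_le u v (ltW Lf0) (favg_smooth HP).
rewrite (bregman_favg HA) ler_pdivrMl//.
have : bregman (fnode P i) u v <= \sum_(j < n) bregman (fnode P j) u v.
  by rewrite (bigD1 i)//= lerDl sumr_ge0.
by move=> /le_trans + H; move=> /(_ _ H); rewrite !mulrA.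
Qed.

Lemma Lbar_le : Lbar_tight A -> smLbar P <= n%:R * smLf P.
Proof.
move=> [H|//]; apply: H; first by rewrite mulr_ge0 ?ltW.
exact: fnode_smooth_sum.
Qed.

(** 3840 = 418 + 3422 and 22035 = 1671 + 20364: once [smLbar / n] is replaced by [smLf], the paired
    terms of [bigM] merge, and [prob_w / delta1] is replaced by [c]. *)
Definition rate_const (c : R) : R := 3840 + 22035 * (c * (1 + 2 * c)).

Lemma bigM_le (c : R) : 0 < c -> Lbar_tight A -> prob_w A <= c * delta1 A ->
  bigM A <= rate_const c * (smLf P + smL P / n%:R
    + (1 - delta A) * smLf P / delta A ^+ 2 + (1 - delta A) * smL P / (n%:R * delta A)).
Proof.
move=> c0 /Lbar_le Lt pc.
have LbN : smLbar P / n%:R <= smLf P by rewrite ler_pdivrMr// mulrC.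
have pd : prob_w A / delta1 A <= c by rewrite ler_pdivrMr.
have pd0 : 0 <= prob_w A / delta1 A by rewrite divr_ge0// ltW.
set r := prob_w A / delta1 A in pd pd0.
set b := smLbar P / n%:R in LbN.
set l := smL P / n%:R.
have l0 : 0 <= l by rewrite divr_ge0// ltW.
have b0 : 0 <= b by rewrite divr_ge0// ltW.
set k := (1 - delta A) / delta A.
have k0 : 0 <= k by rewrite divr_ge0// ltW.
set i := (delta A)^-1.
have i0 : 0 <= i by rewrite invr_ge0 ltW.
have -> : bigM A = k * (418 * (smLf P * i) + 3422 * (b * i) + 1349 * l
   + (1671 * smLf P + 20364 * b) * i * (r * (1 + 2 * r))) + 4 * smLf P + 42 * l.
  by rewrite /bigM /k /i /r /b /l; field; rewrite !gt_eqF.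
have -> : smLf P + smL P / n%:R + (1 - delta A) * smLf P / delta A ^+ 2
   + (1 - delta A) * smL P / (n%:R * delta A) =
   smLf P + l + k * (smLf P * i) + k * l.
  by rewrite /l /k /i; field; rewrite !gt_eqF.
have rr : r * (1 + 2 * r) <= c * (1 + 2 * c).
  by apply: ler_pM => //; [lra|lra].
have cc0 : 0 <= c * (1 + 2 * c) by rewrite mulr_ge0; lra.
have bi : b * i <= smLf P * i by rewrite ler_wpM2r.
have Li0 : 0 <= smLf P * i by rewrite mulr_ge0 ?(ltW Lf0).
have H1 (u v : R) : 0 <= u -> 0 <= v ->
    (u * smLf P + v * b) * i * (r * (1 + 2 * r)) <=
    (u + v) * (smLf P * i) * (c * (1 + 2 * c)).
  move=> u0 v0; apply: ler_pM => //.
  - by rewrite mulr_ge0// addr_ge0// mulr_ge0// ltW.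
  - by rewrite mulr_ge0//; lra.
  - by have := ler_wpM2l v0 bi; lra.
have {}H1 := H1 1671 20364 (ler0n _ _) (ler0n _ _).
set q := r * (1 + 2 * r) in H1 *; set s := c * (1 + 2 * c) in cc0 H1.
have H2 := ler_wpM2l k0 H1; have H3 := ler_wpM2l k0 bi.
have P1 : 0 <= k * l by rewrite mulr_ge0.
have P2 : 0 <= s * (smLf P + l + k * l).
  by rewrite mulr_ge0// !addr_ge0// ltW.
rewrite /rate_const -/s.
have P3 := ltW Lf0.
move: P3 l0 k0 i0 b0 H2 H3 P1 P2.
move: (smLf P) => Lf'; clearbody l k i b q s => P3 l0 k0 i0 b0 H2 H3 P1 P2.
by clear -P3 l0 H2 H3 P1 P2; lra.
Qed.

End Bounds.

(** * Iteration complexity *)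

Section Complexity.
Context (R : realType).

Lemma exprn_le_expR (r : R) k : r <= 1 -> (1 - r) ^+ k <= expR (- (k%:R * r)).
Proof.
move=> r1; rewrite -mulrN expRM_natl lerXn2r ?nnegrE ?subr_ge0 ?expR_ge0//.
exact: expR_ge1Dx.
Qed.

Lemma rate_const_gt0 (c : R) : 0 < c -> 0 < rate_const c.
Proof.
move=> c0; rewrite /rate_const.
have s0 : 0 <= c * (1 + 2 * c).
  by apply: mulr_ge0; [exact: ltW|apply: addr_ge0; [|exact: mulr_ge0 (ltW _)]].
apply: ltr_pwDl; first by rewrite ltr0n.
by apply: mulr_ge0 s0; rewrite ler0n.
Qed.

Context (A : ec_lsvrg R) (c : R).
Hypothesis HA : ec_lsvrg_assumptions A.
Hypothesis c0 : 0 < c.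
Hypothesis Lt : Lbar_tight A.
Hypothesis eta_eq : eta A = 1 / bigM A.
Hypothesis pc : prob_w A <= c * delta1 A.

Notation n := (nodes A).
Notation P := (pb A).

Let HP : erm_assumptions P := A_problem HA.
Let n0 : 0 < n%:R :> R. Proof. by rewrite ltr0n (n_gt0 HP). Qed.
Let Lf0 := Lf_gt0 HP.
Let L0 := L_ge0 HP.
Let p0 : 0 < prob_w A. Proof. by case/andP: (A_p HA). Qed.
Let dl0 : 0 < delta A. Proof. by case: (A_compressor HA) => /andP[]. Qed.
Let dl1 : 0 <= 1 - delta A.
Proof. by rewrite subr_ge0; case: (A_compressor HA) => /andP[]. Qed.
Let d10 : 0 < delta1 A. Proof. by case: (A_compressor1 HA) => /andP[]. Qed.
Let M0 := bigM_gt0 HA.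

(** The inverse of each entry of the minimum is bounded: [3 * bigM / mu] by [3 * rate_const c],
    [4 / delta] and [4 / p] by the summand 4, and [4 / delta1 <= 4 * c / p] by the summand
    [4 * c]. *)
Lemma rho_complexity : 0 < sc_mu P ->
  1 <= rho A * ((3 * rate_const c + 4 + 4 * c) * complexity_strong A).
Proof.
move=> mu0; have K0 := rate_const_gt0 c0; have HM := bigM_le HA c0 Lt pc.
move: (rate_const c) K0 HM => K K0 HM.
set T := complexity_strong A.
set X := (smLf P + _ + _ + _) in HM.
have X0 : 0 <= X.
  have := Lf0; have := L0; have := n0; have := dl0; have := dl1 => a1 a2 a3 a4 a5.
  by rewrite /X; nonneg_tac.
have TE : T = 1 / delta A + 1 / prob_w A + X / sc_mu P.
  by rewrite /T /complexity_strong /X; field; rewrite !gt_eqF.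
have a0 : 0 < 1 / delta A by rewrite divr_gt0.
have b0 : 0 < 1 / prob_w A by rewrite divr_gt0.
have x0 : 0 <= X / sc_mu P := divr_ge0 X0 (ltW mu0).
set a := 1 / delta A in a0 TE; set b := 1 / prob_w A in b0 TE.
set x := X / sc_mu P in x0 TE.
set C := 3 * K + 4 + 4 * c.
have T0 : 0 < C * T.
  rewrite TE; apply: mulr_gt0.
    by rewrite /C; move: K0 c0; lra.
  by move: a0 b0 x0; lra.
have KX : 0 <= K * a /\ 0 <= K * b /\ 0 <= K * x.
  by do 2?split; apply: mulr_ge0 => //; exact: ltW.
have cX : 0 <= c * a /\ 0 <= c * b /\ 0 <= c * x.
  by do 2?split; apply: mulr_ge0 => //; exact: ltW.
have CT : 3 * (K * x) <= C * T /\ 4 * a <= C * T /\ 4 * b <= C * T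
    /\ 4 * (c * b) <= C * T.
  by rewrite TE /C; lra.
have inv (y : R) : 0 < y -> y^-1 <= C * T -> (C * T)^-1 <= y.
  by move=> y0 H; rewrite -[leRHS]invrK lef_pV2 ?posrE ?invr_gt0.
rewrite -ler_pdivrMr// div1r /rho !le_min; apply/and4P; split; apply: inv.
- by rewrite !mulr_gt0 ?invr_gt0// (A_eta HA).
- apply: le_trans CT.1; rewrite eta_eq.
  have -> : (sc_mu P * (1 / bigM A) / 3)^-1 = 3 * (bigM A / sc_mu P).
    by field; rewrite !gt_eqF.
  by rewrite ler_pM2l// /x mulrA ler_pM2r ?invr_gt0.
- by rewrite divr_gt0.
- by apply: le_trans CT.2.1; rewrite /a invf_div mul1r.
- by rewrite divr_gt0.
- apply: le_trans CT.2.2.2; rewrite invf_div ler_pM2l// /b.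
  by rewrite mulrA mulr1 ler_pdivlMr// mulrC ler_pdivrMr.
- by rewrite divr_gt0.
- by apply: le_trans CT.2.2.1; rewrite /b invf_div mul1r.
Qed.

(** The lower bound [l1] on the logarithm lets the additive constant [2 * D] be absorbed into a
    multiple of it. Then [k * rho >= ln (1 / eps) + 2 * D], so [(1 - rho)^k] is at most
    [eps / (1 + 2 * D)]; this makes the denominator at least 1/2 and the numerator at most
    [eps / 2]. *)
Lemma rate_le (D l1 eps : R) k : 1 <= D -> 0 < sc_mu P -> 0 < l1 -> 0 < eps <= 1 ->
  l1 <= ln (1 / eps) ->
  (3 * rate_const c + 4 + 4 * c) * (1 + 2 * D / l1) *
     (complexity_strong A * ln (1 / eps)) <= k%:R ->
  D * ((1 - (1 - rho A) ^+ k.+1)^-1 * (1 - rho A) ^+ k) <= eps.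
Proof.
move=> D1 mu0 l10 /andP[e0 e1] le_l; have := rho_complexity mu0.
set C := 3 * _ + _ + _; set l := ln _ in le_l *; set T := complexity_strong A.
move=> CT Hk; have r0 := rho_ge0 HA; have r1 := rho_lt1 HA.
have l0 : 0 < l := lt_le_trans l10 le_l.
have B0 : 0 <= 1 + 2 * D / l1 by rewrite addr_ge0// divr_ge0 ?(ltW l10)//; lra.
have Bl : l + 2 * D <= (1 + 2 * D / l1) * l.
  rewrite [leRHS]mulrDl mul1r lerD2l mulrAC ler_pdivlMr// ler_wpM2l//; lra.
have rk : l + 2 * D <= k%:R * rho A.
  apply: le_trans (ler_wpM2r r0 Hk); apply: (le_trans Bl).
  have -> : C * (1 + 2 * D / l1) * (T * l) * rho A =
     rho A * (C * T) * ((1 + 2 * D / l1) * l) by ring.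
  by rewrite ler_peMl// mulr_ge0// ltW.
have qk : (1 - rho A) ^+ k <= eps / (1 + 2 * D).
  apply: (le_trans (exprn_le_expR k (ltW r1))).
  apply: (@le_trans _ _ (expR (- (l + 2 * D)))); first by rewrite ler_expR lerN2.
  (* [expR (2 * D) >= 1 + 2 * D] turns the additive surplus into the denominator. *)
  rewrite opprD expRD ler_pM ?expR_ge0//.
    by rewrite expRN lnK ?posrE ?divr_gt0// div1r invrK.
  by rewrite expRN lef_pV2 ?posrE ?expR_gt0 ?expR_ge1Dx//; lra.
set q := (1 - rho A) ^+ k in qk *.
have q0 : 0 <= q by rewrite exprn_ge0// subr_ge0 ltW.
have D2 : 0 < 1 + 2 * D by lra.
have qD : q * (1 + 2 * D) <= eps by rewrite -ler_pdivlMr.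
have qD0 : q <= q * D by rewrite ler_peMr.
have q2 : q <= 1 / 2 by lra.
have qS : (1 - rho A) ^+ k.+1 <= q by rewrite exprSr ler_piMr//; lra.
rewrite mulrCA ler_pdivrMl; last by move: qS q2; lra.
apply: (@le_trans _ _ (1 / 2 * eps)); first by lra.
by rewrite ler_wpM2r ?(ltW e0)//; lra.
Qed.

Lemma expected_gap_strong (D eps1 eps : R) k : 0 < eps1 < 1 ->
  0 < sc_mu P -> (Delta0 A <= D%:E)%E -> 0 < eps <= eps1 ->
  (3 * rate_const c + 4 + 4 * c) * (1 + 2 * Num.max D 1 / ln (1 / eps1)) *
     (complexity_strong A * ln (1 / eps)) <= k%:R ->
  (expected_gap A k <= eps%:E)%E.
Proof.
move=> /andP[e10 e11] mu0 DD /andP[e0 ee1] Hk.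
have q0 : 0 <= (1 - (1 - rho A) ^+ k.+1)^-1 * (1 - rho A) ^+ k.
  have r0 := rho_ge0 HA; have r1 := rho_lt1 HA.
  by rewrite mulr_ge0 ?invr_ge0 ?exprn_ge0 ?subr_ge0 ?exprn_ile1//; lra.
apply: (le_trans (gap_strong HA _ mu0 k)); first by rewrite eta_eq.
apply: (@le_trans _ _ ((Num.max D 1)%:E *
    ((1 - (1 - rho A) ^+ k.+1)^-1 * (1 - rho A) ^+ k)%:E)%E).
  rewrite lee_wpmul2r ?lee_fin// (le_trans DD)// lee_fin le_max lexx//.
rewrite -EFinM lee_fin; apply: rate_le Hk => //.
- by rewrite le_max lexx orbT.
- by rewrite ln_gt0// div1r invf_gt1.
- by rewrite e0 (le_trans ee1)// ltW.
- by rewrite ler_ln ?posrE ?divr_gt0// !div1r lef_pV2 ?posrE.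
Qed.

Lemma expected_gap_convex (D eps : R) k :
  sc_mu P = 0 -> (initial_error A <= D%:E)%E -> 0 < eps ->
  (2 * rate_const c + 3) * Num.max D 1 * (complexity_convex A * (1 / eps)) <= k%:R ->
  (expected_gap A k <= eps%:E)%E.
Proof.
move=> mu0 ID e0 Hk.
have dx0 : dom (psi P) (x_init A).
  rewrite /dom/=; apply: contraT => N; move: ID.
  by rewrite /initial_error (init_gap_infty HA N).
have step : eta A <= 1 / bigM A by rewrite eta_eq.
apply: (le_trans (gap_convex HA step mu0 k)).
rewrite (init_gap_fin HA dx0) -EFinM lee_fin.
move: ID; rewrite /initial_error (init_gap_fin HA dx0) lee_fin.
have g0 := gap0_ge0 HA dx0.
have ge0a := init_dist_ge0 A; have ge0b := init_grad_ge0 A; have ge0s := init_shift_ge0 A.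
have b0 : 0 <= init_grad A / smLf P by rewrite divr_ge0// ltW.
have s0 : 0 <= init_shift A / (smLf P * n%:R) by rewrite divr_ge0// mulr_ge0// ltW.
have -> : 9 / (8 * eta A) * init_dist A = 9 / 8 * bigM A * init_dist A.
  by rewrite eta_eq; field; rewrite !gt_eqF.
have -> : 1 / (10 * smLf P * prob_w A) * init_grad A =
   1 / 10 * (1 / prob_w A) * (init_grad A / smLf P).
  by field; rewrite !gt_eqF.
have -> : 6 / (5 * smLf P * prob_w A * n%:R) * init_shift A =
   6 / 5 * (1 / prob_w A) * (init_shift A / (smLf P * n%:R)).
  by field; rewrite !gt_eqF.
have -> : 8 / (3 * prob_w A) = 8 / 3 * (1 / prob_w A).
  by field; rewrite !gt_eqF.
have K0 := rate_const_gt0 c0; have HM := bigM_le HA c0 Lt pc.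
have TE : complexity_convex A = 1 / prob_w A + (smLf P + smL P / n%:R
    + (1 - delta A) * smLf P / delta A ^+ 2
    + (1 - delta A) * smL P / (n%:R * delta A)).
  by rewrite /complexity_convex !addrA.
set X := (smLf P + _ + _ + _) in HM TE.
have X0 : 0 <= X.
  have := Lf0; have := L0; have := n0; have := dl0; have := dl1 => a1 a2 a3 a4 a5.
  by rewrite /X; nonneg_tac.
rewrite TE in Hk.
have D0 : 0 < Num.max D 1 by rewrite lt_max ltr01 orbT.
have : D <= Num.max D 1 by rewrite le_max lexx.
have y0 : 0 < 1 / prob_w A by rewrite divr_gt0.
move: (Num.max D 1) D0 Hk => D' D'0 Hk DD' ID.
move: (rate_const c) K0 HM Hk => K K0 HM Hk.
move: (1 / prob_w A) y0 Hk => y y0 Hk.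
(* The bound to be met has [k + 1] in its denominator, so [k] may be enlarged by one. The constant
   suffices because 9/8 <= 2 for the term with [bigM] and 8/3 <= 3 for those with [1 / p]. *)
have {}Hk : (2 * K + 3) * D' * (y + X) <= eps * k.+1%:R.
  rewrite [leRHS]mulrC -ler_pdivrMr//; move: Hk; rewrite div1r !mulrA.
  by move=> /le_trans; apply; rewrite ler_nat.
rewrite mulrAC mul1r ler_pdivrMr//; apply: le_trans Hk.
move: (init_grad A / _) (init_shift A / _) b0 s0 ID => b s b0 s0 ID.
move: (init_dist A) (gap0 A) ge0a g0 ID => a g a0 g0 ID.
have M1 := ltW M0.
have a1 : a <= D' by lra.
have H1 : bigM A * a <= K * X * D' by apply: ler_pM.
have H2 : y * (a + g + (b + s)) <= y * D' by rewrite ler_pM2l//; lra.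
have z1 : 0 <= K * X * D' by rewrite !mulr_ge0// ltW.
have z2 : 0 <= X * D' by rewrite !mulr_ge0// ltW.
have z3 : 0 <= K * y * D' by rewrite !mulr_ge0// ltW.
have z4 : 0 <= y * a by rewrite !mulr_ge0// ltW.
have z5 : 0 <= y * b by rewrite !mulr_ge0// ltW.
have z6 : 0 <= y * s by rewrite !mulr_ge0// ltW.
have z7 : 0 <= y * g by rewrite !mulr_ge0// ltW.
by move: (bigM A) H1 => M H1; lra.
Qed.

End Complexity.

Theorem theorem2p6 (R : realType) :
  (* (i) *)
  (forall A : ec_lsvrg R,
     ec_lsvrg_assumptions A -> eta A <= 1 / bigM A ->
     (0 < sc_mu (pb A) -> forall k : nat,
        (expected_gap A k <=
           Delta0 A * ((1 - (1 - rho A) ^+ k.+1)^-1 * (1 - rho A) ^+ k)%:E)%E)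
     /\
     (sc_mu (pb A) = 0 -> forall k : nat,
        (expected_gap A k <=
           (1 / k.+1%:R)%:E *
           ((9 / (8 * eta A) * init_dist A
             + 1 / (10 * smLf (pb A) * prob_w A) * init_grad A
             + 6 / (5 * smLf (pb A) * prob_w A * (nodes A)%:R) * init_shift A)%:E
            + (8 / (3 * prob_w A))%:E * init_gap A))%E))
  /\
  (* (ii), mu > 0 : p <= c * delta1; the constant C of k >= O(.) depends only on
     c, on a bound D for Delta0, and on how far below 1 eps stays *)
  (forall c D eps1 : R, 0 < c -> 0 < eps1 < 1 ->
     exists2 C : R, 0 < C &
     forall A : ec_lsvrg R,
       ec_lsvrg_assumptions A -> Lbar_tight A ->
       eta A = 1 / bigM A -> prob_w A <= c * delta1 A ->
       0 < sc_mu (pb A) -> (Delta0 A <= D%:E)%E ->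
       forall eps : R, 0 < eps <= eps1 -> (eps%:E <= Delta0 A)%E ->
       forall k : nat, C * (complexity_strong A * ln (1 / eps)) <= k%:R ->
         (expected_gap A k <= eps%:E)%E)
  /\
  (* (ii), mu = 0 : the constant C depends only on c and on a bound D for the
     initial error *)
  (forall c D : R, 0 < c ->
     exists2 C : R, 0 < C &
     forall A : ec_lsvrg R,
       ec_lsvrg_assumptions A -> Lbar_tight A ->
       eta A = 1 / bigM A -> prob_w A <= c * delta1 A ->
       sc_mu (pb A) = 0 -> (initial_error A <= D%:E)%E ->
       forall eps : R, 0 < eps ->
       forall k : nat, C * (complexity_convex A * (1 / eps)) <= k%:R ->
         (expected_gap A k <= eps%:E)%E).
Proof.
split; [|split].
- move=> A HA step; split=> [mu0|mu0] k; first exact: gap_strong.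
  exact: gap_convex.
- move=> c D eps1 c0 /andP[e10 e11].
  have l0 : 0 < ln (1 / eps1) by rewrite ln_gt0// div1r invf_gt1.
  exists ((3 * rate_const c + 4 + 4 * c) * (1 + 2 * Num.max D 1 / ln (1 / eps1))).
    have K0 := rate_const_gt0 c0.
    have D0 : 0 <= 2 * Num.max D 1 / ln (1 / eps1).
      by rewrite divr_ge0 ?(ltW l0)// mulr_ge0// le_max ler01 orbT.
    apply: mulr_gt0; last by rewrite ltr_pwDl.
    by move: (rate_const c) K0 => K K0; rewrite !addr_gt0 ?mulr_gt0.
  move=> A HA Lt eta_eq pc mu0 DD eps e01 _ k.
  by apply: (expected_gap_strong HA c0 Lt eta_eq pc _ mu0 DD e01); rewrite e10.
move=> c D c0; exists ((2 * rate_const c + 3) * Num.max D 1).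
  have K0 := rate_const_gt0 c0.
  apply: mulr_gt0; last by rewrite lt_max ltr01 orbT.
  by move: (rate_const c) K0 => K K0; rewrite addr_gt0 ?mulr_gt0.
move=> A HA Lt eta_eq pc mu0 ID eps e0 k.
exact: (expected_gap_convex HA c0 Lt eta_eq pc mu0 ID e0).
Qed.
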